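(* In the setting of the context, suppose that, conditionally on $\xi$: (1) $A(x,y)$ is stationary in $y$; (2) the map $(s_1,s_2)\mapsto\mathrm{Cov}_\xi(s_1,s_2,0)$ is continuous at $(x,x)$ for every $x\in[0,1]$; (3) $A^{-1}$ satisfies the mixing condition stated in the context; (4) there is a constant $C_\xi$ with $$\mathbb E_\xi\left\{\left(\frac1{A(x,y)}-\mathbb E_\xi\left\{\frac1{A(x,y)}\right\}\right)^6\right\}\le C_\xi<\infty .$$ Then, with $\xi$ fixed, as $\varepsilon\to0$, for $x\in[0,1]$, $$\frac{u_\varepsilon(x)-u_0(x)}{\sqrt\varepsilon}\ \xrightarrow{\text{dist.}}\ v(x):=\int_0^1G(x,t)\,\sigma(t)\,dW_t,$$ where $W_t$ is a one-dimensional Brownian motion and $$\sigma^2(t)=\int_{-\infty}^\infty\mathrm{Cov}_\xi(t,t,q)\,dq .$$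
   Context: $(\Omega,\mathcal S,P)$ is a probability space, $\xi$ is a random vector on it, $P_\xi=P[\,\cdot\mid\xi]$ and $\mathbb E_\xi\{X\}=\mathbb E\{X\mid\xi\}$. $A(x,y)=A(x,y,\omega)$, $x\in[0,1]$, $y\in[0,\infty)$, is a random field, and for $\varepsilon>0$, $A_\varepsilon(x):=A(x,x/\varepsilon)$. Pathwise ellipticity: $0<\nu_1(\omega,\varepsilon)\le A_\varepsilon(x)\le\nu_2(\omega,\varepsilon)<\infty$. Standing assumptions on $A^{-1}$: $\mathbb E_\xi\{A^{-1}(x,y)\}$ does not depend on $y$ (written $\mathbb E_\xi\{A^{-1}\}(x)$), and $$0<c_1(\xi)\le \mathbb E_\xi\{A^{-1}(x,y)\}=\mathbb E_\xi\{A^{-1}(x,0)\}=:A_0(x)^{-1}\le c_2<\infty .$$ The conditional covariance $$\mathrm{Cov}_\xi(x_1,x_2,z):=\mathbb E_\xi\left\{\left[A^{-1}(x_1,y)-\mathbb E_\xi\{A^{-1}\}(x_1)\right]\left[A^{-1}(x_2,y+z)-\mathbb E_\xi\{A^{-1}\}(x_2)\right]\right\}$$ is independent of $y\in[0,\infty)$ (with $y+z\ge0$), and $|\mathrm{Cov}_\xi(x_1,x_2,z)|\le\Gamma(z)$ for some $\Gamma$ with $\|\Gamma\|_{L^1}<\infty$. Mixing condition: for a Borel set $U\subset\mathbb R$ let $\mathcal S_U$ be the sub-sigma-algebra generated by $A(x,y)$, $x\in[0,1]$, $y\in U$. There exists a non-negative, bounded, decreasing $\varphi:[0,\infty)\to\mathbb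 R$ with $\varphi^{1/3}\in L^1$ such that for all Borel sets $U,V\subset\mathbb R$, $$\sup\left\{|\mathbb E_\xi[\eta_a\eta_b]| : \eta_a\ \mathcal S_U\text{-measurable},\ \eta_b\ \mathcal S_V\text{-measurable},\ \mathbb E_\xi\eta_a=\mathbb E_\xi\eta_b=0,\ \mathbb E_\xi\eta_a^2=\mathbb E_\xi\eta_b^2=1\right\}\le\varphi(d(U,V)),$$ $d(U,V)$ being the distance between $U$ and $V$. $f\in L^2([0,1])$ is deterministic, $F(s):=\int_0^sf(t)\,dt$, $\langle\phi\rangle:=\int_0^1\phi(y)\,dy$. $u_\varepsilon$ solves $-\frac{d}{dx}\left(A_\varepsilon\frac{d}{dx}u_\varepsilon\right)=f$ on $(0,1)$, $u_\varepsilon(0)=u_\varepsilon(1)=0$, i.e. $$u_\varepsilon(x)=-\int_0^x\frac{F(s)}{A_\varepsilon(s)}\,ds+\frac{\langle F/A_\varepsilon\rangle}{\langle 1/A_\varepsilon\rangle}\int_0^x\frac{1}{A_\varepsilon(s)}\,ds ,$$ and $u_0$ is given by the same formula with $A_0$ in place of $A_\varepsilon$. The kernel $G$ is $$G(x,s):=\begin{cases}\left(F(s)-\dfrac{\langle F/A_0\rangle}{\langle1/A_0\rangle}\right)\left(\dfrac1{\langle1/A_0\rangle}\displaystyle\int_0^x\frac1{A_0(t)}\,dt-1\right),&0\le s\le x,\\[2ex]\left(F(s)-\dfrac{\langle F/A_0\rangle}{\langle1/A_0\rangle}\right)\dfrac1{\langle1/A_0\rangle}\displaystyle\int_0^x\frac1{A_0(t)}\,dt,&x<s\le1.\end{cases}$$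 *)

(* Defs.v *)
From HB Require Import structures.
From mathcomp Require Import all_boot all_order all_algebra.
From mathcomp Require Import all_classical all_reals all_analysis.

Set Implicit Arguments.
Unset Strict Implicit.
Unset Printing Implicit Defensive.

Import Order.TTheory GRing.Theory Num.Theory.
Import numFieldNormedType.Exports.

Local Open Scope classical_set_scope.
Local Open Scope ring_scope.

(* A random field A(x, y, omega) is a function [A : R -> R -> Omega -> R] of
   which only the values at x in [0, 1] and y >= 0 are meaningful: every
   hypothesis below restricts x and y to these ranges. *)

Section conditioning.
Context {d d' : measure_display} {Omega : measurableType d}
  {E : measurableType d'} {R : realType}.

(* [Pxi z] is a version of P[ . | xi = z]: it depends measurably on z, and
   omega |-> Pxi (xi omega) S is the conditional probability of S given xi. *)
Definition conditional_probability (P : probability Omega R)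
    (xi : {RV P >-> E}) (Pxi : E -> probability Omega R) : Prop :=
  measurable_fun setT (Pxi : E -> pprobability Omega R) /\
  forall (S : set Omega) (B : set E), measurable S -> measurable B ->
    (P (S `&` xi @^-1` B) = \int[P]_(w in xi @^-1` B) Pxi (xi w) S)%E.

End conditioning.

Section random_field.
Context {d : measure_display} {Omega : measurableType d} {R : realType}.
Variable A : R -> R -> Omega -> R.

(* Joint measurability in (x, y, omega): needed for the integrals of
   s |-> A(s, s / eps, omega) to be defined and to be random variables. *)
Definition measurable_field : Prop :=
  measurable_fun ((`[0, 1] `*` `[0, +oo[) `*` setT : set (R * R * Omega))
    (fun p => A p.1.1 p.1.2 p.2).

Definition Aeps (eps x : R) (w : Omega) : R := A x (x / eps) w.

Definition pathwise_elliptic (nu1 nu2 : Omega -> R -> R) : Prop :=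
  forall w eps x, 0 < eps -> x \in `[0, 1] ->
    [/\ 0 < nu1 w eps, nu1 w eps <= Aeps eps x w & Aeps eps x w <= nu2 w eps].

Definition invA (x y : R) (w : Omega) : R := (A x y w)^-1.

(* Generators of the sigma-algebra S_U of the field restricted to y in U. *)
Definition field_events (U : set R) : set (set Omega) :=
  \bigcup_(p in `[0, 1] `*` (U `&` `[0, +oo[))
    preimage_set_system setT (A p.1 p.2) measurable.

Definition field_measurable (U : set R) (eta : Omega -> R) : Prop :=
  measurable_fun setT (eta : g_sigma_algebraType (field_events U) -> R).

(* From here on [Q] is the law P_xi = P[ . | xi] at a fixed value of xi. *)
Variable Q : probability Omega R.

Definition meanA (x : R) : R := fine 'E_Q[invA x 0]%E.

Definition A0 (x : R) : R := (meanA x)^-1.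

Definition mean_hypothesis (c1 c2 : R) : Prop :=
  0 < c1 /\
  forall x y, x \in `[0, 1] -> 0 <= y ->
    [/\ ('E_Q[invA x y] = 'E_Q[invA x 0])%E,
        (c1%:E <= 'E_Q[invA x y])%E & ('E_Q[invA x y] <= c2%:E)%E].

Definition cov_at (x1 x2 y z : R) : \bar R :=
  'E_Q[fun w => ((invA x1 y w - meanA x1) * (invA x2 (y + z) w - meanA x2))%R]%E.

(* The base point max(0, -z) is the least y >= 0 with y + z >= 0; it is
   irrelevant under [cov_hypothesis]. *)
Definition Cov (x1 x2 z : R) : R := fine (cov_at x1 x2 (Num.max 0 (- z)) z).

Definition cov_hypothesis (Gamma : R -> R) : Prop :=
  [/\ forall x1 x2 y z, x1 \in `[0, 1] -> x2 \in `[0, 1] ->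
        0 <= y -> 0 <= y + z -> cov_at x1 x2 y z = (Cov x1 x2 z)%:E,
      forall x1 x2 z, x1 \in `[0, 1] -> x2 \in `[0, 1] ->
        `|Cov x1 x2 z| <= Gamma z &
      lebesgue_measure.-integrable setT (EFin \o Gamma)].

Definition stationary_in_y : Prop :=
  forall (n : nat) (x y : 'I_n -> R) (h : R) (B : set (n.-tuple R)),
    (forall i, x i \in `[0, 1]) -> (forall i, 0 <= y i) -> 0 <= h ->
    measurable B ->
    Q [set w | B [tuple A (x i) (y i + h) w | i < n]] =
    Q [set w | B [tuple A (x i) (y i) w | i < n]].

Definition cov_continuous_diag : Prop :=
  forall x : R, x \in `[0, 1] ->
    Cov s.1 s.2 0
      @[s --> within (`[0, 1] `*` `[0, 1] : set (R * R)) (nbhs (x, x))]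
      --> Cov x x 0.

Definition set_distance (U V : set R) : R :=
  inf [set `|u - v| | u in U & v in V].

Definition normalized (U : set R) (eta : Omega -> R) : Prop :=
  [/\ field_measurable U eta, ('E_Q[eta] = 0)%E
    & ('E_Q[fun w => (eta w ^+ 2)%R] = 1)%E].

(* If U or V is empty the supremum is over the empty set, hence -oo, and the
   junk value of [set_distance] does not matter. *)
Definition mixing : Prop :=
  exists phi : R -> R,
    [/\ forall t, 0 <= t -> 0 <= phi t,
        exists M, forall t, 0 <= t -> phi t <= M,
        forall s t, 0 <= s -> s <= t -> phi t <= phi s,
        lebesgue_measure.-integrable `[0, +oo[
          (fun t => (phi t `^ 3^-1)%:E) &
        forall U V : set R, measurable U -> measurable V ->
          (ereal_sup [set `|'E_Q[fun w => (etaa w * etab w)%R]| |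
                        etaa in normalized U & etab in normalized V]
           <= (phi (set_distance U V))%:E)%E].

Definition sixth_moment_bound (C : R) : Prop :=
  forall x y, x \in `[0, 1] -> 0 <= y ->
    ('E_Q[fun w => ((invA x y w - fine 'E_Q[invA x y]%E) ^+ 6)%R] <= C%:E)%E.

Definition sigma (t : R) : R :=
  Num.sqrt (\int[lebesgue_measure]_q Cov t t q).

End random_field.

Section elliptic_problem.
Context {R : realType}.
Variable f : R -> R.

Definition square_integrable01 : Prop :=
  measurable_fun (`[0, 1] : set R) f /\
  lebesgue_measure.-integrable `[0, 1] (fun t => (f t ^+ 2)%:E).

Definition primitive (s : R) : R := \int[lebesgue_measure]_(t in `[0, s]) f t.

Definition avg (g : R -> R) : R := \int[lebesgue_measure]_(y in `[0, 1]) g y.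

(* The solution of -(a u')' = f on (0, 1) with u(0) = u(1) = 0. *)
Definition solution (a : R -> R) (x : R) : R :=
  - (\int[lebesgue_measure]_(s in `[0, x]) (primitive s / a s))
  + avg (fun s => primitive s / a s) / avg (fun s => (a s)^-1)
    * (\int[lebesgue_measure]_(s in `[0, x]) (a s)^-1).

Definition kernelG (a0 : R -> R) (x s : R) : R :=
  let c := avg (fun t => primitive t / a0 t) / avg (fun t => (a0 t)^-1) in
  let theta := (avg (fun t => (a0 t)^-1))^-1
                 * (\int[lebesgue_measure]_(t in `[0, x]) (a0 t)^-1) in
  if s <= x then (primitive s - c) * (theta - 1) else (primitive s - c) * theta.

End elliptic_problem.

Section brownian.
Context {d : measure_display} {Omega : measurableType d} {R : realType}.
Variable P : probability Omega R.

Definition brownian_motion (W : R -> {RV P >-> R}) : Prop :=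
  [/\ {ae P, forall w, W 0 w = 0},
      forall s t (B : set R), 0 <= s -> s < t -> measurable B ->
        P [set w | B (W t w - W s w)] = normal_prob 0 (Num.sqrt (t - s)) B,
      forall (n : nat) (t : nat -> R) (B : nat -> set R),
        0 <= t 0%N -> (forall i, t i <= t i.+1) ->
        (forall i, measurable (B i)) ->
        (P [set w | forall i, (i < n)%N -> B i (W (t i.+1) w - W (t i) w)%R] =
         \prod_(i < n) P [set w | B i (W (t i.+1) w - W (t i) w)%R])%E &
      {ae P, forall w, {within `[0, +oo[, continuous (fun t => W t w)}}].

(* A list of triples (c, (a, b)) encodes the step function
   sum of c * 1_{(a, b]}; the intervals may overlap. *)
Definition step_fun (p : seq (R * (R * R))) (t : R) : R :=
  \sum_(k <- p) k.1 * \1_(`]k.2.1, k.2.2]%classic) t.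

Definition step_integral (W : R -> {RV P >-> R}) (p : seq (R * (R * R)))
    (w : Omega) : R :=
  \sum_(k <- p) k.1 * (W k.2.2 w - W k.2.1 w).

(* [I] is (a version of) the Wiener integral of the deterministic function g
   over [0, 1]: the L^2(P)-limit of the integrals of step functions converging
   to g in L^2([0, 1]). *)
Definition wiener_integral (W : R -> {RV P >-> R}) (g : R -> R)
    (I : {RV P >-> R}) : Prop :=
  measurable_fun (`[0, 1] : set R) g /\
  exists p : nat -> seq (R * (R * R)),
    [/\ forall n k, k \in p n -> [&& 0 <= k.2.1, k.2.1 <= k.2.2 & k.2.2 <= 1],
        (\int[lebesgue_measure]_(t in `[0%R, 1%R])
           ((step_fun (p n) t - g t) ^+ 2)%R%:E)%E @[n --> \oo] --> 0%E &
        'E_P[fun w => ((step_integral W (p n) w - I w) ^+ 2)%R]%E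
           @[n --> \oo] --> 0%E].

End brownian.

(* Convergence in distribution, as eps decreases to 0, of random variables
   X eps on (Omega, Q) to a random variable Y on (Omega', Q'). *)
Definition cvg_in_distribution {d d' : measure_display}
    {Omega : measurableType d} {Omega' : measurableType d'} {R : realType}
    (Q : probability Omega R) (Q' : probability Omega' R)
    (X : R -> Omega -> R) (Y : {RV Q' >-> R}) : Prop :=
  (forall eps, 0 < eps -> measurable_fun setT (X eps)) /\
  forall h : R -> R, continuous h -> (exists M, forall r, `|h r| <= M) ->
    'E_Q[h \o X eps]%E @[eps --> (0 : R)^'+] --> 'E_Q'[h \o Y]%E.

(* Main.v *)
Require Import Defs.
From HB Require Import structures.
From mathcomp Require Import all_boot all_order all_algebra.
From mathcomp Require Import all_classical all_reals all_analysis.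
From mathcomp Require Import measurable_realfun.
From mathcomp Require Import ring lra zify.
Set Implicit Arguments.
Unset Strict Implicit.
Unset Printing Implicit Defensive.
Import Order.TTheory GRing.Theory Num.Theory.
Import numFieldNormedType.Exports.
Local Open Scope classical_set_scope.
Local Open Scope ring_scope.

(** Write X (s) for the centred inverse coefficient 1 / A (s, s / eps) - E 1 / A
([fluct]). By the explicit formula of the solution, u_eps - u_0 is the integral of
G X plus the product of two integrals of X divided by the integral of 1 / A_eps
([solution_difference]). The variance of an integral of X is a double integral of
Cov (s, t, (t - s) / eps), hence at most a constant times eps; the product is
therefore O(eps) in mean, and on the scale sqrt eps only the linear functional
remains ([solution_fluctuation]).

Its variance, divided by eps, converges to the integral of G^2 times the lag
integral of the covariance: substitute t = s + eps q in the double integral and use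
dominated convergence, the bound being Gamma and the pointwise limit coming from the
continuity of the covariance ([cvg_variance_scaled_average]). The same convergence
with the negative part of the lag integral as weight shows that the lag integral is
nonnegative almost everywhere, so that it is the square of sigma
([lag_integral_ge0_ae]).

That the limit is Gaussian follows from mixing. The integral over [0, 1] is cut into
blocks which are short, but long on the scale eps, and over each block it is replaced
by a finite sum Z_j of sampled values, which is measurable with respect to the field
over that block ([block_approximation]); variables attached to distant blocks are
then almost uncorrelated ([mixing_decorrelated]). Let S be the sum of the Z_j, and
expand psi (S) around the value that S takes without Z_j and its two neighbours. This
gives Stein's identity E [S psi (S)] = E [S^2] E [psi' (S)] up to a small error. For
psi a sine or a cosine, it is an approximate linear differential equation for the
characteristic function of S, whose solution is Gaussian ([stein_char],
[char_sum_blocks]). The error is controlled by the fourth moments of the Z_j and by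
the decay phi (t) = O (t^-3), which follows from the integrability of phi^(1/3)
([decay_of_integrable_root], [char_scaled_average]).

The integral of G sigma against W is the limit in mean square of integrals of step
functions, by the isometry [step_isometry], and the independence of the increments
gives its characteristic function, that of the centred Gaussian law whose variance is
the integral of G^2 sigma^2 ([wiener_integral_exists]). The characteristic functions
of the rescaled errors converge to it ([cvg_char_solution]). Since first moments are
bounded, a bounded continuous test function may be approximated by trigonometric
polynomials on a large interval, and convergence in distribution follows
([cvg_mean_of_char]). *)

(** * Moments of random variables *)

Section moments.
Context {d : measure_display} {T : measurableType d} {R : realType}.
Variable Q : probability T R.
Implicit Types X Y : T -> R.

Definition mean X : R := \int[Q]_w X w.

Definition L1 X := Q.-integrable setT (EFin \o X).

Definition L2 X := measurable_fun setT X /\ L1 (fun w => X w ^+ 2).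

Definition L4 X := measurable_fun setT X /\ L1 (fun w => X w ^+ 4).

Lemma L1_measurable X : L1 X -> measurable_fun setT X.
Proof. by move=> /integrableP[/measurable_EFinP]. Qed.

Lemma L1_dominated X Y : measurable_fun setT X -> L1 Y ->
  (forall w, `|X w| <= Y w) -> L1 X.
Proof.
move=> mX iY XY; apply: le_integrable iY => //; first exact/measurable_EFinP.
move=> w _ /=; rewrite lee_fin (le_trans (XY w))//; exact: ler_norm.
Qed.

Lemma L1_cst c : L1 (fun=> c).
Proof.
by apply: finite_measure_integrable_cst.
Qed.

Lemma L1_bounded X B : measurable_fun setT X -> (forall w, `|X w| <= B) -> L1 X.
Proof. by move=> mX XB; apply: (L1_dominated mX (L1_cst B)). Qed.

Lemma L1D X Y : L1 X -> L1 Y -> L1 (fun w => X w + Y w).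
Proof. by move=> iX iY; have := integrableD measurableT iX iY. Qed.

Lemma L1Z c X : L1 X -> L1 (fun w => c * X w).
Proof. by move=> iX; have := integrableZl measurableT c iX. Qed.

Lemma L1N X : L1 X -> L1 (fun w => - X w).
Proof. by move=> /integrableN. Qed.

Lemma L1B X Y : L1 X -> L1 Y -> L1 (fun w => X w - Y w).
Proof. by move=> iX iY; apply: L1D => //; exact: L1N. Qed.

Lemma L1_norm X : L1 X -> L1 (fun w => `|X w|).
Proof. by move=> /integrable_norm. Qed.

Lemma L1_sum (I : Type) (s : seq I) (P : pred I) (X : I -> T -> R) :
  (forall i, P i -> L1 (X i)) -> L1 (fun w => \sum_(i <- s | P i) X i w).
Proof.
move=> iX; elim: s => [|i s ih].
  by under [X in L1 X]eq_fun do rewrite big_nil; exact: L1_cst.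
under [X in L1 X]eq_fun do rewrite big_cons.
by have [/iX Pi|//] := boolP (P i); exact: L1D.
Qed.

Lemma mean_cst c : mean (fun=> c) = c.
Proof. by rewrite /mean Rintegral_cst//= [X in fine X]probability_setT mulr1. Qed.

Lemma meanD X Y : L1 X -> L1 Y -> mean (fun w => X w + Y w) = mean X + mean Y.
Proof. by move=> iX iY; exact: RintegralD. Qed.

Lemma meanB X Y : L1 X -> L1 Y -> mean (fun w => X w - Y w) = mean X - mean Y.
Proof. by move=> iX iY; exact: RintegralB. Qed.

Lemma meanZ c X : L1 X -> mean (fun w => c * X w) = c * mean X.
Proof. by move=> iX; exact: RintegralZl. Qed.

Lemma meanN X : L1 X -> mean (fun w => - X w) = - mean X.
Proof.
move=> iX; rewrite -mulN1r -meanZ//.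
by congr mean; apply/funext => w; rewrite mulN1r.
Qed.

Lemma mean_sum (I : Type) (s : seq I) (P : pred I) (X : I -> T -> R) :
  (forall i, P i -> L1 (X i)) ->
  mean (fun w => \sum_(i <- s | P i) X i w) = \sum_(i <- s | P i) mean (X i).
Proof.
move=> iX; elim: s => [|i s ih].
  by under eq_fun do rewrite big_nil; rewrite mean_cst big_nil.
under eq_fun do rewrite big_cons; rewrite big_cons.
have [Pi|//] := boolP (P i); rewrite meanD ?ih//; first exact: iX.
exact: L1_sum.
Qed.

Lemma le_mean X Y : L1 X -> L1 Y -> (forall w, X w <= Y w) -> mean X <= mean Y.
Proof. by move=> iX iY XY; apply: le_Rintegral. Qed.

Lemma mean_ge0 X : (forall w, 0 <= X w) -> 0 <= mean X.
Proof. by move=> X0; apply: Rintegral_ge0. Qed.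

Lemma norm_mean X : L1 X -> `|mean X| <= mean (fun w => `|X w|).
Proof. by move=> iX; exact: le_normr_Rintegral. Qed.

Lemma norm_mean_le X Y : measurable_fun setT X -> L1 Y ->
  (forall w, `|X w| <= Y w) -> `|mean X| <= mean Y.
Proof.
move=> mX iY XY; have iX := L1_dominated mX iY XY.
by apply: (le_trans (norm_mean iX)); apply: le_mean => //; exact: L1_norm.
Qed.

Lemma L2_bounded X B : measurable_fun setT X -> (forall w, `|X w| <= B) -> L2 X.
Proof.
move=> mX XB; split=> //; apply: (@L1_bounded _ (B ^+ 2)).
  exact: measurable_funX.
by move=> w; rewrite normrX lerXn2r// nnegrE ?normr_ge0// (le_trans _ (XB w)).
Qed.

Lemma L2M X Y : L2 X -> L2 Y -> L1 (fun w => X w * Y w).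
Proof.
move=> [mX iX] [mY iY].
apply: (L1_dominated (measurable_funM mX mY) (L1D iX iY)) => w.
rewrite normrM -[leRHS]/(_ ^+ 2 + _) -(normr_id (X w)) -(real_normK (num_real (X w))).
rewrite -(real_normK (num_real (Y w))) normr_id.
have := sqr_ge0 (`|X w| - `|Y w|); have := normr_ge0 (X w); have := normr_ge0 (Y w).
nra.
Qed.

Lemma L2_L1 X : L2 X -> L1 X.
Proof.
move=> X2; have := L2M X2 (@L2_bounded (fun=> 1) 1 _ _).
rewrite normr1 => /(_ (measurable_cst _) (fun=> lexx _)).
by under eq_fun do rewrite mulr1.
Qed.

Lemma L2Z c X : L2 X -> L2 (fun w => c * X w).
Proof.
move=> [mX iX]; split; first exact: measurable_funM.
by under eq_fun do rewrite exprMn; exact: L1Z.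
Qed.

Lemma L2N X : L2 X -> L2 (fun w => - X w).
Proof. by move=> /(L2Z (-1)); under eq_fun do rewrite mulN1r. Qed.

Lemma L2D X Y : L2 X -> L2 Y -> L2 (fun w => X w + Y w).
Proof.
move=> X2 Y2; split; first by apply: measurable_funD; [case: X2|case: Y2].
rewrite [X in L1 X](_ : _ = fun w => X w ^+ 2 + 2 * (X w * Y w) + Y w ^+ 2).
  apply: L1D; last by case: Y2.
  by apply: L1D; [case: X2|apply: L1Z; exact: L2M].
by apply/funext => w; ring.
Qed.

Lemma L2B X Y : L2 X -> L2 Y -> L2 (fun w => X w - Y w).
Proof. by move=> X2 Y2; apply: L2D => //; exact: L2N. Qed.

Lemma L2_cst c : L2 (fun=> c).
Proof. exact: (@L2_bounded _ `|c|). Qed.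

Lemma L2_sum (I : Type) (s : seq I) (P : pred I) (X : I -> T -> R) :
  (forall i, P i -> L2 (X i)) -> L2 (fun w => \sum_(i <- s | P i) X i w).
Proof.
move=> iX; elim: s => [|i s ih].
  by under eq_fun do rewrite big_nil; exact: L2_cst.
under eq_fun do rewrite big_cons.
by have [/iX Pi|//] := boolP (P i); exact: L2D.
Qed.

Lemma L2_dominated X Y : measurable_fun setT X -> L2 Y ->
  (forall w, `|X w| <= `|Y w|) -> L2 X.
Proof.
move=> mX [mY iY] XY; split=> //; apply: (L1_dominated _ iY).
  exact: measurable_funX.
move=> w; rewrite normrX -(real_normK (num_real (Y w))).
by rewrite lerXn2r// nnegrE.
Qed.

Lemma L2_Mbounded X Y B : L2 X -> measurable_fun setT Y ->
  (forall w, `|Y w| <= B) -> L2 (fun w => X w * Y w).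
Proof.
move=> [mX iX] mY YB; apply: (@L2_dominated _ (fun w => B * X w)).
- exact: measurable_funM.
- by apply: L2Z.
- move=> w; rewrite !normrM mulrC ler_wpM2r//.
  by rewrite (le_trans (YB w))// ler_norm.
Qed.

(** The discriminant of the nonnegative quadratic form E (t X + Y)^2. *)
Lemma mean_Cauchy_Schwarz X Y : L2 X -> L2 Y ->
  mean (fun w => X w * Y w) ^+ 2 <=
  mean (fun w => X w ^+ 2) * mean (fun w => Y w ^+ 2).
Proof.
move=> X2 Y2; set a := mean (fun w => X w ^+ 2); set c := mean (fun w => Y w ^+ 2).
set b := mean (fun w => X w * Y w).
have quad s t : 0 <= s ^+ 2 * a + 2 * s * t * b + t ^+ 2 * c.
  have := mean_ge0 (fun w => sqr_ge0 (s * X w + t * Y w)).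
  rewrite [X in mean X](_ : _ =
    fun w => s ^+ 2 * X w ^+ 2 + 2 * s * t * (X w * Y w) + t ^+ 2 * Y w ^+ 2); last first.
    by apply/funext => w; ring.
  case: (X2) => _ iX; case: (Y2) => _ iY; have iXY := L2M X2 Y2.
  by rewrite !(meanD, meanZ)//; do ?[apply: L1D|apply: L1Z].
have a0 : 0 <= a by apply: mean_ge0 => w; exact: sqr_ge0.
have [a_eq0|] := eqVneq a 0.
  rewrite a_eq0 mul0r; have := quad (- b * (c + 1)) 1; have := quad (- b) 0.
  have c0 : 0 <= c by apply: mean_ge0 => w; exact: sqr_ge0.
  have := quad (- (c + 1)) b; rewrite a_eq0; have := sqr_ge0 b.
  nra.
move=> a_neq0; have ap : 0 < a by rewrite lt_neqAle eq_sym a_neq0.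
have := quad (- b) a; rewrite (_ : _ + _ = a * (a * c - b ^+ 2)); last by ring.
by rewrite pmulr_rge0// subr_ge0.
Qed.

Lemma L2_norm X : L2 X -> L2 (fun w => `|X w|).
Proof.
move=> X2; apply: L2_dominated (X2) _ => [|w]; last by rewrite normr_id.
by case: X2 => mX _; exact: measurableT_comp.
Qed.

Lemma mean_Cauchy_Schwarz_le X Y (a b : R) : L2 X -> L2 Y -> 0 <= a -> 0 <= b ->
  mean (fun w => X w ^+ 2) <= a ^+ 2 -> mean (fun w => Y w ^+ 2) <= b ^+ 2 ->
  mean (fun w => `|X w * Y w|) <= a * b.
Proof.
move=> X2 Y2 a0 b0 Xa Yb.
have aX := L2_norm X2; have aY := L2_norm Y2.
have sqE (f : T -> R) : (fun w => `|f w| ^+ 2) = (fun w => f w ^+ 2).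
  by apply/funext => w; rewrite real_normK// num_real.
have := mean_Cauchy_Schwarz aX aY; rewrite !sqE.
under [in X in X -> _]eq_fun do rewrite -normrM.
move=> cs; rewrite -(@ler_pXn2r _ 2)// ?nnegrE ?mulr_ge0//; last first.
  exact: mean_ge0.
apply: (le_trans cs); rewrite exprMn ler_pM// mean_ge0// => w; exact: sqr_ge0.
Qed.

(** Cauchy-Schwarz against the constant 1. *)
Lemma mean_norm_le_L2 X (a : R) : L2 X -> 0 <= a ->
  mean (fun w => X w ^+ 2) <= a ^+ 2 -> mean (fun w => `|X w|) <= a.
Proof.
move=> X2 a0 Xa.
have := @mean_Cauchy_Schwarz_le X (fun=> 1) a 1 X2 (L2_cst 1) a0 ler01 Xa.
rewrite !expr1n mean_cst => /(_ (lexx _)); rewrite mulr1.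
by under eq_fun do rewrite mulr1.
Qed.

(** Minkowski's inequality for the L^2 norm. *)
Lemma mean_sqrD X Y (a b : R) : L2 X -> L2 Y -> 0 <= a -> 0 <= b ->
  mean (fun w => X w ^+ 2) <= a ^+ 2 -> mean (fun w => Y w ^+ 2) <= b ^+ 2 ->
  mean (fun w => (X w + Y w) ^+ 2) <= (a + b) ^+ 2.
Proof.
move=> X2 Y2 a0 b0 Xa Yb.
have iXY := L2M X2 Y2; have [_ iX] := X2; have [_ iY] := Y2.
have le_XY := le_trans (norm_mean iXY) (mean_Cauchy_Schwarz_le X2 Y2 a0 b0 Xa Yb).
rewrite [X in mean X](_ : _ = fun w => X w ^+ 2 + 2 * (X w * Y w) + Y w ^+ 2).
  rewrite !(meanD, meanZ)//; do ?[apply: L1D|apply: L1Z] => //.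
  have := le_trans (ler_norm _) le_XY; move: Xa Yb; nra.
by apply/funext => w; ring.
Qed.

(** The arithmetic-geometric inequality, used twice. *)
Lemma mul4_le (a b c e : R) :
  `|a * b * c * e| <= a ^+ 4 + b ^+ 4 + c ^+ 4 + e ^+ 4.
Proof.
have amgm (x y : R) : `|x * y| <= (x ^+ 2 + y ^+ 2) / 2.
  by rewrite ler_norml; apply/andP; split; have := sqr_ge0 (x + y); have := sqr_ge0 (x - y); nra.
have H := amgm (a * b) (c * e); have H1 := amgm (a ^+ 2) (b ^+ 2).
have H2 := amgm (c ^+ 2) (e ^+ 2).
have le1 : (a * b) ^+ 2 <= (a ^+ 4 + b ^+ 4) / 2.
  rewrite exprMn; apply: le_trans (ler_norm _) _; apply: le_trans H1 _.
  by rewrite -!exprM.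
have le2 : (c * e) ^+ 2 <= (c ^+ 4 + e ^+ 4) / 2.
  rewrite exprMn; apply: le_trans (ler_norm _) _; apply: le_trans H2 _.
  by rewrite -!exprM.
have p4 (x : R) : 0 <= x ^+ 4 by rewrite exprn_even_ge0.
rewrite -mulrA; apply: (le_trans H); have := p4 a; have := p4 b; have := p4 c; have := p4 e.
lra.
Qed.

Lemma L4M4 X Y Z V : L4 X -> L4 Y -> L4 Z -> L4 V ->
  L1 (fun w => X w * Y w * Z w * V w).
Proof.
move=> [mX iX] [mY iY] [mZ iZ] [mV iV].
apply: (L1_dominated _ (L1D (L1D (L1D iX iY) iZ) iV)) => [|w].
  by do ?apply: measurable_funM.
exact: mul4_le.
Qed.

Lemma L4_cst c : L4 (fun=> c).
Proof. by split=> //; exact: L1_cst. Qed.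

Lemma L4M X Y : L4 X -> L4 Y -> L2 (fun w => X w * Y w).
Proof.
move=> X4 Y4; split; first by apply: measurable_funM; [case: X4|case: Y4].
have := L4M4 X4 Y4 X4 Y4; congr L1; apply/funext => w; ring.
Qed.

Lemma L4_L2 X : L4 X -> L2 X.
Proof. by move=> /L4M/(_ (L4_cst 1)); under eq_fun do rewrite mulr1. Qed.

Lemma L4Z c X : L4 X -> L4 (fun w => c * X w).
Proof.
move=> [mX iX]; split; first exact: measurable_funM.
by under eq_fun do rewrite exprMn; exact: L1Z.
Qed.

Lemma L4D X Y : L4 X -> L4 Y -> L4 (fun w => X w + Y w).
Proof.
move=> [mX iX] [mY iY]; split; first exact: measurable_funD.
apply: (L1_dominated _ (L1Z 8 (L1D iX iY))) => [|w].
  by apply: measurable_funX; exact: measurable_funD.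
rewrite ger0_norm ?exprn_even_ge0//.
move: (X w) (Y w) => x y.
have le_sq (a b : R) : (a + b) ^+ 2 <= 2 * (a ^+ 2 + b ^+ 2).
  by have := sqr_ge0 (a - b); nra.
have -> : (x + y) ^+ 4 = ((x + y) ^+ 2) ^+ 2 by rewrite -exprM.
apply: (@le_trans _ _ ((2 * (x ^+ 2 + y ^+ 2)) ^+ 2)).
  by rewrite lerXn2r ?nnegrE ?sqr_ge0 ?mulr_ge0 ?addr_ge0 ?sqr_ge0.
rewrite exprMn; have := le_sq (x ^+ 2) (y ^+ 2); rewrite -!exprM; nra.
Qed.

Lemma L4_sum (I : Type) (s : seq I) (P : pred I) (X : I -> T -> R) :
  (forall i, P i -> L4 (X i)) -> L4 (fun w => \sum_(i <- s | P i) X i w).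
Proof.
move=> iX; elim: s => [|i s ih].
  by under eq_fun do rewrite big_nil; exact: L4_cst.
under eq_fun do rewrite big_cons.
by have [/iX Pi|//] := boolP (P i); exact: L4D.
Qed.

End moments.

(** * Stein's equation on the Fourier side *)

Section calculus.
Context {R : realType}.

Lemma lipschitz_of_derivative (g g' : R -> R) :
  (forall x : R, is_derive x 1 g (g' x)) -> (forall x, `|g' x| <= 1) ->
  forall x y, `|g x - g y| <= `|x - y|.
Proof.
move=> dg g'1 x y.
wlog xy : x y / y < x.
  move=> hw; have [/hw//|/hw|->] := ltgtP y x; first by rewrite distrC (distrC y).
  by rewrite !subrr.
have cg : {within `[y, x], continuous g}.
  by apply: derivable_within_continuous => z _; have [] := dg z.
have [c _ ->] := MVT xy (fun z _ => dg z) cg.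
by rewrite normrM ler_piMl.
Qed.

(** The function g y - y g' x has a derivative of size at most |y - x|. *)
Lemma taylor_of_derivative (g g' g'' : R -> R) : (forall x : R, is_derive x 1 g (g' x)) ->
  (forall x : R, is_derive x 1 g' (g'' x)) -> (forall x, `|g'' x| <= 1) ->
  forall x h, `|g x - g (x - h) - h * g' x| <= h ^+ 2.
Proof.
move=> dg dg' g''1 x h.
pose k (y : R) := g y - y * g' x.
have dk (y : R) : is_derive y 1 k (g' y - g' x).
  have := @is_deriveB R R^o R^o _ _ y 1 _ _ (dg y)
    (@is_deriveM R R^o id (cst (g' x)) y 1 _ _ (is_derive_id _ _) (is_derive_cst _ _ _)).
  by move=> H; apply: is_derive_eq H _; rewrite /= /GRing.scale /= mulr0 add0r mulr1.
have dk_le (z y : R) : `|z - x| <= `|y| -> `|g' z - g' x| <= `|y|.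
  by move=> zx; apply: le_trans (lipschitz_of_derivative dg' g''1 z x) zx.
have -> : g x - g (x - h) - h * g' x = k x - k (x - h) by rewrite /k; ring.
have ck a b : {within `[a, b], continuous k}.
  by apply: derivable_within_continuous => z _; have [] := dk z.
rewrite -(real_normK (num_real h)) expr2.
have [h0|h0|h_eq0] := ltgtP 0 h; last by rewrite -h_eq0 subr0 subrr !normr0 mulr0.
  have xh : x - h < x by lra.
  have [c + ->] := MVT xh (fun z _ => dk z) (ck _ _).
  rewrite in_itv/= => /andP[c1 c2]; rewrite (_ : x - (x - h) = h); last by ring.
  rewrite normrM ler_wpM2r//.
  by apply: dk_le; rewrite (gtr0_norm h0) ler_norml; lra.
have xh : x < x - h by lra.
have [c + ] := MVT xh (fun z _ => dk z) (ck _ _).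
rewrite in_itv/= => /andP[c1 c2] kc; rewrite distrC kc (_ : x - h - x = - h); last by ring.
rewrite normrM normrN ler_wpM2r//.
by apply: dk_le; rewrite (ltr0_norm h0) ler_norml; lra.
Qed.

(** Variation of constants: the derivative of C x times exp (v x^2 / 2) is small. *)
Lemma gaussian_ode (C C' : R -> R) (v l e : R) : 0 <= v -> 0 <= l ->
  (forall x : R, is_derive x 1 C (C' x)) ->
  (forall x : R, 0 <= x <= l -> `|C' x + v * x * C x| <= e) ->
  `|C l - C 0 * expR (- (v * l ^+ 2 / 2))| <= l * e.
Proof.
move=> v0; rewrite le_eqVlt => /predU1P[<-|l0] dC err.
  by rewrite expr0n/= mulr0 mul0r oppr0 expR0 mulr1 subrr normr0 mul0r.
pose K (x : R) := C x * expR (v / 2 * x ^+ 2).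
pose K' (x : R) := (C' x + v * x * C x) * expR (v / 2 * x ^+ 2).
have dq (x : R) : is_derive x 1 (fun y : R => v / 2 * y ^+ 2) (v * x).
  rewrite (_ : (fun _ => _) = cst (v / 2) * (id * id)); last first.
    by apply/funext => y; rewrite expr2.
  have := @is_deriveM R R^o _ _ x 1 _ _ (is_derive_cst (v / 2) x 1)
    (@is_deriveM R R^o id id x 1 _ _ (is_derive_id _ _) (is_derive_id _ _)).
  by move=> h; apply: is_derive_eq h _; rewrite /= /GRing.scale /=; field.
have dE (x : R) : is_derive x 1 (fun y : R => expR (v / 2 * y ^+ 2))
    (expR (v / 2 * x ^+ 2) * (v * x)).
  exact: (@is_derive1_comp R expR _ x _ _ (is_derive_expR _) (dq x)).
have dK (x : R) : is_derive x 1 K (K' x).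
  have := @is_deriveM R R^o _ _ x 1 _ _ (dC x) (dE x).
  by move=> h; apply: is_derive_eq h _; rewrite /K' /= /GRing.scale /=; ring.
have cK : {within `[0, l], continuous K}.
  apply: derivable_within_continuous => x _.
  by have [] := dK x.
have [c + Kc] := MVT l0 (fun x _ => dK x) cK.
rewrite in_itv/= => /andP[c0 cl].
have EK : `|K l - K 0| <= l * e * expR (v * l ^+ 2 / 2).
  rewrite Kc subr0 normrM /K' normrM (ger0_norm (expR_ge0 _)) (gtr0_norm l0).
  rewrite [leLHS]mulrC -[leRHS]mulrA ler_wpM2l ?(ltW l0)// ler_pM ?normr_ge0 ?expR_ge0//.
    by rewrite err// (ltW c0) (ltW cl).
  by rewrite ler_expR mulrAC ler_wpM2r// ler_wpM2l// lerXn2r// ?nnegrE ltW.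
have -> : C l - C 0 * expR (- (v * l ^+ 2 / 2)) =
    (K l - K 0) * expR (- (v * l ^+ 2 / 2)).
  rewrite /K expr0n/= mulr0 expR0 mulr1 mulrBl -(mulrA (C l)) -expRD.
  by rewrite [X in C l * expR X](_ : _ = 0) ?expR0 ?mulr1//; field.
rewrite normrM (ger0_norm (expR_ge0 _)) expRN -ler_pdivlMr ?invr_gt0 ?expR_gt0//.
by rewrite invrK.
Qed.

Lemma continuous_sin_measurable : measurable_fun setT (@sin R).
Proof. by apply: continuous_measurable_fun; exact: continuous_sin. Qed.

Lemma continuous_cos_measurable : measurable_fun setT (@cos R).
Proof. by apply: continuous_measurable_fun; exact: continuous_cos. Qed.

Lemma norm_sin_le1 (x : R) : `|sin x| <= 1.
Proof. by rewrite ler_norml sin_geN1 sin_le1. Qed.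

Lemma norm_cos_le1 (x : R) : `|cos x| <= 1.
Proof. by rewrite ler_norml cos_geN1 cos_le1. Qed.

End calculus.

Section characteristic_function.
Context {d : measure_display} {T : measurableType d} {R : realType}.
Variable Q : probability T R.
Implicit Types X : T -> R.

Lemma L1_cos (X : T -> R) (l : R) : measurable_fun setT X -> L1 Q (fun w => cos (l * X w)).
Proof.
move=> mX; apply: (@L1_bounded _ _ _ Q _ 1) => [|w]; last exact: norm_cos_le1.
apply: measurableT_comp; first exact: continuous_cos_measurable.
exact: measurable_funM.
Qed.

Lemma L1_sin (X : T -> R) (l : R) : measurable_fun setT X -> L1 Q (fun w => sin (l * X w)).
Proof.
move=> mX; apply: (@L1_bounded _ _ _ Q _ 1) => [|w]; last exact: norm_sin_le1.
apply: measurableT_comp; first exact: continuous_sin_measurable.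
exact: measurable_funM.
Qed.

(** The derivative under the expectation is dominated by the absolute value of X. *)
Lemma is_derive_mean (g g' : R -> R) X (m : R) : L1 Q X ->
  (forall x : R, is_derive x 1 g (g' x)) ->
  (forall x, `|g x| <= 1) -> (forall x, `|g' x| <= 1) ->
  is_derive m 1 (fun x : R => mean Q (fun w => g (x * X w)))
    (mean Q (fun w => X w * g' (m * X w))).
Proof.
move=> iX dg g1 g'1.
have mX := L1_measurable iX.
have cg : continuous g.
  by move=> x; apply/differentiable_continuous/derivable1_diffP; have [] := dg x.
have d1 (x : R) w : is_derive x 1 (fun y : R => g (y * X w)) (g' (x * X w) * X w).
  apply: (@is_derive1_comp R g _ x _ _ (dg _)).
  have := @is_deriveM R R^o id (cst (X w)) x 1 _ _ (is_derive_id _ _) (is_derive_cst _ _ _).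
  by move=> h; apply: is_derive_eq h _; rewrite /= /GRing.scale /= mulr0 add0r mulr1.
have p1 (x : R) w : partial1of2 (fun (y : R) w => g (y * X w)) x w = X w * g' (x * X w).
  by rewrite partial1of2E; have [_ ->] := d1 x w; rewrite mulrC.
have Im : `]m - 1, m + 1[%classic m by rewrite /= in_itv/=; lra.
have intf (x : R) : `]m - 1, m + 1[%classic x -> Q.-integrable setT (EFin \o (fun w => g (x * X w))).
  move=> _; apply: (@L1_bounded _ _ _ Q _ 1) => //.
  apply: measurableT_comp; first exact: continuous_measurable_fun.
  exact: measurable_funM.
have der (x : R) w : `]m - 1, m + 1[%classic x -> [set: T] w -> derivable (fun y : R => g (y * X w)) x 1.
  by move=> _ _; have [] := d1 x w.
have ub (x : R) w : `]m - 1, m + 1[%classic x -> [set: T] w ->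
    `|partial1of2 (fun (y : R) w => g (y * X w)) x w| <= `|X w|.
  by move=> _ _; rewrite p1 normrM ler_piMr.
have h1 := derivable_under_integral measurableT Im intf der
  (fun w => normr_ge0 (X w)) (L1_norm iX) ub.
have h2 := differentiation_under_integral measurableT Im intf der
  (fun w => normr_ge0 (X w)) (L1_norm iX) ub.
apply: DeriveDef; first exact: h1.
rewrite -derive1E; apply: eq_trans h2 _.
by apply: eq_Rintegral => w _; rewrite p1.
Qed.

(** The distance to the characteristic function of the centred Gaussian law of
variance [v], which is real; splitting it in two parts keeps all means real. *)
Definition gaussian_char_defect X (v e l : R) :=
  `|mean Q (fun w => cos (l * X w)) - expR (- (v * l ^+ 2 / 2))| <= l * e /\
  `|mean Q (fun w => sin (l * X w))| <= l * e.

(** Stein's method on the Fourier side: with C(l) = E cos(lX), the derivative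
is C'(l) = - E[X sin(lX)], so an approximate Stein identity is an approximate
linear differential equation C' = - v l C, solved by the Gaussian. *)
Lemma stein_char X (v l e : R) : L1 Q X -> 0 <= v -> 0 <= l ->
  (forall m : R, 0 <= m <= l ->
    `|mean Q (fun w => X w * sin (m * X w))
      - v * m * mean Q (fun w => cos (m * X w))| <= e /\
    `|mean Q (fun w => X w * cos (m * X w))
      + v * m * mean Q (fun w => sin (m * X w))| <= e) ->
  gaussian_char_defect X v e l.
Proof.
move=> iX v0 l0 err; split.
  have := @gaussian_ode R (fun l => mean Q (fun w => cos (l * X w)))
    (fun m => mean Q (fun w => X w * - sin (m * X w))) v l e v0 l0.
  rewrite [X in mean Q X * expR _](_ : _ = fun=> 1); last first.
    by apply/funext => w; rewrite mul0r cos0.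
  rewrite mean_cst mul1r; apply.
    move=> x; apply: is_derive_mean => // y.
    - exact: norm_cos_le1.
    - by rewrite normrN norm_sin_le1.
  move=> m /err[+ _]; rewrite -normrN; congr (`| _ | <= _).
  rewrite opprB addrC; congr (_ + _); rewrite -meanN; last first.
    apply: L1_dominated (L1_norm iX) _ => [|w]; last first.
      by rewrite normrM ler_piMr// norm_sin_le1.
    have mX := L1_measurable iX.
    apply: measurable_funM => //; apply: measurableT_comp.
      exact: continuous_sin_measurable.
    exact: measurable_funM.
  by congr (mean Q _); apply/funext => w; rewrite mulrN.
have := @gaussian_ode R (fun l => mean Q (fun w => sin (l * X w)))
    (fun m => mean Q (fun w => X w * cos (m * X w))) v l e v0 l0.
rewrite [X in mean Q X * expR _](_ : _ = fun=> 0); last first.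
  by apply/funext => w; rewrite mul0r sin0.
rewrite mean_cst mul0r subr0; apply.
  move=> x; apply: is_derive_mean => // y.
  - exact: norm_sin_le1.
  - exact: norm_cos_le1.
by move=> m /err[].
Qed.

End characteristic_function.

(** * Central limit theorem for a sum of weakly dependent blocks *)

Section sums.
Context {R : realType}.

Lemma sqr_sum_le (I : Type) (s : seq I) (P : pred I) (a : I -> R) :
  (\sum_(i <- s | P i) a i) ^+ 2 <=
  (count P s)%:R * \sum_(i <- s | P i) a i ^+ 2.
Proof.
elim: s => [|i s ih]; first by rewrite !big_nil expr0n mulr0.
rewrite !big_cons/=; case: ifPn => // _; rewrite add1n.
move: ih; set A := \sum_(j <- s | P j) a j.
set B := \sum_(j <- s | P j) a j ^+ 2; move: (count P s) => n AB.
have B0 : 0 <= B by apply: sumr_ge0 => j _; exact: sqr_ge0.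
rewrite -natr1; have n0 : 0 <= n%:R :> R by [].
have [n_eq0|n_neq0] := eqVneq (n%:R : R) 0.
  move: AB; rewrite n_eq0 mul0r => A2.
  have -> : A = 0 by apply/eqP; rewrite -(@sqrf_eq0 R) eq_le A2 sqr_ge0.
  by rewrite addr0 add0r mul1r lerDl.
have np : 0 < n%:R :> R by rewrite lt_neqAle eq_sym n_neq0.
rewrite -subr_ge0 -(pmulr_rge0 _ np).
rewrite [X in 0 <= X](_ : _ = (n%:R * a i - A) ^+ 2 + (n%:R + 1) * (n%:R * B - A ^+ 2)).
  by rewrite addr_ge0 ?sqr_ge0// mulr_ge0 ?subr_ge0// addr_ge0.
by ring.
Qed.

Lemma sum_expr4_le (I : Type) (s : seq I) (P : pred I) (a : I -> R) :
  (\sum_(i <- s | P i) a i) ^+ 4 <=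
  (count P s)%:R ^+ 3 * \sum_(i <- s | P i) a i ^+ 4.
Proof.
rewrite (_ : _ ^+ 4 = ((\sum_(i <- s | P i) a i) ^+ 2) ^+ 2); last first.
  by rewrite -exprM.
have := sqr_sum_le s P a; set n : R := (count P s)%:R.
move=> h; apply: (@le_trans _ _ ((n * \sum_(i <- s | P i) a i ^+ 2) ^+ 2)).
  rewrite lerXn2r ?nnegrE ?sqr_ge0// mulr_ge0// sumr_ge0// => i _.
  exact: sqr_ge0.
rewrite exprMn (_ : n ^+ 3 = n ^+ 2 * n); last by ring.
rewrite -[leRHS]mulrA ler_wpM2l ?sqr_ge0//.
apply: (le_trans (sqr_sum_le _ _ _)); rewrite ler_wpM2l//.
by under eq_bigr do rewrite -exprM.
Qed.

Lemma ler_sum_nat_cond (n : nat) (P : pred nat) (F G : nat -> R) :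
  (forall k, (k < n)%N -> P k -> F k <= G k) ->
  \sum_(0 <= k < n | P k) F k <= \sum_(0 <= k < n | P k) G k.
Proof. by move=> FG; rewrite !big_mkord; apply: ler_sum => k; exact: FG. Qed.

(** The form of the inequalities avoids the truncated subtraction. *)
Definition window (c j k : nat) : bool := (j <= k + c)%N && (k <= j + c)%N.

Lemma count_window c j N :
  (count (window c j) (index_iota 0 N) <= c.*2.+1)%N.
Proof.
rewrite -size_filter -(size_iota (j - c) c.*2.+1).
apply: uniq_leq_size; first by rewrite filter_uniq// iota_uniq.
by move=> k; rewrite mem_filter mem_iota /window => /andP[/andP[? ?] _]; lia.
Qed.

Lemma sum_window_le c j N (a : R) : 0 <= a ->
  \sum_(0 <= k < N | window c j k) a <= (c.*2.+1)%:R * a.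
Proof.
move=> a0; rewrite big_const_seq iter_addr addr0 -[leLHS]mulr_natl ler_wpM2r//.
by rewrite ler_nat count_window.
Qed.

End sums.

Section stein_sum.
Context {d : measure_display} {T : measurableType d} {R : realType}.
Variable Q : probability T R.
Local Notation E := (mean Q).

(** The correlation inequality without square roots: [a] and [b] stand for
upper bounds of the two L^2 norms. *)
Definition decorrelated (rho : R) (X Y : T -> R) :=
  forall a b : R, 0 <= a -> 0 <= b ->
    E (fun w => X w ^+ 2) <= a ^+ 2 -> E (fun w => Y w ^+ 2) <= b ^+ 2 ->
    `|E (fun w => X w * Y w) - E X * E Y| <= rho * a * b.

Variables (N : nat) (Z : nat -> T -> R) (M rho : R).
Hypothesis M0 : 0 <= M.
Hypothesis rho0 : 0 <= rho.

Let S w := \sum_(0 <= j < N) Z j w.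
Let D j w := \sum_(0 <= k < N | window 1 j k) Z k w.
Let far j w := S w - D j w.

Hypothesis Z4 : forall j, L4 Q (Z j).
Hypothesis Zmean0 : forall j, (j < N)%N -> E (Z j) = 0.
Hypothesis Zbound : forall j, (j < N)%N -> E (fun w => Z j w ^+ 4) <= M ^+ 4.
Hypothesis Zfar : forall j (psi : R -> R), (j < N)%N -> measurable_fun setT psi ->
  L2 Q (fun w => psi (far j w)) -> decorrelated rho (Z j) (fun w => psi (far j w)).
Hypothesis ZDfar : forall j k, (j + 3 < k)%N -> (k < N)%N ->
  decorrelated rho (fun w => Z j w * D j w) (fun w => Z k w * D k w).

Let S4 : L4 Q S. Proof. exact: L4_sum. Qed.
Let D4 j : L4 Q (D j). Proof. exact: L4_sum. Qed.
Let far4 j : L4 Q (far j).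
Proof.
by have := L4D S4 (L4Z (-1) (D4 j)); congr L4; apply/funext => w; rewrite mulN1r.
Qed.

Lemma L2_norm_of_L4 (X : T -> R) (a : R) : L4 Q X -> 0 <= a ->
  E (fun w => X w ^+ 4) <= a ^+ 4 -> E (fun w => X w ^+ 2) <= a ^+ 2.
Proof.
move=> X4 a0 Xa; have X2 := L4M X4 X4.
have := @mean_norm_le_L2 _ _ _ Q _ (a ^+ 2) X2 (sqr_ge0 a).
rewrite [X in mean _ X <= _ -> _](_ : _ = fun w => X w ^+ 4); last first.
  by apply/funext => w; ring.
rewrite -exprM => /(_ Xa); congr (mean _ _ <= _).
by apply/funext => w; rewrite -expr2 ger0_norm// sqr_ge0.
Qed.

Let Zsqr j : (j < N)%N -> E (fun w => Z j w ^+ 2) <= M ^+ 2.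
Proof. by move=> jN; apply: L2_norm_of_L4 => //; exact: Zbound. Qed.

Let Dbound j : E (fun w => D j w ^+ 4) <= (3 * M) ^+ 4.
Proof.
have D4E w : D j w ^+ 4 <= 27 * \sum_(0 <= k < N | window 1 j k) Z k w ^+ 4.
  apply: (le_trans (sum_expr4_le _ _ _)); rewrite ler_wpM2r//.
    by apply: sumr_ge0 => k _; rewrite exprn_even_ge0.
  rewrite (_ : 27 = 3 ^+ 3); last by ring.
  by rewrite lerXn2r// ?nnegrE// ler_nat count_window.
have iZ4 : L1 Q (fun w => \sum_(0 <= k < N | window 1 j k) Z k w ^+ 4).
  by apply: L1_sum => k _; have [] := Z4 k.
apply: (@le_trans _ _ (27 * E (fun w => \sum_(0 <= k < N | window 1 j k) Z k w ^+ 4))).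
  rewrite -meanZ//; apply: le_mean => //; last exact: L1Z.
  by have [] := D4 j.
rewrite mean_sum; last by move=> k _; have [] := Z4 k.
rewrite (_ : (3 * M) ^+ 4 = 27 * (3 * M ^+ 4)); last by ring.
rewrite ler_wpM2l//; apply: le_trans (sum_window_le 1 j N _); last first.
  by rewrite exprn_even_ge0.
by apply: ler_sum_nat_cond => k kN _; exact: Zbound.
Qed.

Let Dsqr j : E (fun w => D j w ^+ 2) <= (3 * M) ^+ 2.
Proof. apply: L2_norm_of_L4 (D4 j) _ (Dbound j); by rewrite mulr_ge0. Qed.

Let ZD j w := Z j w * D j w.

Let ZD2 j : L2 Q (ZD j). Proof. exact: L4M. Qed.

Let ZDsqr j : (j < N)%N -> E (fun w => ZD j w ^+ 2) <= (3 * M ^+ 2) ^+ 2.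
Proof.
move=> jN.
have := @mean_Cauchy_Schwarz_le _ _ _ Q _ _ (M ^+ 2) ((3 * M) ^+ 2)
  (L4M (Z4 j) (Z4 j)) (L4M (D4 j) (D4 j)) (sqr_ge0 _) (sqr_ge0 _).
rewrite [X in E X <= _ -> _](_ : _ = fun w => Z j w ^+ 4); last first.
  by apply/funext => w; ring.
rewrite [X in _ -> E X <= _ -> _](_ : _ = fun w => D j w ^+ 4); last first.
  by apply/funext => w; ring.
rewrite -!exprM => /(_ (Zbound jN) (Dbound j)); congr (_ <= _); last by ring.
congr (mean Q _); apply/funext => w; rewrite (_ : _ * _ = ZD j w ^+ 2).
  by rewrite ger0_norm// sqr_ge0.
by rewrite /ZD; ring.
Qed.

Let V w := \sum_(0 <= j < N) ZD j w.

Let V2 : L2 Q V. Proof. exact: L2_sum. Qed.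

Let cov j k := E (fun w => ZD j w * ZD k w) - E (ZD j) * E (ZD k).

Let cov_near j k : (j < N)%N -> (k < N)%N -> `|cov j k| <= 18 * M ^+ 4.
Proof.
move=> jN kN; have M20 : 0 <= 3 * M ^+ 2 by rewrite mulr_ge0 ?sqr_ge0.
have iZD := L2M (ZD2 j) (ZD2 k).
have h1 := mean_Cauchy_Schwarz_le (ZD2 j) (ZD2 k) M20 M20 (ZDsqr jN) (ZDsqr kN).
have {}h1 := le_trans (norm_mean iZD) h1.
have m1 i : (i < N)%N -> `|E (ZD i)| <= 3 * M ^+ 2.
  move=> iN; apply: le_trans (norm_mean (L2_L1 (ZD2 i))) _.
  by apply: mean_norm_le_L2 => //; exact: ZDsqr.
apply: (le_trans (ler_normB _ _)); rewrite normrM.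
rewrite (_ : 18 * _ = 3 * M ^+ 2 * (3 * M ^+ 2) + 3 * M ^+ 2 * (3 * M ^+ 2)).
  by rewrite lerD// ler_pM// m1.
by ring.
Qed.

Let cov_far j k : (j < N)%N -> (k < N)%N -> ~~ window 3 j k ->
  `|cov j k| <= 9 * rho * M ^+ 4.
Proof.
wlog jk : j k / (j <= k)%N.
  move=> hw jN kN njk; have [/hw|/ltnW kj] := leqP j k; first exact.
  rewrite (_ : cov j k = cov k j).
    by apply: hw => //; move: njk; rewrite /window andbC.
  rewrite /cov mulrC; congr (mean Q _ - _).
  by apply/funext => w; rewrite mulrC.
move=> jN kN njk; have jk3 : (j + 3 < k)%N by move: njk; rewrite /window; lia.
have M20 : 0 <= 3 * M ^+ 2 by rewrite mulr_ge0 ?sqr_ge0.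
apply: le_trans (ZDfar jk3 kN M20 M20 (ZDsqr jN) (ZDsqr kN)) _.
by rewrite le_eqVlt; apply/orP; left; apply/eqP; ring.
Qed.

(** Only O(N) of the covariances are not small. *)
Let variance_V : E (fun w => (V w - E V) ^+ 2) <=
  126 * N%:R * M ^+ 4 + 9 * N%:R ^+ 2 * rho * M ^+ 4.
Proof.
have M40 : 0 <= M ^+ 4 by rewrite exprn_even_ge0.
have iVV := L2M V2 V2; have iV := L2_L1 V2.
have -> : E (fun w => (V w - E V) ^+ 2) =
    \sum_(0 <= j < N) \sum_(0 <= k < N) cov j k.
  rewrite (_ : (fun w => (V w - E V) ^+ 2) =
    fun w => V w * V w - 2 * E V * V w + E V ^+ 2); last first.
    by apply/funext => w; ring.
  rewrite meanD; [|by apply: L1B => //; exact: L1Z|exact: L1_cst].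
  rewrite meanB//; last exact: L1Z.
  rewrite meanZ// mean_cst (_ : _ + _ = E (fun w => V w * V w) - E V * E V); last by ring.
  rewrite (_ : (fun w => V w * V w) = fun w => \sum_(0 <= j < N) \sum_(0 <= k < N) ZD j w * ZD k w).
    rewrite mean_sum; last by move=> j _; apply: L1_sum => k _; exact: L2M.
    have -> : E V = \sum_(0 <= j < N) E (ZD j).
      by rewrite mean_sum// => j _; exact: L2_L1.
    rewrite mulr_suml -sumrB; apply: eq_bigr => j _.
    rewrite mean_sum; last by move=> k _; exact: L2M.
    by rewrite mulr_sumr -sumrB.
  by apply/funext => w; rewrite mulr_suml; apply: eq_bigr => j _; rewrite mulr_sumr.
apply: (@le_trans _ _ (\sum_(0 <= j < N) (126 * M ^+ 4 + N%:R * (9 * rho * M ^+ 4)))); last first.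
  rewrite sumr_const_nat subn0 -[leLHS]mulr_natl le_eqVlt; apply/orP; left; apply/eqP; ring.
apply: ler_sum_nat_cond => j jN _.
rewrite (bigID (window 3 j))/=; apply: lerD.
  apply: (@le_trans _ _ (\sum_(0 <= k < N | window 3 j k) 18 * M ^+ 4)).
    apply: ler_sum_nat_cond => k kN _.
    by apply: (le_trans (ler_norm _)); exact: cov_near.
  apply: (le_trans (sum_window_le _ _ _ _)); first by rewrite mulr_ge0.
  by rewrite (_ : 3.*2.+1 = 7)%N// le_eqVlt; apply/orP; left; apply/eqP; ring.
apply: (@le_trans _ _ (\sum_(0 <= k < N) 9 * rho * M ^+ 4)); last first.
  by rewrite sumr_const_nat subn0 -[leLHS]mulr_natl.
have c0 : 0 <= 9 * rho * M ^+ 4 by rewrite !mulr_ge0.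
rewrite [leRHS](bigID (window 3 j))/= -[leLHS]add0r lerD//; first exact: sumr_ge0.
apply: ler_sum_nat_cond => k kN njk.
by apply: (le_trans (ler_norm _)); exact: cov_far.
Qed.

Variables (s : R) (s0 : 0 <= s) (Ss : E (fun w => S w ^+ 2) <= s ^+ 2).

Let far_sqr j : E (fun w => far j w ^+ 2) <= (s + 3 * M) ^+ 2.
Proof.
have -> : (fun w => far j w ^+ 2) = (fun w => (S w + -1 * D j w) ^+ 2).
  by apply/funext => w; rewrite mulN1r.
apply: mean_sqrD => //; [exact: L4_L2|by apply: L2Z; exact: L4_L2|by rewrite mulr_ge0|].
by under eq_fun do rewrite mulN1r sqrrN; exact: Dsqr.
Qed.

Let S_split w : S w ^+ 2 = V w + \sum_(0 <= j < N) Z j w * far j w.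
Proof.
rewrite /V -big_split/= expr2 {1}/S mulr_suml; apply: eq_bigr => j _.
by rewrite /ZD /far mulrBr addrC subrK.
Qed.

Let variance_S : `|E (fun w => S w ^+ 2) - E V| <= N%:R * rho * M * (s + 3 * M).
Proof.
have iZf j : L1 Q (fun w => Z j w * far j w) by apply: L2M; exact: L4_L2.
have -> : E (fun w => S w ^+ 2) - E V = \sum_(0 <= j < N) E (fun w => Z j w * far j w).
  under eq_fun do rewrite S_split.
  rewrite meanD; [|exact: L2_L1|exact: L1_sum].
  by rewrite addrC addKr mean_sum.
apply: (le_trans (ler_norm_sum _ _ _)).
apply: (@le_trans _ _ (\sum_(0 <= j < N) rho * M * (s + 3 * M))); last first.
  by rewrite sumr_const_nat subn0 -[leLHS]mulr_natl !mulrA.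
apply: ler_sum_nat_cond => j jN _.
have s30 : 0 <= s + 3 * M by rewrite addr_ge0// mulr_ge0.
have := @Zfar j id jN (@measurable_id _ _ _) (L4_L2 (far4 j)) M (s + 3 * M)
  M0 s30 (Zsqr jN) (far_sqr j).
by rewrite Zmean0// mul0r subr0.
Qed.

(** Stein's identity up to an error: expand [psi] at S around the part of S
that is far from block j; the linear term produces the variance. *)
Let stein_identity (psi psi1 : R -> R) (b v : R) : 0 <= b -> 0 <= v ->
  126 * N%:R * M ^+ 4 + 9 * N%:R ^+ 2 * rho * M ^+ 4 <= v ^+ 2 ->
  measurable_fun setT psi -> measurable_fun setT psi1 ->
  (forall x, `|psi x| <= 1) -> (forall x, `|psi1 x| <= b) ->
  (forall x h, `|psi x - psi (x - h) - h * psi1 x| <= b ^+ 2 * h ^+ 2) ->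
  `|E (fun w => S w * psi (S w)) - E (fun w => S w ^+ 2) * E (fun w => psi1 (S w))|
  <= N%:R * rho * M + b * v + 9 * b ^+ 2 * N%:R * M ^+ 3
     + b * (N%:R * rho * M * (s + 3 * M)).
Proof.
move=> b0 v0 Vv mpsi mpsi1 psi_le1 psi1_le taylor.
have mS : measurable_fun setT S by case: S4.
have mpS : measurable_fun setT (fun w => psi (S w)) by exact: measurableT_comp.
have mp1S : measurable_fun setT (fun w => psi1 (S w)) by exact: measurableT_comp.
have mpf j : measurable_fun setT (fun w => psi (far j w)).
  by apply: measurableT_comp => //; have [] := far4 j.
pose r j w := psi (S w) - psi (far j w) - D j w * psi1 (S w).
have rE j w : `|r j w| <= b ^+ 2 * D j w ^+ 2.
  have := taylor (S w) (D j w); rewrite /r /far.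
  by [].
have pf2 j : L2 Q (fun w => psi (far j w)) by exact: (@L2_bounded _ _ _ Q _ 1).
have iZf j : L1 Q (fun w => Z j w * psi (far j w)).
  by apply: L2M => //; exact: L4_L2.
have mr j : measurable_fun setT (r j).
  apply: measurable_funB; first exact: measurable_funB.
  by apply: measurable_funM => //; have [] := D4 j.
have iZDD j : L1 Q (fun w => `|Z j w * D j w ^+ 2|).
  by apply: L1_norm; apply: L2M (L4_L2 (Z4 j)) (L4M (D4 j) (D4 j)).
have Zr_le j w : `|Z j w * r j w| <= b ^+ 2 * `|Z j w * D j w ^+ 2|.
  rewrite normrM (normrM (Z j w)) mulrCA ler_wpM2l//.
  by rewrite (ger0_norm (sqr_ge0 (D j w))).
have iZr j : L1 Q (fun w => Z j w * r j w).
  apply: L1_dominated (L1Z (b ^+ 2) (iZDD j)) (Zr_le j).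
  by apply: measurable_funM => //; have [] := Z4 j.
have iVp : L1 Q (fun w => V w * psi1 (S w)).
  by apply: L2_L1; apply: L2_Mbounded.
have ip1 : L1 Q (fun w => psi1 (S w)) by exact: L1_bounded.
have split_S w : S w * psi (S w) =
    V w * psi1 (S w) + \sum_(0 <= j < N) (Z j w * psi (far j w) + Z j w * r j w).
  rewrite {1}/S /V !mulr_suml -big_split/=; apply: eq_bigr => j _.
  by rewrite /r /ZD; ring.
have -> : E (fun w => S w * psi (S w)) - E (fun w => S w ^+ 2) * E (fun w => psi1 (S w)) =
    \sum_(0 <= j < N) E (fun w => Z j w * psi (far j w))
    + E (fun w => (V w - E V) * psi1 (S w))
    + \sum_(0 <= j < N) E (fun w => Z j w * r j w)
    + (E V - E (fun w => S w ^+ 2)) * E (fun w => psi1 (S w)).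
  under eq_fun do rewrite split_S.
  have iN j : L1 Q (fun w => Z j w * psi (far j w) + Z j w * r j w) by exact: L1D.
  rewrite meanD//; last exact: L1_sum.
  rewrite mean_sum//; under eq_bigr do rewrite meanD//.
  rewrite big_split/= (_ : (fun w => (V w - E V) * psi1 (S w)) =
    fun w => V w * psi1 (S w) - E V * psi1 (S w)); last first.
    by apply/funext => w; rewrite mulrBl.
  rewrite meanB//; last exact: L1Z.
  by rewrite meanZ//; ring.
apply: (le_trans (ler_normD _ _)); apply: lerD; last first.
  rewrite mulrC normrM ler_pM//.
    by have := norm_mean_le mp1S (L1_cst Q b) (fun w => psi1_le (S w)); rewrite mean_cst.
  by rewrite distrC variance_S.
apply: (le_trans (ler_normD _ _)); apply: lerD; last first.
  apply: (le_trans (ler_norm_sum _ _ _)).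
  apply: (@le_trans _ _ (\sum_(0 <= j < N) 9 * b ^+ 2 * M ^+ 3)); last first.
    rewrite sumr_const_nat subn0 -[leLHS]mulr_natl le_eqVlt; apply/orP; left; apply/eqP; ring.
  apply: ler_sum_nat_cond => j jN _.
  have mZr : measurable_fun setT (fun w => Z j w * r j w) by exact: L1_measurable.
  apply: le_trans (norm_mean_le mZr (L1Z (b ^+ 2) (iZDD j)) (Zr_le j)) _.
  rewrite meanZ// -mulrA mulrCA ler_wpM2l ?sqr_ge0//.
  rewrite (_ : 9 * M ^+ 3 = M * (3 * M) ^+ 2); last by ring.
  apply: (mean_Cauchy_Schwarz_le (L4_L2 (Z4 j)) (L4M (D4 j) (D4 j))) => //.
  - exact: sqr_ge0.
  - exact: Zsqr.
  - rewrite -exprM; apply: le_trans (Dbound j); rewrite le_eqVlt; apply/orP; left.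
    by apply/eqP; congr (mean Q _); apply/funext => w; ring.
apply: (le_trans (ler_normD _ _)); apply: lerD.
  apply: (le_trans (ler_norm_sum _ _ _)).
  apply: (@le_trans _ _ (\sum_(0 <= j < N) rho * M)); last first.
    by rewrite sumr_const_nat subn0 -[leLHS]mulr_natl mulrA.
  apply: ler_sum_nat_cond => j jN _.
  have psi2 : E (fun w => psi (far j w) ^+ 2) <= 1 ^+ 2.
    rewrite expr1n -(mean_cst Q 1); apply: le_mean; [by have [] := pf2 j|exact: L1_cst|].
    by move=> w; rewrite -(real_normK (num_real _)) expr_le1.
  have := @Zfar j psi jN mpsi (pf2 j) M 1 M0 ler01 (Zsqr jN) psi2.
  by rewrite Zmean0// mul0r subr0 mulr1.
have VV2 : L2 Q (fun w => V w - E V) by apply: L2B => //; exact: L2_cst.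
have VV : E (fun w => `|V w - E V|) <= v.
  by apply: mean_norm_le_L2 => //; exact: le_trans variance_V Vv.
have iVV : L1 Q (fun w => `|V w - E V|) by apply: L1_norm; exact: L2_L1.
apply: (@le_trans _ _ (b * E (fun w => `|V w - E V|))); last by rewrite ler_wpM2l.
rewrite -meanZ//; apply: norm_mean_le; last 2 first.
- exact: L1Z.
- by move=> w; rewrite normrM mulrC ler_wpM2r.
- by apply: measurable_funM => //; case: VV2.
Qed.

(** Only neighbouring terms may depend strongly on each other, so Stein's identity
is available for psi (x) = sin (m x) and cos (m x), whose Taylor remainders are
bounded by m^2 h^2; its error then bounds the distance to the characteristic
function of the Gaussian law with the variance of the sum. *)
Lemma char_sum_blocks (l v : R) : 0 <= l -> 0 <= v ->
  126 * N%:R * M ^+ 4 + 9 * N%:R ^+ 2 * rho * M ^+ 4 <= v ^+ 2 ->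
  gaussian_char_defect Q (fun w => \sum_(0 <= j < N) Z j w)
    (E (fun w => (\sum_(0 <= j < N) Z j w) ^+ 2))
    (N%:R * rho * M + l * v + 9 * l ^+ 2 * N%:R * M ^+ 3
     + l * (N%:R * rho * M * (s + 3 * M))) l.
Proof.
move=> l0 v0 Vv; apply: stein_char => //; first exact/L2_L1/L4_L2.
  by apply: mean_ge0 => w; exact: sqr_ge0.
move=> m /andP[m0 ml].
have bound (psi psi1 : R -> R) : measurable_fun setT psi -> measurable_fun setT psi1 ->
    (forall x, `|psi x| <= 1) -> (forall x, `|psi1 x| <= m) ->
    (forall x h, `|psi x - psi (x - h) - h * psi1 x| <= m ^+ 2 * h ^+ 2) ->
    `|E (fun w => S w * psi (S w)) - E (fun w => S w ^+ 2) * E (fun w => psi1 (S w))|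
    <= N%:R * rho * M + l * v + 9 * l ^+ 2 * N%:R * M ^+ 3
     + l * (N%:R * rho * M * (s + 3 * M)).
  move=> mpsi mpsi1 psi_le1 psi1_le taylor.
  apply: (le_trans (stein_identity m0 v0 Vv mpsi mpsi1 psi_le1 psi1_le taylor)).
  have s30 : 0 <= s + 3 * M by rewrite addr_ge0// mulr_ge0.
  rewrite !lerD// ?ler_wpM2r ?mulr_ge0// ?exprn_ge0//.
  by rewrite ler_wpM2l// lerXn2r// nnegrE.
have ms : measurable_fun setT (fun x : R => sin (m * x)).
  by apply: measurableT_comp; [exact: continuous_sin_measurable|exact: measurable_funM].
have mc : measurable_fun setT (fun x : R => cos (m * x)).
  by apply: measurableT_comp; [exact: continuous_cos_measurable|exact: measurable_funM].
have iSc : L1 Q (fun w => cos (m * S w)) by apply: L1_cos; case: S4.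
have iSs : L1 Q (fun w => sin (m * S w)) by apply: L1_sin; case: S4.
split.
  have := bound (fun x => sin (m * x)) (fun x => m * cos (m * x)) ms
    (measurable_funM (measurable_cst _) mc).
  rewrite meanZ// mulrA; apply.
  - by move=> x; exact: norm_sin_le1.
  - by move=> x; rewrite normrM ger0_norm// ler_piMr// norm_cos_le1.
  move=> x h; rewrite mulrBr.
  rewrite (mulrCA h) -exprMn mulrA; apply: (@taylor_of_derivative R sin cos (fun x => - sin x)).
  by move=> y; rewrite normrN norm_sin_le1.
have := bound (fun x => cos (m * x)) (fun x => m * - sin (m * x)) mc
    (measurable_funM (measurable_cst _) (measurableT_comp (@oppr_measurable R setT) ms)).
rewrite (_ : (fun w => m * - sin (m * S w)) = (fun w => - m * sin (m * S w))); last first.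
  by apply/funext => w; rewrite mulrN mulNr.
rewrite meanZ// mulNr mulrN opprK mulrA; apply.
- by move=> x; exact: norm_cos_le1.
- by move=> x; rewrite normrM ger0_norm// ler_piMr// normrN norm_sin_le1.
move=> x h; rewrite mulrBr.
rewrite (mulrCA h) -exprMn mulrA.
apply: (@taylor_of_derivative R cos (fun x => - sin x) (fun x => - cos x)).
by move=> y; rewrite normrN norm_cos_le1.
Qed.

End stein_sum.

(** * From characteristic functions to convergence in distribution *)

Section approximation.
Context {R : realType}.

(** Continuity is asked at the points of the segment, as points of the line; this
is why one of the two points of the conclusion may lie outside. *)
Lemma uniform_continuity_segment (f : R -> R) (a b eta : R) :
  (forall x, a <= x <= b -> {for x, continuous f}) -> 0 < eta ->
  exists2 delta, 0 < delta & forall x y, a <= x <= b -> `|x - y| <= delta ->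
    `|f x - f y| <= eta.
Proof.
move=> cf eta0.
have /compact_near_coveringP ncov := @segment_compact R a b.
pose P (r x : R) := forall y, `|x - y| <= r -> `|f x - f y| <= eta.
have loc (x : R) : `[a, b]%classic x -> \forall x' \near x & r \near 0^'+, P r x'.
  move=> /=; rewrite in_itv/= => xab.
  have /cvgrPdist_le/(_ (eta / 2)) := cf x xab.
  have eta2 : 0 < eta / 2 by rewrite divr_gt0.
  move=> /(_ eta2)[r /= r0 fr].
  exists (ball x (r / 2), [set t | t < r / 2]) => /=.
    split; first by apply: nbhsx_ballx; rewrite divr_gt0.
    by apply: nbhs_right_lt; rewrite divr_gt0.
  move=> [x' t]/= [xx' tr] y x'y.
  have fx' : `|f x - f x'| <= eta / 2.
    by apply: fr => /=; rewrite (lt_trans xx')// ltr_pdivrMr// ltr_pMr// ltr1n.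
  have fy : `|f x - f y| <= eta / 2.
    apply: fr => /=; rewrite (_ : x - y = (x - x') + (x' - y)); last by ring.
    rewrite (le_lt_trans (ler_normD _ _))// (splitr r) ltrD//.
    exact: le_lt_trans tr.
  rewrite (_ : f x' - f y = (f x - f y) - (f x - f x')); last by ring.
  by rewrite (le_trans (ler_normB _ _))// [leRHS]splitr lerD.
have [r [r0 Pr]] : exists r, 0 < r /\ (`[a, b]%classic `<=` P r).
  have := ncov _ (0^'+) P _ loc => near_P.
  have : \forall r \near 0^'+, 0 < r /\ (`[a, b]%classic `<=` P r).
    near=> r; split; first by near: r; exact: nbhs_right_gt.
    by near: r; exact: near_P.
  by move=> /filter_ex.
by exists r => // x y xab xy; apply: Pr => //=.
Unshelve. all: by end_near. Qed.

(** [bernstein n g x] is the expectation of g at a binomial variable with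
parameters n and x, computed by conditioning on the first trial; this recursion
replaces the binomial coefficients. *)
Fixpoint bernstein (n : nat) (g : R -> R) (x : R) : R :=
  if n is m.+1 then
    x * bernstein m (fun k => g (k + 1)) x + (1 - x) * bernstein m g x
  else g 0.

Lemma bernsteinD n (g h : R -> R) x :
  bernstein n (fun k => g k + h k) x = bernstein n g x + bernstein n h x.
Proof. by elim: n g h => //= n ih g h; rewrite !ih; ring. Qed.

Lemma bernsteinZ n c (g : R -> R) x :
  bernstein n (fun k => c * g k) x = c * bernstein n g x.
Proof. by elim: n g => //= n ih g; rewrite !ih; ring. Qed.

Lemma bernstein_cst n c x : bernstein n (fun=> c) x = c.
Proof. by elim: n => //= n ->; ring. Qed.

Lemma le_bernstein n (g h : R -> R) x : 0 <= x <= 1 ->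
  (forall k, g k <= h k) -> bernstein n g x <= bernstein n h x.
Proof.
move=> /andP[x0 x1]; elim: n g h => //= n ih g h gh.
by rewrite lerD// ler_wpM2l ?subr_ge0// ih// => k; exact: gh.
Qed.

(** A binomial variable with parameters n and x has mean n x and variance
n x (1 - x). *)
Lemma bernstein_moments n x (c : R) :
  bernstein n (fun k => k - c) x = n%:R * x - c /\
  bernstein n (fun k => (k - c) ^+ 2) x = (n%:R * x - c) ^+ 2 + n%:R * x * (1 - x).
Proof.
elim: n c => [c|n ih c] /=; first by split; ring.
have s1 : (fun k : R => k + 1 - c) = (fun k => k - (c - 1)) by apply/funext => k; ring.
have s2 : (fun k : R => (k + 1 - c) ^+ 2) = (fun k => (k - (c - 1)) ^+ 2).
  by apply/funext => k; ring.
rewrite s1 s2; have [-> ->] := ih (c - 1); have [-> ->] := ih c.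
by rewrite -natr1; split; ring.
Qed.

(** Weierstrass' theorem by Chebyshev's inequality for the binomial law. *)
Lemma bernstein_approximation (g : R -> R) (B eta delta : R) (n : nat) (x : R) :
  0 < delta -> 0 <= B -> (forall y z, `|y - z| <= delta -> `|g y - g z| <= eta) ->
  (forall y, `|g y| <= B) -> 0 <= x <= 1 -> (0 < n)%N ->
  `|bernstein n (fun k => g (k / n%:R)) x - g x| <= eta + 2 * B / (delta ^+ 2 * n%:R).
Proof.
move=> d0 B0 gunif gB x01 n0.
have n0' : 0 < n%:R :> R by rewrite ltr0n.
have eta0 : 0 <= eta.
  by apply: le_trans (gunif 0 0 _); rewrite subrr normr0// ltW.
pose q (k : R) := eta + 2 * B / (delta ^+ 2 * n%:R ^+ 2) * (k - n%:R * x) ^+ 2.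
have gq k : `|g (k / n%:R) - g x| <= q k.
  have [kd|kd] := leP `|k / n%:R - x| delta.
    rewrite (le_trans (gunif _ _ kd))// lerDl mulr_ge0 ?sqr_ge0//.
    by apply: divr_ge0; apply: mulr_ge0 => //; exact: sqr_ge0.
  rewrite (le_trans (ler_normB _ _))// (@le_trans _ _ (2 * B))//.
    by have := gB (k / n%:R); have := gB x; lra.
  rewrite -[leLHS]add0r lerD// -[leLHS]mulr1 -[X in _ <= X]mulrA ler_wpM2l ?mulr_ge0//.
  have -> : k - n%:R * x = n%:R * (k / n%:R - x) by field; rewrite gt_eqF.
  rewrite exprMn (_ : _^-1 * _ = (k / n%:R - x) ^+ 2 / delta ^+ 2); last first.
    by field; rewrite !gt_eqF.
  rewrite ler_pdivlMr ?exprn_gt0// mul1r -(real_normK (num_real (_ - x))).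
  by rewrite lerXn2r ?nnegrE// ltW.
have bq : bernstein n q x <= eta + 2 * B / (delta ^+ 2 * n%:R).
  rewrite bernsteinD bernsteinZ bernstein_cst; have [_ ->] := bernstein_moments n x (n%:R * x).
  rewrite lerD2l subrr expr0n/= add0r.
  rewrite (_ : _ * _ = 2 * B / (delta ^+ 2 * n%:R) * (x * (1 - x))); last first.
    by field; rewrite !gt_eqF.
  rewrite ler_piMr//; last by move: x01 => /andP[]; nra.
  by rewrite divr_ge0 ?mulr_ge0// ?sqr_ge0// ltW.
have -> : bernstein n (fun k => g (k / n%:R)) x - g x =
    bernstein n (fun k => g (k / n%:R) + - g x) x.
  by rewrite bernsteinD bernstein_cst.
apply: le_trans bq; rewrite ler_norml -[X in X <= _]mulN1r -bernsteinZ.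
by apply/andP; split; apply: le_bernstein => // k; have := gq k; rewrite ler_norml => /andP[]; lra.
Qed.

(** The functions whose means are determined by characteristic functions; they
are closed under products because products of sines and cosines linearize. *)
Inductive trig_poly : (R -> R) -> Prop :=
| trig_cos l : trig_poly (fun x => cos (l * x))
| trig_sin l : trig_poly (fun x => sin (l * x))
| trigD g h : trig_poly g -> trig_poly h -> trig_poly (fun x => g x + h x)
| trigZ c g : trig_poly g -> trig_poly (fun x => c * g x).

Lemma trig_cst c : trig_poly (fun=> c).
Proof.
have := trigZ c (trig_cos 0); congr trig_poly.
by apply/funext => x; rewrite mul0r cos0 mulr1.
Qed.

Lemma trig_mul_sin c g : trig_poly g -> trig_poly (fun x => sin (c * x) * g x).
Proof.
elim=> {g} [l|l|g h _ ihg _ ihh|k g _ ih].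
- have := trigZ 2^-1 (trigD (trig_sin (c + l)) (trig_sin (c - l))).
  congr trig_poly; apply/funext => x; rewrite mulrBl mulrDl sinD sinB; by field.
- have := trigZ 2^-1 (trigD (trig_cos (c - l)) (trigZ (-1) (trig_cos (c + l)))).
  congr trig_poly; apply/funext => x; rewrite mulrBl cosB mulrDl cosD; by field.
- have := trigD ihg ihh; congr trig_poly; apply/funext => x; ring.
- have := trigZ k ih; congr trig_poly; apply/funext => x; ring.
Qed.

Lemma trig_bernstein c n g :
  trig_poly (fun x => bernstein n g ((1 + sin (c * x)) / 2)).
Proof.
elim: n g => [|n ih] g /=; first exact: trig_cst.
have h1 := trigD (trigZ 2^-1 (ih (fun k => g (k + 1))))
  (trigZ 2^-1 (trig_mul_sin c (ih (fun k => g (k + 1))))).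
have h2 := trigD (trigZ 2^-1 (ih g)) (trigZ (- 2^-1) (trig_mul_sin c (ih g))).
have := trigD h1 h2; congr trig_poly; apply/funext => x; by field.
Qed.

(** On [-M, M] the variable sin (x / M) is a homeomorphism onto its image, so a
polynomial in it approximates any continuous function there; unlike a polynomial
in x, it stays bounded on the whole line, and it is a trigonometric polynomial. *)
Lemma trig_approximation (h : R -> R) (B M eta : R) : continuous h ->
  (forall x, `|h x| <= B) -> 0 < M -> 0 < eta ->
  exists g, [/\ trig_poly g, (forall x, `|g x| <= B + eta) &
    forall x, `|x| <= M -> `|g x - h x| <= eta].
Proof.
move=> ch hB M0 eta0.
have B0 : 0 <= B by exact: le_trans (hB 0).
(* For |x| <= M the value sin (x / M) stays in [-s, s], where asin is continuous
because s < 1. *)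
pose s : R := sin 1.
have pi1 : 1 < pi / 2 :> R.
  rewrite lt_neqAle pihalf_ge1 andbT; apply/eqP => e1.
  have := @cos_pihalf R; rewrite -e1 => c1.
  by have := @cos1_gt0 R; rewrite c1 ltxx.
have s0 : 0 < s by apply: sin_gt0_pihalf; rewrite ltr01.
have s1 : s < 1.
  rewrite -(@sin_pihalf R) ltr_sin// in_itv/=; have := @pi_gt0 R; move: pi1; lra.
pose H y := h (M * asin y).
have cH y : - s <= y <= s -> {for y, continuous H}.
  move=> /andP[y1 y2].
  have casin : {for y, continuous (@asin R)}.
    by apply: continuous_asin; apply/andP; split; lra.
  apply: (@continuous_comp _ _ _ (fun z => M * asin z) h); last exact: ch.
  by apply: cvgMr; exact: casin.
have eta2 : 0 < eta / 2 by rewrite divr_gt0.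
have [delta d0 Hunif] := uniform_continuity_segment cH eta2.
(* The function to approximate on [0, 1] takes at (1 + sin (x / M)) / 2 the value
h x; beyond [-s, s] it is continued by constants. *)
pose cut (v : R) := if v <= - s then - s else if s <= v then s else v.
pose clamp (y : R) := cut (2 * y - 1).
have clamp_s y : - s <= clamp y <= s.
  rewrite /clamp /cut; case: (leP (2 * y - 1)) => h1; first by apply/andP; split; lra.
  by case: (leP s) => h2; apply/andP; split; lra.
have cut_lip (u v : R) : `|cut u - cut v| <= `|u - v|.
  have := ler_norm (u - v); have := ler_norm (v - u); rewrite (distrC v) => uv vu.
  rewrite /cut; case: (leP u) => u1; case: (leP v) => v1; rewrite ?subrr ?normr0 ?normr_ge0//.
  - case: (leP s v) => v2; rewrite ler_norml; apply/andP; split; lra.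
  - case: (leP s u) => u2; rewrite ler_norml; apply/andP; split; lra.
  - case: (leP s u) => u2; case: (leP s v) => v2; rewrite ler_norml; apply/andP; split; lra.
have clamp_lip y z : `|clamp y - clamp z| <= 2 * `|y - z|.
  have -> : 2 * `|y - z| = `|(2 * y - 1) - (2 * z - 1)|.
    rewrite (_ : _ - (2 * z - 1) = 2 * (y - z)); last by ring.
    by rewrite normrM ger0_norm.
  exact: cut_lip.
pose g y := H (clamp y).
have gunif y z : `|y - z| <= delta / 2 -> `|g y - g z| <= eta / 2.
  move=> yz; apply: Hunif => //; apply: (le_trans (clamp_lip y z)).
  by rewrite mulrC -ler_pdivlMr.
have gB y : `|g y| <= B by exact: hB.
have d2 : 0 < delta / 2 by rewrite divr_gt0.
pose n := (Num.truncn (2 * B / ((delta / 2) ^+ 2 * (eta / 2)))).+1.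
have n_large : 2 * B / ((delta / 2) ^+ 2 * n%:R) <= eta / 2.
  rewrite ler_pdivrMr ?mulr_gt0 ?exprn_gt0//.
  rewrite [leRHS](_ : _ = n%:R * ((delta / 2) ^+ 2 * (eta / 2))); last by ring.
  rewrite -ler_pdivrMr ?mulr_gt0 ?exprn_gt0//.
  by apply: ltW; rewrite /n; exact: truncnS_gt.
have sin01 (x : R) : 0 <= (1 + sin (M^-1 * x)) / 2 <= 1.
  by have := sin_geN1 (M^-1 * x); have := sin_le1 (M^-1 * x); lra.
have approx x := bernstein_approximation d2 B0 gunif gB (sin01 x) (ltn0Sn _ : (0 < n)%N).
exists (fun x => bernstein n (fun k => g (k / n%:R)) ((1 + sin (M^-1 * x)) / 2)).
split; first exact: trig_bernstein.
  move=> x; have := approx x; have := gB ((1 + sin (M^-1 * x)) / 2).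
  rewrite !ler_norml => /andP[? ?] /andP[? ?]; apply/andP; split; lra.
move=> x xM.
have -> : h x = g ((1 + sin (M^-1 * x)) / 2).
  have xM1 : -1 <= M^-1 * x <= 1.
    move: xM; rewrite ler_norml => /andP[? ?].
    by rewrite [M^-1 * x]mulrC ler_pdivlMr// ler_pdivrMr//; apply/andP; split; lra.
  have in_pi (y : R) : -1 <= y <= 1 -> y \in `[(- (pi / 2)), (pi / 2)].
    by move=> /andP[? ?]; rewrite in_itv/=; apply/andP; split; lra.
  have clampE : clamp ((1 + sin (M^-1 * x)) / 2) = sin (M^-1 * x).
    rewrite /clamp (_ : 2 * _ - 1 = sin (M^-1 * x)) /cut; last by field.
    have sle : sin (M^-1 * x) <= s.
      by rewrite /s leNgt ltr_sin ?in_pi// -?leNgt; lra.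
    have sge : - s <= sin (M^-1 * x).
      by rewrite /s -sinN leNgt ltr_sin ?in_pi// -?leNgt; lra.
    case: (leP (sin _)) => h1; first by apply/eqP; rewrite eq_le sge h1.
    by case: (leP s) => h2 //; apply/eqP; rewrite eq_le sle h2.
  by rewrite /g /H clampE sinK ?in_pi// mulrA divff ?mul1r// gt_eqF.
by apply: (le_trans (approx x)); lra.
Qed.

End approximation.

Section convergence_of_means.
Context {d d' : measure_display} {T : measurableType d} {T' : measurableType d'}.
Context {R : realType} (Q : probability T R) (Q' : probability T' R).

(** Bounded first moments make the mass beyond M of size K / M. Up to an error
uniform in n, a bounded continuous test function may therefore be replaced by the
trigonometric polynomial of [trig_approximation]. *)
Lemma cvg_mean_of_char (X : nat -> T -> R) (Y : T' -> R) (K : R) :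
  (forall n, L1 Q (X n)) -> L1 Q' Y ->
  (forall n, mean Q (fun w => `|X n w|) <= K) -> mean Q' (fun w => `|Y w|) <= K ->
  (forall l, 0 <= l ->
    mean Q (fun w => cos (l * X n w)) @[n --> \oo] --> mean Q' (fun w => cos (l * Y w))) ->
  (forall l, 0 <= l ->
    mean Q (fun w => sin (l * X n w)) @[n --> \oo] --> mean Q' (fun w => sin (l * Y w))) ->
  forall h, continuous h -> (exists B, forall x, `|h x| <= B) ->
    mean Q (fun w => h (X n w)) @[n --> \oo] --> mean Q' (fun w => h (Y w)).
Proof.
move=> iX iY XK YK ccos csin h ch [B hB].
have mX n := L1_measurable (iX n); have mY := L1_measurable iY.
have trig g : trig_poly g ->
    [/\ measurable_fun setT g, (exists C, forall x, `|g x| <= C) &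
     mean Q (fun w => g (X n w)) @[n --> \oo] --> mean Q' (fun w => g (Y w))].
  elim=> {g} [l|l|g1 g2 _ [mg1 [C1 b1] c1] _ [mg2 [C2 b2] c2]|c g _ [mg [C b] cg]].
  - split.
    + by apply: measurableT_comp; [exact: continuous_cos_measurable|exact: measurable_funM].
    + by exists 1 => x; exact: norm_cos_le1.
    + have [/ccos//|l0] := leP 0 l.
      have := ccos (- l); rewrite oppr_ge0 (ltW l0) => /(_ isT).
      have e1 (Z : R) : cos (- l * Z) = cos (l * Z) by rewrite mulNr cosN.
      by under [X in X @ _ --> _]eq_fun do under eq_fun do rewrite e1;
        under [X in _ --> mean Q' X]eq_fun do rewrite e1.
  - split.
    + by apply: measurableT_comp; [exact: continuous_sin_measurable|exact: measurable_funM].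
    + by exists 1 => x; exact: norm_sin_le1.
    + have [/csin//|l0] := leP 0 l.
      have l0' : 0 <= - l by rewrite oppr_ge0 ltW.
      have eX n : - mean Q (fun w => sin (- l * X n w)) = mean Q (fun w => sin (l * X n w)).
        rewrite -meanN; last first.
          apply: (@L1_bounded _ _ _ Q _ 1) => [|w]; last exact: norm_sin_le1.
          by apply: measurableT_comp; [exact: continuous_sin_measurable|exact: measurable_funM].
        by congr mean; apply/funext => w; rewrite mulNr sinN opprK.
      have eY : - mean Q' (fun w => sin (- l * Y w)) = mean Q' (fun w => sin (l * Y w)).
        rewrite -meanN; last first.
          apply: (@L1_bounded _ _ _ Q' _ 1) => [|w]; last exact: norm_sin_le1.
          by apply: measurableT_comp; [exact: continuous_sin_measurable|exact: measurable_funM].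
        by congr mean; apply/funext => w; rewrite mulNr sinN opprK.
      rewrite -eY (_ : (fun n => _) = (fun n => - mean Q (fun w => sin (- l * X n w)))).
        by apply: cvgN; exact: csin.
      by apply/funext => n; rewrite eX.
  - split; first exact: measurable_funD.
      by exists (C1 + C2) => x; rewrite (le_trans (ler_normD _ _))// lerD.
    have i1 n : L1 Q (fun w => g1 (X n w)).
      by apply: (@L1_bounded _ _ _ _ _ C1) => //; exact: measurableT_comp.
    have i2 n : L1 Q (fun w => g2 (X n w)).
      by apply: (@L1_bounded _ _ _ _ _ C2) => //; exact: measurableT_comp.
    rewrite meanD; [|by apply: (@L1_bounded _ _ _ _ _ C1) => //; exact: measurableT_comp
      |by apply: (@L1_bounded _ _ _ _ _ C2) => //; exact: measurableT_comp].
    under [X in X @ _ --> _]eq_fun do rewrite meanD//.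
    exact: cvgD.
  - split; first exact: measurable_funM.
      by exists (`|c| * C) => x; rewrite normrM ler_wpM2l.
    have i1 n : L1 Q (fun w => g (X n w)) by apply: (@L1_bounded _ _ _ _ _ C) => //; exact: measurableT_comp.
    rewrite meanZ; last by apply: (@L1_bounded _ _ _ _ _ C) => //; exact: measurableT_comp.
    under [X in X @ _ --> _]eq_fun do rewrite meanZ//.
    exact: cvgMr.
have B0 : 0 <= B by exact: le_trans (hB 0).
have K0 : 0 <= K by apply: le_trans (XK 0%N); apply: mean_ge0.
apply/cvgrPdist_le => e e0.
pose eta := Num.min 1 (e / 8).
have eta0 : 0 < eta by rewrite lt_min ltr01/= divr_gt0.
have eta8 : eta <= e / 8 by rewrite ge_min lexx orbT.
pose M := (2 * B + 1) * (K + 1) * 8 / e.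
have M0 : 0 < M by rewrite /M divr_gt0// !mulr_gt0// ltr_wpDl// mulr_ge0.
have [g [tg gB gh]] := trig_approximation ch hB M0 eta0.
have [mg _ cg] := trig _ tg.
have mh : measurable_fun setT h by exact: continuous_measurable_fun.
have ptw x : `|g x - h x| <= eta + (2 * B + 1) / M * `|x|.
  have [xM|xM] := leP `|x| M.
    by rewrite (le_trans (gh _ xM))// lerDl mulr_ge0// divr_ge0 ?(ltW M0)// addr_ge0// mulr_ge0.
  have c0 : 0 <= 2 * B + 1 by rewrite addr_ge0// mulr_ge0.
  apply: (@le_trans _ _ (2 * B + 1 + eta)).
    rewrite (le_trans (ler_normB _ _))//.
    by have := gB x; have := hB x; lra.
  rewrite addrC lerD2l// -[leLHS]mulr1 -mulrA ler_wpM2l//.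
  by rewrite mulrC ler_pdivlMr// mul1r ltW.
have small : eta + (2 * B + 1) / M * K <= e / 4.
  have : (2 * B + 1) / M * K <= e / 8.
    rewrite /M (_ : _ * K = e / 8 * (K / (K + 1))); last first.
      have K1 : K + 1 != 0 by rewrite gt_eqF// ltr_wpDl.
      have B1 : 2 * B + 1 != 0 by rewrite gt_eqF// ltr_wpDl// mulr_ge0.
      by field; rewrite K1 B1 gt_eqF.
    rewrite ler_piMr//; first by rewrite divr_ge0// ltW.
    by rewrite ler_pdivrMr ?ltr_wpDl// mul1r lerDl.
  lra.
have dist (d0 : measure_display) (T0 : measurableType d0) (P : probability T0 R) (Z : T0 -> R) :
    L1 P Z -> mean P (fun w => `|Z w|) <= K ->
    `|mean P (fun w => g (Z w)) - mean P (fun w => h (Z w))| <= e / 4.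
  move=> iZ ZK; have mZ := L1_measurable iZ.
  have ig : L1 P (fun w => g (Z w)).
    by apply: (@L1_bounded _ _ _ _ _ (B + eta)) => //; exact: measurableT_comp.
  have ih : L1 P (fun w => h (Z w)).
    by apply: (@L1_bounded _ _ _ _ _ B) => //; exact: measurableT_comp.
  rewrite -meanB//; apply: le_trans small.
  apply: (@le_trans _ _ (mean P (fun w => eta + (2 * B + 1) / M * `|Z w|))).
    apply: norm_mean_le => //; first by apply: measurable_funB; exact: measurableT_comp.
    by apply: L1D; [exact: L1_cst|apply: L1Z; exact: L1_norm].
  rewrite meanD; [|exact: L1_cst|by apply: L1Z; exact: L1_norm].
  rewrite mean_cst meanZ; last exact: L1_norm.
  by rewrite lerD2l ler_wpM2l// divr_ge0 ?(ltW M0)// addr_ge0// mulr_ge0.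
have /cvgrPdist_le/(_ (e / 2)) := cg.
rewrite divr_gt0// => /(_ isT); apply: filterS => n.
have := dist _ _ _ _ (iX n) (XK n); have := dist _ _ _ _ iY YK.
rewrite !ler_norml => /andP[? ?] /andP[? ?] /andP[? ?]; apply/andP; split; lra.
Qed.

End convergence_of_means.

(** * Time averages of a random process *)

Section lebesgue.
Context {R : realType}.
Local Notation mu := (@lebesgue_measure R).

Lemma lebesgue_itv_lty (a b : R) : (mu `[a, b] < +oo)%E.
Proof. by rewrite lebesgue_measure_itv; case: ifP => _; rewrite ?EFinN -?EFinB ltry. Qed.

Lemma fine_lebesgue_itv (a b : R) : a <= b -> fine (mu `[a, b]) = b - a.
Proof.
rewrite lebesgue_measure_itv/= lte_fin le_eqVlt => /predU1P[->|->].
  by rewrite ltxx subrr.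
by [].
Qed.

Lemma integrable_bounded (D : set R) (f : R -> R) (B : R) : measurable D ->
  (mu D < +oo)%E -> measurable_fun D f -> (forall s, D s -> `|f s| <= B) ->
  mu.-integrable D (EFin \o f).
Proof.
move=> mD Dfin mf fB; apply: measurable_bounded_integrable => //.
exists B; split; first exact: num_real.
by move=> M BM s Ds; apply: (le_trans (fB s Ds)); exact: ltW.
Qed.

Lemma norm_Rintegral_le (D : set R) (f : R -> R) (B : R) : measurable D ->
  (mu D < +oo)%E -> measurable_fun D f -> (forall s, D s -> `|f s| <= B) ->
  `|\int[mu]_(s in D) f s| <= B * fine (mu D).
Proof.
move=> mD Dfin mf fB; have iF := integrable_bounded mD Dfin mf fB.
apply: (le_trans (@le_normr_Rintegral _ _ _ mu _ _ mD iF)).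
rewrite -Rintegral_cst//; apply: le_Rintegral => //.
  by apply: integrable_norm.
apply: (@integrable_bounded _ _ `|B|) => //; exact: measurable_cst.
Qed.

(** Jensen's inequality for the square. *)
Lemma sqr_Rintegral_le (a b : R) (f : R -> R) (B : R) : a < b ->
  measurable_fun `[a, b] f -> (forall s, `[a, b]%classic s -> `|f s| <= B) ->
  (\int[mu]_(s in `[a, b]) f s) ^+ 2 <= (b - a) * \int[mu]_(s in `[a, b]) (f s ^+ 2).
Proof.
move=> ab mf fB; have Dfin := lebesgue_itv_lty a b.
have mD : measurable `[a, b]%classic by exact: measurable_itv.
have iF := integrable_bounded mD Dfin mf fB.
have iF2 : mu.-integrable `[a, b] (EFin \o (fun s => f s ^+ 2)).
  apply: (@integrable_bounded _ _ (B ^+ 2)) => //; first exact: measurable_funX.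
  move=> s Ds; rewrite normrX lerXn2r ?nnegrE//; last exact: fB.
  exact: le_trans (fB s Ds).
have iC c : mu.-integrable `[a, b] (EFin \o (fun=> c)).
  by apply: (@integrable_bounded _ _ `|c|) => //; exact: measurable_cst.
set I := \int[mu]_(s in `[a, b]) f s.
set J := \int[mu]_(s in `[a, b]) (f s ^+ 2).
have l0 : 0 < b - a by rewrite subr_gt0.
have iZ c (h : R -> R) : mu.-integrable `[a, b] (EFin \o h) ->
    mu.-integrable `[a, b] (EFin \o (fun s => c * h s)).
  by move=> ih; have := @integrableZl _ _ _ mu _ mD c _ ih.
have iB (h k : R -> R) : mu.-integrable `[a, b] (EFin \o h) ->
    mu.-integrable `[a, b] (EFin \o k) ->
    mu.-integrable `[a, b] (EFin \o (fun s => h s - k s)).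
  by move=> ih ik; have := @integrableB _ _ _ mu _ mD _ _ ih ik.
have : 0 <= \int[mu]_(s in `[a, b]) ((b - a) * f s - I) ^+ 2.
  by apply: Rintegral_ge0 => s _; exact: sqr_ge0.
under eq_Rintegral => s _.
  rewrite (_ : _ ^+ 2 = (b - a) ^+ 2 * f s ^+ 2 - (2 * (b - a) * I * f s - I ^+ 2)); last by ring.
  over.
rewrite RintegralB//; [|exact: iZ|by apply: iB; [exact: iZ|exact: iC]].
rewrite RintegralB//; last exact: iZ.
rewrite !RintegralZl// Rintegral_cst// (fine_lebesgue_itv (ltW ab)) -/I -/J.
rewrite [X in 0 <= X](_ : _ = (b - a) * ((b - a) * J - I ^+ 2)); last by ring.
by rewrite pmulr_rge0// subr_ge0.
Qed.

End lebesgue.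

Section fubini_process.
Context {d : measure_display} {T : measurableType d} {R : realType}.
Variable Q : probability T R.
Local Notation mu := (@lebesgue_measure R).

(** Over a time domain of finite measure, one bound on all the first absolute
moments gives integrability on the product space. *)
Lemma fubini_process (D : set R) (u : R -> T -> R) (K : R) : measurable D ->
  (mu D < +oo)%E -> measurable_fun setT (fun p : R * T => u p.1 p.2) ->
  (forall s, D s -> L1 Q (u s) /\ mean Q (fun w => `|u s w|) <= K) ->
  (forall w, mu.-integrable D (EFin \o u^~ w)) ->
  [/\ L1 Q (fun w => \int[mu]_(s in D) u s w),
      measurable_fun D (fun s => mean Q (u s)) &
      mean Q (fun w => \int[mu]_(s in D) u s w) =
      \int[mu]_(s in D) mean Q (u s)].
Proof.
move=> mD Dfin mu_u uK ipath.
pose f (p : T * R) := ((EFin \o u^~ p.1) \_ D) p.2.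
have fE p : f p = (u p.2 p.1 * \1_D p.2)%:E.
  rewrite /f /patch indicE; case: ifP => pD; rewrite ?mulr1 ?mulr0//.
have mf : measurable_fun setT f.
  rewrite (_ : f = EFin \o (fun p => u p.2 p.1 * \1_D p.2)); last first.
    by apply/funext => p; rewrite fE.
  apply/measurable_EFinP; apply: measurable_funM.
    pose sw (p : T * R) := (p.2, p.1).
    have msw : measurable_fun setT sw by apply: measurable_fun_pair.
    exact: (measurableT_comp mu_u msw).
  by apply: measurableT_comp; [exact: measurable_indic|exact: measurable_snd].
have K0 (s : R) : D s -> 0 <= K.
  by move=> /uK[_]; apply: le_trans; exact: mean_ge0.
have fin_mean s : D s -> (\int[Q]_w `|f (w, s)|)%E = (mean Q (fun w => `|u s w|))%:E.
  move=> Ds; have [iu _] := uK s Ds.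
  rewrite /mean /Rintegral fineK; last first.
    apply: integrable_fin_num => //; exact: L1_norm.
  by apply: eq_integral => w _; rewrite fE indicE mem_set//= mulr1.
have zero_out s : ~ D s -> (\int[Q]_w `|f (w, s)|)%E = 0%E.
  move=> nDs; rewrite -(integral0 Q setT); apply: eq_integral => w _.
  by rewrite fE indicE memNset//= mulr0 normr0.
have if_ : ((Q : {sigma_finite_measure set T -> \bar R}) \x mu)%E.-integrable setT f.
  apply/integrable21ltyP => //.
  apply: (@le_lt_trans _ _ (\int[mu]_(s in D) K%:E)%E); last first.
    rewrite integral_cst//; have [->|/set0P[s /K0 K00]] := eqVneq D set0.
      by rewrite measure0 mule0.
    by rewrite lte_mul_pinfty.
  rewrite [leRHS]integral_mkcond; apply: ge0_le_integral => //.
  - by move=> s _; apply: integral_ge0.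
  - apply: (@measurable_fun_fubini_tonelli_G _ _ _ _ _ Q (abse \o f)) => [|p].
      exact: measurableT_comp.
    exact: abse_ge0.
  - by apply/measurable_restrict => //; rewrite setTI; exact: measurable_cst.
  - move=> s _; rewrite /patch; case: ifPn => [/set_mem Ds|/negP nD].
      by rewrite fin_mean// lee_fin; have [_] := uK s Ds.
    by rewrite zero_out// => Ds; apply: nD; exact: mem_set.
have FE : fubini_F mu f = EFin \o (fun w => \int[mu]_(s in D) u s w).
  apply/funext => w; rewrite /fubini_F /= /Rintegral fineK; last first.
    exact: (@integrable_fin_num _ _ _ mu _ mD _ (ipath w)).
  by rewrite [RHS]integral_mkcond.
have GE s : D s -> fubini_G Q f s = (mean Q (u s))%:E.
  move=> Ds; have [iu _] := uK s Ds.
  rewrite /fubini_G /mean /Rintegral fineK; last exact: integrable_fin_num.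
  by apply: eq_integral => w _; rewrite fE indicE mem_set//= mulr1.
have GE' : fubini_G Q f = (EFin \o (fun s => mean Q (u s))) \_ D.
  apply/funext => s; rewrite /patch; case: ifPn => [/set_mem/GE//|/negP nD].
  transitivity (0%E : \bar R) => //; rewrite /fubini_G -(integral0 Q setT); apply: eq_integral => w _.
  by rewrite fE indicE memNset ?mulr0// => Ds; apply: nD; exact: mem_set.
have iF := integrable_fubini_F if_.
have mG := measurable_fubini_G if_.
split.
- by rewrite /L1 -FE.
- have : measurable_fun setT ((EFin \o (fun s => mean Q (u s))) \_ D).
    by rewrite -GE'; exact: mG.
  by move/(measurable_restrict _ mD measurableT); rewrite setTI => /measurable_EFinP.
- rewrite {1}/mean /Rintegral -/(Rintegral _ _ _); congr fine.
  transitivity (\int[Q]_w fubini_F mu f w)%E; first by rewrite FE.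
  rewrite integral12_prod_meas1// -integral21_prod_meas1// [RHS]integral_mkcond.
  by apply: eq_integral => s _; rewrite -GE'.
Qed.

End fubini_process.

Section weighted_average.
Context {d : measure_display} {T : measurableType d} {R : realType}.
Variable Q : probability T R.
Local Notation mu := (@lebesgue_measure R).
Local Notation E := (mean Q).

Variables (Y : R -> T -> R) (V : R).
Hypothesis mY : measurable_fun setT (fun p : R * T => Y p.1 p.2).
Hypothesis Ypath : forall w, exists B, forall s, `|Y s w| <= B.
Hypothesis Y4 : forall s, L4 Q (Y s).
Hypothesis V0 : 0 <= V.
Hypothesis YV : forall s, E (fun w => Y s w ^+ 4) <= V ^+ 4.

Variables (g : R -> R) (C : R).
Hypothesis mg : measurable_fun setT g.
Hypothesis gC : forall s, `|g s| <= C.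

Definition weighted_average (a b : R) (w : T) : R :=
  \int[mu]_(s in `[a, b]) (g s * Y s w).

Let mpath w : measurable_fun setT (Y ^~ w).
Proof.
have m1 : measurable_fun setT (fun s : R => (s, w)) by apply: measurable_fun_pair.
exact: (measurableT_comp mY m1).
Qed.

Let C0 : 0 <= C. Proof. exact: le_trans (gC 0). Qed.

Let Ysqr s : E (fun w => Y s w ^+ 2) <= V ^+ 2.
Proof. exact: L2_norm_of_L4. Qed.

Lemma integrable_path (a b : R) w :
  mu.-integrable `[a, b] (EFin \o (fun s => g s * Y s w)).
Proof.
have [B YB] := Ypath w.
apply: (@integrable_bounded _ _ _ (C * B)) => //.
- exact: lebesgue_itv_lty.
- by apply: measurable_funTS; apply: measurable_funM.
- by move=> s _; rewrite normrM ler_pM.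
Qed.

Lemma weighted_average_sqr (a b : R) : a < b ->
  L2 Q (weighted_average a b) /\
  E (fun w => weighted_average a b w ^+ 2) <= ((b - a) * C * V) ^+ 2.
Proof.
move=> ab; have Dfin := lebesgue_itv_lty a b.
have mD : measurable `[a, b]%classic by exact: measurable_itv.
have mgYp : measurable_fun setT (fun p : R * T => g p.1 * Y p.1 p.2).
  by apply: measurable_funM => //; apply: measurableT_comp.
have gY_le s w : `|g s * Y s w| <= C * `|Y s w| by rewrite normrM ler_wpM2r.
have Ynorm s : E (fun w => `|Y s w|) <= V.
  by apply: mean_norm_le_L2 => //; exact: L4_L2.
have iY s : L1 Q (Y s) by apply/L2_L1/L4_L2.
have igY s : L1 Q (fun w => g s * Y s w) by exact: L1Z.
have [iI _ _] := @fubini_process _ _ _ Q `[a, b]%classic (fun s w => g s * Y s w) (C * V)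
  mD Dfin mgYp (fun s _ => conj (igY s) (le_trans
    (le_mean (L1_norm (igY s)) (L1Z C (L1_norm (iY s))) (gY_le s))
    (eq_ind_r (fun z => z <= C * V) (ler_wpM2l C0 (Ynorm s)) (meanZ C (L1_norm (iY s))))))
  (integrable_path a b).
have iY2 s : L1 Q (fun w => Y s w ^+ 2) by have [] := L4_L2 (Y4 s).
have sqE s : (fun w => `|(g s * Y s w) ^+ 2|) = (fun w => g s ^+ 2 * Y s w ^+ 2).
  by apply/funext => w; rewrite ger0_norm ?sqr_ge0// exprMn.
have gC2 s : g s ^+ 2 <= C ^+ 2.
  by rewrite -(real_normK (num_real _)) lerXn2r// nnegrE.
have bnd2 s : `[a, b]%classic s -> L1 Q (fun w => (g s * Y s w) ^+ 2) /\
    E (fun w => `|(g s * Y s w) ^+ 2|) <= C ^+ 2 * V ^+ 2.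
  move=> _; split.
    by under eq_fun do rewrite exprMn; exact: L1Z.
  rewrite sqE meanZ// ler_pM ?sqr_ge0 ?mean_ge0// => w; exact: sqr_ge0.
have path2 w : mu.-integrable `[a, b] (EFin \o (fun s => (g s * Y s w) ^+ 2)).
  have [B YB] := Ypath w.
  apply: (@integrable_bounded _ _ _ ((C * B) ^+ 2)) => //.
  - by apply: measurable_funTS; apply: measurable_funX; apply: measurable_funM.
  - by move=> s _; rewrite normrX lerXn2r ?nnegrE ?normrM ?mulr_ge0 ?ler_pM// (le_trans _ (YB s)).
have [iJ mJ EJ] := @fubini_process _ _ _ Q `[a, b]%classic (fun s w => (g s * Y s w) ^+ 2)
  (C ^+ 2 * V ^+ 2) mD Dfin (measurable_funX 2 mgYp) bnd2 path2.
have sqr_le w : weighted_average a b w ^+ 2 <=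
    (b - a) * \int[mu]_(s in `[a, b]) ((g s * Y s w) ^+ 2).
  have [B YB] := Ypath w.
  apply: (@sqr_Rintegral_le _ _ _ _ (C * B)) => //.
    by apply: measurable_funTS; apply: measurable_funM.
  by move=> s _; rewrite normrM ler_pM.
have mI := L1_measurable iI.
have I2 : L2 Q (weighted_average a b).
  split=> //; apply: (L1_dominated _ (L1Z (b - a) iJ)); first exact: measurable_funX.
  by move=> w; rewrite ger0_norm ?sqr_ge0.
split=> //; have [_ iI2] := I2.
apply: (le_trans (le_mean iI2 (L1Z (b - a) iJ) sqr_le)).
rewrite meanZ// EJ.
rewrite (_ : _ ^+ 2 = (b - a) * (C ^+ 2 * V ^+ 2 * (b - a))); last by ring.
rewrite ler_wpM2l ?subr_ge0 ?(ltW ab)// -(fine_lebesgue_itv (ltW ab)).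
apply: (le_trans (ler_norm _)); apply: norm_Rintegral_le => // s Ds.
have [i2 le2] := bnd2 s Ds; apply: le_trans le2.
by apply: (le_trans (norm_mean i2)).
Qed.

Lemma mean_weighted_average (a b : R) (eta : T -> R) : L2 Q eta ->
  [/\ L1 Q (fun w => eta w * weighted_average a b w),
      mu.-integrable `[a, b] (EFin \o (fun s => g s * E (fun w => eta w * Y s w))) &
      E (fun w => eta w * weighted_average a b w) =
      \int[mu]_(s in `[a, b]) (g s * E (fun w => eta w * Y s w))].
Proof.
move=> eta2; have Dfin := lebesgue_itv_lty a b.
have mD : measurable `[a, b]%classic by exact: measurable_itv.
have [meta ieta] := eta2.
have mu_ : measurable_fun setT (fun p : R * T => g p.1 * (eta p.2 * Y p.1 p.2)).
  apply: measurable_funM; first exact: measurableT_comp.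
  by apply: measurable_funM => //; exact: measurableT_comp.
pose e2 := E (fun w => eta w ^+ 2).
have e20 : 0 <= e2 by apply: mean_ge0 => w; exact: sqr_ge0.
have iEY s : L1 Q (fun w => eta w * Y s w) by apply: L2M => //; exact: L4_L2.
have boundK s : E (fun w => `|eta w * Y s w|) <= (e2 + 1) * V.
  apply: mean_Cauchy_Schwarz_le => //; [exact: L4_L2|exact: addr_ge0|].
  rewrite -/e2; nra.
have hK s : `[a, b]%classic s -> L1 Q (fun w => g s * (eta w * Y s w)) /\
    E (fun w => `|g s * (eta w * Y s w)|) <= C * ((e2 + 1) * V).
  move=> _; split; first exact: L1Z.
  apply: (@le_trans _ _ (E (fun w => C * `|eta w * Y s w|))).
    apply: le_mean; [by apply: L1_norm; exact: L1Z|by apply: L1Z; exact: L1_norm|].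
    by move=> w; rewrite normrM ler_wpM2r.
  by rewrite meanZ; [rewrite ler_wpM2l|exact: L1_norm].
have ipath w : mu.-integrable `[a, b] (EFin \o (fun s => g s * (eta w * Y s w))).
  have := @integrableZl _ _ _ mu _ mD (eta w) _ (integrable_path a b w).
  congr (_.-integrable _ _); apply/funext => s /=; rewrite -EFinM; congr EFin; ring.
have [i1 i2 i3] := @fubini_process _ _ _ Q `[a, b]%classic
  (fun s w => g s * (eta w * Y s w)) _ mD Dfin mu_ hK ipath.
have e1 : (fun w => \int[mu]_(s in `[a, b]) (g s * (eta w * Y s w))) =
    (fun w => eta w * weighted_average a b w).
  apply/funext => w; rewrite /weighted_average -RintegralZl//; last exact: integrable_path.
  by apply: eq_Rintegral => s _; ring.
have e3 : (fun s => E (fun w => g s * (eta w * Y s w))) = (fun s => g s * E (fun w => eta w * Y s w)).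
  by apply/funext => s; rewrite meanZ.
rewrite e1 e3 in i1 i2 i3; split=> //.
apply: (@integrable_bounded _ _ _ (C * ((e2 + 1) * V))) => // s Ds.
have [h1 h2] := hK s Ds; apply: le_trans h2; rewrite -meanZ//; exact: norm_mean.
Qed.

(** Points are added one at a time. Averaged over the position of the new point,
the square of the error grows by at most the variance of one sample, because the
cross term averages to zero; so some position does at least as well. *)
Lemma sampled_average (a b : R) (K : nat) : a < b ->
  exists ss : seq R, [/\ size ss = K, (forall s, s \in ss -> a <= s <= b) &
    E (fun w => (\sum_(s <- ss) ((b - a) * (g s * Y s w) - weighted_average a b w)) ^+ 2)
    <= K%:R * ((b - a) ^+ 2 * (2 * C ^+ 2 * V ^+ 2 + 1))].
Proof.
move=> ab; have l0 : 0 < b - a by rewrite subr_gt0.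
have Dfin := lebesgue_itv_lty a b.
have mD : measurable `[a, b]%classic by exact: measurable_itv.
have [I2 Isqr] := weighted_average_sqr ab.
set I := weighted_average a b in I2 Isqr *.
elim: K => [|K [ss [sz_ss ss_ab IH]]].
  exists [::]; split=> //; rewrite mul0r.
  by under eq_fun do rewrite big_nil expr0n; rewrite mean_cst.
set A := fun w => \sum_(s <- ss) ((b - a) * (g s * Y s w) - I w) in IH *.
have Y2 s : L2 Q (Y s) by exact: L4_L2.
have term2 s : L2 Q (fun w => (b - a) * (g s * Y s w) - I w).
  by apply: L2B => //; apply: L2Z; exact: L2Z.
have A2 : L2 Q A by exact: L2_sum.
have [_ iAY AI_E] := mean_weighted_average a b A2.
have [_ iIY II_E] := mean_weighted_average a b I2.
(* What a new point s adds to the mean square, apart from its own second moment. *)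
pose psi s := 2 * (b - a) * (g s * E (fun w => A w * Y s w))
  - 2 * (b - a) * (g s * E (fun w => I w * Y s w))
  - (2 * E (fun w => A w * I w) - E (fun w => I w * I w)).
have iZ c (h : R -> R) : mu.-integrable `[a, b] (EFin \o h) ->
    mu.-integrable `[a, b] (EFin \o (fun s => c * h s)).
  by move=> ih; have := @integrableZl _ _ _ mu _ mD c _ ih.
have iB (h k : R -> R) : mu.-integrable `[a, b] (EFin \o h) ->
    mu.-integrable `[a, b] (EFin \o k) ->
    mu.-integrable `[a, b] (EFin \o (fun s => h s - k s)).
  by move=> ih ik; have := @integrableB _ _ _ mu _ mD _ _ ih ik.
have iC c : mu.-integrable `[a, b] (EFin \o (fun=> c)).
  by apply: (@integrable_bounded _ _ _ `|c|) => //; exact: measurable_cst.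
have ipsi : mu.-integrable `[a, b] (EFin \o psi).
  by apply: (iB); [apply: (iB); exact: iZ|exact: iC].
have II0 : 0 <= E (fun w => I w * I w).
  by apply: mean_ge0 => w; rewrite -expr2 sqr_ge0.
have int_psi : \int[mu]_(s in `[a, b]) psi s <= 0.
  rewrite RintegralB//; last by apply: (iB); exact: iZ.
  rewrite RintegralB; [|by []|exact: iZ|exact: iZ].
  rewrite !RintegralZl// Rintegral_cst// (fine_lebesgue_itv (ltW ab)) -AI_E -II_E -/I.
  rewrite [leLHS](_ : _ = - ((b - a) * E (fun w => I w * I w))); last by ring.
  by rewrite oppr_le0 mulr_ge0// ltW.
(* The slack (b - a)^2 makes the comparison of the integrals strict. *)
have [s sab psi_s] : exists2 s, a <= s <= b & psi s <= (b - a) ^+ 2.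
  apply: contrapT => nex.
  have psi_large s : `[a, b]%classic s -> (b - a) ^+ 2 <= psi s.
    rewrite /= in_itv/= => sab; rewrite leNgt; apply/negP => lts.
    by apply: nex; exists s => //; exact: ltW.
  have : (b - a) ^+ 2 * (b - a) <= \int[mu]_(s in `[a, b]) psi s.
    by rewrite -{2}(fine_lebesgue_itv (ltW ab)) -Rintegral_cst//; exact: le_Rintegral.
  apply/negP; rewrite -ltNge (le_lt_trans int_psi)//.
  by rewrite mulr_gt0// exprn_gt0.
exists (s :: ss); split; first by rewrite /= sz_ss.
  by move=> t; rewrite inE => /predU1P[->//|/ss_ab].
under eq_fun do rewrite big_cons -/(A _).
have [_ iA2] := A2; have [_ iI2] := I2; have [_ iY2] := Y2 s.
have iAYs := L2M A2 (Y2 s); have iIYs := L2M I2 (Y2 s); have iAI := L2M A2 I2.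
have iII := L2M I2 I2.
rewrite (_ : (fun w => _ ^+ 2) = (fun w =>
   A w ^+ 2 + ((b - a) ^+ 2 * g s ^+ 2 * Y s w ^+ 2 +
   ((2 * (b - a) * g s * (A w * Y s w) - 2 * (b - a) * g s * (I w * Y s w))
    - (2 * (A w * I w) - I w * I w))))); last by apply/funext => w; ring.
have iR1 : L1 Q (fun w => 2 * (b - a) * g s * (A w * Y s w) - 2 * (b - a) * g s * (I w * Y s w)).
  by apply: L1B; exact: L1Z.
have iR2 : L1 Q (fun w => 2 * (A w * I w) - I w * I w) by apply: L1B => //; exact: L1Z.
have iR3 : L1 Q (fun w => (b - a) ^+ 2 * g s ^+ 2 * Y s w ^+ 2) by exact: L1Z.
rewrite meanD//; last by apply: L1D => //; exact: L1B.
rewrite meanD//; last exact: L1B.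
rewrite meanB// (meanB (L1Z _ iAYs) (L1Z _ iIYs)) (meanB (L1Z _ iAI) iII).
rewrite !meanZ//.
have psi_sE : 2 * (b - a) * g s * E (fun w => A w * Y s w)
    - 2 * (b - a) * g s * E (fun w => I w * Y s w)
    - (2 * E (fun w => A w * I w) - E (fun w => I w * I w)) = psi s.
  by rewrite /psi !mulrA.
rewrite psi_sE -natr1 mulrDl mul1r lerD//.
have gC2 : g s ^+ 2 <= C ^+ 2.
  by rewrite -(real_normK (num_real _)) lerXn2r// nnegrE.
have EY0 : 0 <= E (fun w => Y s w ^+ 2) by apply: mean_ge0 => w; exact: sqr_ge0.
apply: (@le_trans _ _ ((b - a) ^+ 2 * C ^+ 2 * V ^+ 2 + (b - a) ^+ 2)).
  apply: lerD => //; rewrite -[leLHS]mulrA -[leRHS]mulrA ler_wpM2l ?sqr_ge0//.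
  by rewrite ler_pM ?sqr_ge0//; exact: Ysqr.
rewrite [leRHS](_ : _ = (b - a) ^+ 2 * C ^+ 2 * V ^+ 2 + (b - a) ^+ 2
  + (b - a) ^+ 2 * (C * V) ^+ 2); last by ring.
by rewrite lerDl mulr_ge0 ?sqr_ge0.
Qed.

End weighted_average.

(** * Mixing and decorrelation *)

Section mixing_decorrelation.
Context {d : measure_display} {T : measurableType d} {R : realType}.

Lemma measurable_invr : measurable_fun setT (fun x : R => x^-1).
Proof.
apply: (@measurable_fun_cvg _ _ _ _ (fun n (x : R) => x / (x ^+ 2 + n.+1%:R^-1))).
  move=> n; apply: continuous_measurable_fun => x.
  apply: cvgM; first exact: cvg_id.
  apply: cvgV; first by rewrite gt_eqF// ltr_wpDl ?sqr_ge0// invr_gt0.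
  by apply: cvgD; [exact: exprn_continuous|exact: cvg_cst].
move=> x _; have [->|x0] := eqVneq x 0.
  by rewrite invr0; under eq_fun do rewrite mul0r; exact: cvg_cst.
have -> : x^-1 = x / (x ^+ 2 + 0) by field.
apply: cvgM; first exact: cvg_cst.
apply: cvgV; first by rewrite addr0 expf_neq0.
by apply: cvgD; [exact: cvg_cst|exact: cvg_harmonic].
Qed.

Variables (A : R -> R -> T -> R) (Q : probability T R).
Local Notation E := (mean Q).

Lemma expectation_mean (X : T -> R) : L1 Q X -> ('E_Q[X] = (E X)%:E)%E.
Proof.
move=> iX; rewrite unlock /mean /Rintegral fineK//.
exact: integrable_fin_num.
Qed.

Section closure.
Variable U : set R.
Let G := g_sigma_algebraType (field_events A U).

Lemma field_measurable_cst c : field_measurable A U (fun=> c).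
Proof. exact: (@measurable_cst _ _ G R). Qed.

Lemma field_measurableD X Y : field_measurable A U X -> field_measurable A U Y ->
  field_measurable A U (fun w => X w + Y w).
Proof. exact: (@measurable_funD _ G R). Qed.

Lemma field_measurableM X Y : field_measurable A U X -> field_measurable A U Y ->
  field_measurable A U (fun w => X w * Y w).
Proof. exact: (@measurable_funM _ G R). Qed.

Lemma field_measurable_comp (psi : R -> R) X : measurable_fun setT psi ->
  field_measurable A U X -> field_measurable A U (fun w => psi (X w)).
Proof. by move=> mpsi mX; exact: (@measurableT_comp _ _ _ G _ _ psi _ X mpsi mX). Qed.

Lemma field_measurable_sum (I : eqType) (s : seq I) (P : pred I) (X : I -> T -> R) :
  (forall i, i \in s -> P i -> field_measurable A U (X i)) ->
  field_measurable A U (fun w => \sum_(i <- s | P i) X i w).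
Proof.
elim: s => [|i s ih] iX.
  by under [X in field_measurable _ _ X]eq_fun do rewrite big_nil;
    exact: field_measurable_cst.
under [X in field_measurable _ _ X]eq_fun do rewrite big_cons.
have ihs : field_measurable A U (fun w => \sum_(j <- s | P j) X j w).
  by apply: ih => j js; apply: iX; rewrite inE js orbT.
have [Pi|//] := boolP (P i).
by apply: field_measurableD => //; apply: iX => //; rewrite inE eqxx.
Qed.

Lemma field_measurable_field x y : 0 <= x <= 1 -> 0 <= y -> U y ->
  field_measurable A U (A x y).
Proof.
move=> x01 y0 Uy _ B mB; apply: sub_sigma_algebra.
exists (x, y); last by exists B.
by split=> /=; [rewrite in_itv|split; [|rewrite in_itv/= andbT]].
Qed.

End closure.

Section maximal_correlation.
Variables (phi : R -> R) (U V : set R) (L : R).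
Hypothesis phi0 : forall t : R, 0 <= t -> 0 <= phi t.
Hypothesis phidec : forall s t : R, 0 <= s -> s <= t -> phi t <= phi s.
Hypothesis mix : forall U V : set R, measurable U -> measurable V ->
  (ereal_sup [set `|'E_Q[fun w => (etaa w * etab w)%R]| |
     etaa in normalized A Q U & etab in normalized A Q V]
   <= (phi (set_distance U V))%:E)%E.
Hypothesis (mU : measurable U) (mV : measurable V).
Hypothesis (U0 : U !=set0) (V0 : V !=set0) (L0 : 0 <= L).
Hypothesis UV : forall u v, U u -> V v -> L <= `|u - v|.

Let normalize W (Z : T -> R) (s : R) : field_measurable A W Z -> L2 Q Z ->
  E Z = 0 -> E (fun w => Z w ^+ 2) = s ^+ 2 -> s != 0 ->
  normalized A Q W (fun w => s^-1 * Z w).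
Proof.
move=> fZ Z2 EZ Zs s0; have [_ iZ] := Z2; have [_ iZ'] := L2Z s^-1 Z2.
split.
- by apply: field_measurableM => //; exact: field_measurable_cst.
- by rewrite expectation_mean ?meanZ ?EZ ?mulr0//; [exact: L2_L1|apply: L1Z; exact: L2_L1].
- rewrite expectation_mean//; congr EFin.
  under eq_fun do rewrite exprMn.
  by rewrite meanZ// Zs -exprMn mulVf// expr1n.
Qed.

Let covariance_centred (X Y : T -> R) (s t : R) :
  field_measurable A U X -> field_measurable A V Y -> L2 Q X -> L2 Q Y ->
  E X = 0 -> E Y = 0 -> 0 <= s -> 0 <= t ->
  E (fun w => X w ^+ 2) = s ^+ 2 -> E (fun w => Y w ^+ 2) = t ^+ 2 ->
  `|E (fun w => X w * Y w)| <= phi L * s * t.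
Proof.
move=> fX fY X2 Y2 EX EY s0 t0 Xs Yt.
have iXY := L2M X2 Y2.
have Xs' : E (fun w => X w ^+ 2) <= s ^+ 2 by rewrite Xs.
have Yt' : E (fun w => Y w ^+ 2) <= t ^+ 2 by rewrite Yt.
have cs := le_trans (norm_mean iXY) (mean_Cauchy_Schwarz_le X2 Y2 s0 t0 Xs' Yt').
have [s_eq0|s_neq0] := eqVneq s 0.
  by move: cs; rewrite s_eq0 mulr0 !mul0r.
have [t_eq0|t_neq0] := eqVneq t 0.
  by move: cs; rewrite t_eq0 !mulr0.
have sp : 0 < s by rewrite lt_neqAle eq_sym s_neq0.
have tp : 0 < t by rewrite lt_neqAle eq_sym t_neq0.
have nX := normalize fX X2 EX Xs s_neq0.
have nY := normalize fY Y2 EY Yt t_neq0.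
have dist_ge : L <= set_distance U V.
  have [[u0 Uu0] [v0 Vv0]] := (U0, V0).
  apply: lb_le_inf; first by exists `|u0 - v0|, u0 => //; exists v0.
  by move=> _ [u Uu [v Vv <-]]; exact: UV.
have h : (`|'E_Q[fun w => (s^-1 * X w * (t^-1 * Y w))%R]| <= (phi L)%:E)%E.
  apply: le_trans (le_trans (mix mU mV) _); last by rewrite lee_fin phidec.
  apply: ereal_sup_ubound; exists (fun w => s^-1 * X w) => //.
  by exists (fun w => t^-1 * Y w).
move: h; have -> : (fun w => s^-1 * X w * (t^-1 * Y w)) =
    (fun w => (s^-1 * t^-1) * (X w * Y w)).
  by apply/funext => w; ring.
rewrite expectation_mean; last exact: L1Z.
rewrite meanZ// abse_EFin lee_fin normrM ger0_norm ?mulr_ge0 ?invr_ge0//.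
by rewrite -invfM mulrC ler_pdivrMr ?mulrA// mulr_gt0.
Qed.

Let centre (Z : T -> R) : L2 Q Z ->
  [/\ L2 Q (fun w => Z w - E Z), E (fun w => Z w - E Z) = 0 &
    E (fun w => (Z w - E Z) ^+ 2) <= E (fun w => Z w ^+ 2)].
Proof.
move=> Z2; have [_ iZ] := Z2; have iZ1 := L2_L1 Z2; split.
- by apply: L2B => //; exact: L2_cst.
- by rewrite meanB ?mean_cst ?subrr//; exact: L1_cst.
rewrite (_ : (fun w => (Z w - E Z) ^+ 2) =
  fun w => Z w ^+ 2 - (2 * E Z * Z w - E Z ^+ 2)); last first.
  by apply/funext => w; ring.
rewrite meanB//; last by apply: L1B; [exact: L1Z|exact: L1_cst].
rewrite meanB ?mean_cst; [|exact: L1Z|exact: L1_cst].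
rewrite meanZ// gerDl oppr_le0 (_ : _ - _ = E Z ^+ 2) ?sqr_ge0//; ring.
Qed.

(** The maximal correlation bounds covariances after centring and normalising;
a variable of zero variance is decorrelated from everything by the
Cauchy-Schwarz inequality. *)
Lemma mixing_decorrelated (X Y : T -> R) :
  field_measurable A U X -> field_measurable A V Y -> L2 Q X -> L2 Q Y ->
  decorrelated Q (phi L) X Y.
Proof.
move=> fX fY X2 Y2 a b a0 b0 Xa Yb.
have iX1 := L2_L1 X2; have iY1 := L2_L1 Y2; have iXY := L2M X2 Y2.
have [X'2 EX' varX] := centre X2; have [Y'2 EY' varY] := centre Y2.
have covE : E (fun w => X w * Y w) - E X * E Y = E (fun w => (X w - E X) * (Y w - E Y)).
  rewrite (_ : (fun w => (X w - E X) * (Y w - E Y)) =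
    fun w => (X w * Y w - E Y * X w) - (E X * Y w - E X * E Y)); last first.
    by apply/funext => w; ring.
  have i1 : L1 Q (fun w => X w * Y w - E Y * X w) by apply: L1B => //; exact: L1Z.
  have i2 : L1 Q (fun w => E X * Y w - E X * E Y) by apply: L1B; [exact: L1Z|exact: L1_cst].
  rewrite meanB// meanB//; last exact: L1Z.
  rewrite meanB ?mean_cst; [|exact: L1Z|exact: L1_cst].
  by rewrite !meanZ//; ring.
rewrite covE.
have root (Z : T -> R) (c : R) : 0 <= c -> E (fun w => Z w ^+ 2) <= c ^+ 2 ->
    exists s, [/\ 0 <= s, s <= c & E (fun w => Z w ^+ 2) = s ^+ 2].
  move=> c0 Zc; have E0 : 0 <= E (fun w => Z w ^+ 2) by apply: mean_ge0 => w; exact: sqr_ge0.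
  exists (Num.sqrt (E (fun w => Z w ^+ 2))); rewrite sqrtr_ge0 sqr_sqrtr//; split=> //.
  by rewrite -(ger0_norm c0) -sqrtr_sqr ler_wsqrtr.
have [s [s0 sa sE]] := root _ a a0 (le_trans varX Xa).
have [t [t0 tb tE]] := root _ b b0 (le_trans varY Yb).
have fX' : field_measurable A U (fun w => X w - E X).
  by apply: field_measurableD => //; exact: field_measurable_cst.
have fY' : field_measurable A V (fun w => Y w - E Y).
  by apply: field_measurableD => //; exact: field_measurable_cst.
apply: (le_trans (covariance_centred fX' fY' X'2 Y'2 EX' EY' s0 t0 sE tE)).
by rewrite -!mulrA ler_wpM2l ?phi0// ler_pM.
Qed.

End maximal_correlation.

Local Notation mu := (@lebesgue_measure R).

(** The integral of the cube root over [0, t] is at least t times its value at the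
right end t, because phi is decreasing. *)
Lemma decay_of_integrable_root (phi : R -> R) :
  (forall t : R, 0 <= t -> 0 <= phi t) ->
  (forall s t : R, 0 <= s -> s <= t -> phi t <= phi s) ->
  lebesgue_measure.-integrable `[0, +oo[ (fun t => (phi t `^ 3^-1)%:E) ->
  exists2 I : R, 0 <= I & forall t : R, 0 < t -> phi t <= (I / t) ^+ 3.
Proof.
move=> phi0 phidec iphi.
have mD : measurable (`[0, +oo[%classic : set (measurableTypeR R)).
  exact: (@measurable_itv R `[0, +oo[).
pose D : set R := `[0, +oo[%classic.
pose I := fine (\int[mu]_(t in D) (phi t `^ 3^-1)%:E)%E.
have fin_int : (\int[mu]_(t in D) (phi t `^ 3^-1)%:E)%E \is a fin_num.
  exact: (@integrable_fin_num _ _ _ mu _ mD _ iphi).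
exists I.
  by apply: fine_ge0; apply: integral_ge0 => t _; rewrite lee_fin powR_ge0.
move=> t t0.
have root_le : t * phi t `^ 3^-1 <= I.
  rewrite -lee_fin /I fineK//.
  pose Dt : set R := `[0, t]%classic.
  have mDt : measurable (Dt : set (measurableTypeR R)).
    exact: (@measurable_itv R `[0, t]).
  have sub : Dt `<=` D.
    by move=> s; rewrite /Dt /D /= !in_itv/= andbT => /andP[].
  have mphi : measurable_fun D (fun t => (phi t `^ 3^-1)%:E).
    exact: (@measurable_int _ _ _ mu _ _ iphi).
  apply: (@le_trans _ _ (\int[mu]_(s in Dt) (phi s `^ 3^-1)%:E)%E); last first.
    by apply: ge0_subset_integral => // s _; rewrite lee_fin powR_ge0.
  apply: (@le_trans _ _ (\int[mu]_(s in Dt) (phi t `^ 3^-1)%:E)%E).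
    have muDt : mu Dt = t%:E by rewrite /Dt lebesgue_measure_itv/= lte_fin t0 -EFinB subr0.
    rewrite integral_cst//= [X in (_ * X)%E](_ : _ = t%:E)//.
    by rewrite -EFinM mulrC.
  apply: ge0_le_integral => //.
  - by move=> s _; rewrite lee_fin powR_ge0.
  - exact: measurable_funS mphi.
  move=> s; rewrite /Dt /= in_itv/= => /andP[s0 st].
  by rewrite lee_fin ge0_ler_powR ?nnegrE ?invr_ge0// ?phidec// phi0// (le_trans s0).
have -> : phi t = (phi t `^ 3^-1) ^+ 3.
  by rewrite -powR_mulrn ?powR_ge0// -powRrM mulVf// powRr1// phi0// ltW.
have I_ge : phi t `^ 3^-1 <= I / t by rewrite ler_pdivlMr// mulrC.
by rewrite lerXn2r ?nnegrE ?powR_ge0// (le_trans _ I_ge)// powR_ge0.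
Qed.

End mixing_decorrelation.

(** * The fluctuation of the inverse coefficient *)

Section fluctuation.
Context {d : measure_display} {T : measurableType d} {R : realType}.
Variables (A : R -> R -> T -> R) (Q : probability T R).
Hypothesis hA : measurable_field A.
Variables nu1 nu2 : T -> R -> R.
Hypothesis hell : pathwise_elliptic A nu1 nu2.
Variables (c1 c2 : R).
Hypothesis hmean : mean_hypothesis A Q c1 c2.
Variable C6 : R.
Hypothesis hmom : sixth_moment_bound A Q C6.
Local Notation mu := (@lebesgue_measure R).
Local Notation E := (mean Q).
Local Notation a0 := (meanA A Q).

Let dom : set (R * R * T) := (`[0, 1] `*` `[0, +oo[) `*` setT.

Let mdom : measurable dom.
Proof.
apply: measurableX => //; apply: measurableX; exact: measurable_itv.
Qed.

Lemma field_section_measurable (x y : R) : 0 <= x <= 1 -> 0 <= y ->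
  measurable_fun setT (A x y).
Proof.
move=> x01 y0; have m1 : measurable_fun setT (fun w : T => ((x, y), w)).
  by apply: measurable_fun_pair.
apply: (@measurable_comp _ _ _ _ _ _ dom (fun p => A p.1.1 p.1.2 p.2) setT
  (fun w : T => ((x, y), w)) mdom _ hA m1).
by move=> _ [w _ <-]; split=> //; split; rewrite /= in_itv/= ?andbT.
Qed.

Lemma invA_section_measurable (x y : R) : 0 <= x <= 1 -> 0 <= y ->
  measurable_fun setT (invA A x y).
Proof.
move=> x01 y0; apply: (measurableT_comp measurable_invr).
exact: field_section_measurable.
Qed.

Let minvA : measurable_fun dom (fun p => invA A p.1.1 p.1.2 p.2).
Proof. exact: (measurableT_comp measurable_invr hA). Qed.

Lemma L1_invA (x y : R) : 0 <= x <= 1 -> 0 <= y ->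
  L1 Q (invA A x y) /\ E (invA A x y) = a0 x.
Proof.
move=> x01 y0; have [c10 hm] := hmean.
have x01' : x \in `[0, 1] by rewrite in_itv.
have [e1 e2 e3] := hm x y x01' y0.
have fin_exp : ('E_Q[invA A x y])%E \is a fin_num.
  rewrite fin_numE; apply/andP; split; apply/eqP => e; [move: e2|move: e3]; by rewrite e.
have mi := invA_section_measurable x01 y0.
have iX : L1 Q (invA A x y).
  apply/integrableP; split; first exact/measurable_EFinP.
  apply/abse_integralP => //; first exact/measurable_EFinP.
  by move: fin_exp; rewrite unlock => h; rewrite -fin_num_abs.
by split=> //; rewrite /meanA -e1 expectation_mean.
Qed.

Lemma a0_bounds (x : R) : 0 <= x <= 1 -> c1 <= a0 x <= c2.
Proof.
move=> x01; have [c10 hm] := hmean.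
have x01' : x \in `[0, 1] by rewrite in_itv.
have [e1 e2 e3] := hm x 0 x01' (lexx _).
have [iX EX] := L1_invA x01 (lexx 0).
by move: e2 e3; rewrite expectation_mean// EX !lee_fin => -> ->.
Qed.

Let diag_pos (x : R) w : 0 <= x <= 1 -> 0 < A x (x / 1) w.
Proof.
move=> x01; have x01' : x \in `[0, 1] by rewrite in_itv.
by have [h1 h2 _] := hell w ltr01 x01'; exact: lt_le_trans h2.
Qed.

Lemma measurable_a0 : measurable_fun (`[0, 1] : set R) a0.
Proof.
pose D : set R := `[0, 1]%classic.
pose h (p : R * T) : R := ((fun q : R * R * T => invA A q.1.1 q.1.2 q.2) \_ dom) ((p.1, p.1), p.2).
have mh : measurable_fun setT h.
  have mr : measurable_fun setT ((fun q : R * R * T => invA A q.1.1 q.1.2 q.2) \_ dom).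
    by apply/(measurable_restrict _ mdom measurableT); rewrite setTI.
  have m1 : measurable_fun setT (fun p : R * T => ((p.1, p.1), p.2)).
    by apply: measurable_fun_pair => //; apply: measurable_fun_pair.
  exact: (measurableT_comp mr m1).
have hE (x : R) w : 0 <= x <= 1 -> h (x, w) = invA A x x w.
  move=> /[dup] x01 /andP[x0 _]; rewrite /h /patch mem_set//=.
  by split=> //; split; rewrite /= in_itv/= ?andbT.
have h0 p : 0 <= h p.
  rewrite /h /patch; case: ifPn => // /set_mem[[/= +] _] _; rewrite in_itv/= => x01.
  by rewrite /invA invr_ge0 ltW// -[X in A _ X](divr1 p.1) diag_pos.
have mF := @measurable_fun_fubini_tonelli_F _ _ _ _ R Q (EFin \o h)
  (measurableT_comp (@EFin_measurable _ _) mh) (fun p => h0 p).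
have : measurable_fun D (fine \o fubini_F Q (EFin \o h)).
  apply: measurable_funTS.
  exact: (measurableT_comp (fine_measurable measurableT) mF).
apply: eq_measurable_fun => x; rewrite inE /D /= in_itv/= => /[dup] x01 /andP[x0 _].
have [_ <-] := L1_invA x01 x0; rewrite /mean /Rintegral /fubini_F/=.
by congr fine; apply: eq_integral => w _; rewrite hE.
Qed.

(** The centred inverse coefficient, extended by zero outside the range in which
the field is meaningful, so that it is a total measurable process. *)
Definition fluct (s y : R) (w : T) : R :=
  if (0 <= s <= 1) && (0 <= y) then invA A s y w - a0 s else 0.

Lemma fluctE (s y : R) w : 0 <= s <= 1 -> 0 <= y ->
  fluct s y w = invA A s y w - a0 s.
Proof. by rewrite /fluct => -> ->. Qed.

Lemma measurable_fluct : measurable_fun setT (fun p : R * R * T => fluct p.1.1 p.1.2 p.2).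
Proof.
have -> : (fun p : R * R * T => fluct p.1.1 p.1.2 p.2) =
    (fun p => invA A p.1.1 p.1.2 p.2 - a0 p.1.1) \_ dom.
  apply/funext => -[[s y] w]; rewrite /patch /fluct/=; case: ifPn => [/andP[h1 h2]|h].
    by rewrite mem_set//; split=> //; split; rewrite /= in_itv/= ?andbT.
  rewrite memNset// => -[[/= h1 h2] _]; move/negP: h; apply.
  by move: h1 h2; rewrite !in_itv/= andbT => -> ->.
apply/(measurable_restrict _ mdom measurableT); rewrite setTI.
apply: measurable_funB => //.
have m1 : measurable_fun dom (fun p : R * R * T => p.1.1).
  by apply: measurable_funTS; apply: measurableT_comp.
apply: (@measurable_comp _ _ _ _ _ _ (`[0, 1]%classic : set R) a0 _ _ _ _ measurable_a0 m1).
  exact: measurable_itv.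
by move=> _ [p [[p1 _] _] <-].
Qed.

Lemma field_measurable_fluct (U : set R) (s y : R) : U y ->
  field_measurable A U (fluct s y).
Proof.
move=> Uy; have [/andP[s01 y0]|h] := boolP ((0 <= s <= 1) && (0 <= y)).
  rewrite (_ : fluct s y = fun w => invA A s y w + - a0 s); last first.
    by apply/funext => w; rewrite fluctE.
  apply: field_measurableD; last exact: field_measurable_cst.
  apply: (field_measurable_comp measurable_invr).
  exact: field_measurable_field.
rewrite (_ : fluct s y = fun=> 0); first exact: field_measurable_cst.
by apply/funext => w; rewrite /fluct (negbTE h).
Qed.

Let V : R := 1 + `|C6|.

Lemma fluct_moments (s y : R) :
  [/\ L4 Q (fluct s y), E (fluct s y) = 0 & E (fun w => fluct s y w ^+ 4) <= V ^+ 4].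
Proof.
have V1 : 1 <= V by rewrite lerDl.
have [/andP[s01 y0]|h] := boolP ((0 <= s <= 1) && (0 <= y)); last first.
  rewrite (_ : fluct s y = fun=> 0); last by apply/funext => w; rewrite /fluct (negbTE h).
  split; [exact: L4_cst|exact: mean_cst|].
  by rewrite expr0n mean_cst exprn_ge0// (le_trans ler01).
have s01' : s \in `[0, 1] by rewrite in_itv.
have [iX EX] := L1_invA s01 y0.
have fE : fluct s y = fun w => invA A s y w - a0 s by apply/funext => w; exact: fluctE.
have mX := invA_section_measurable s01 y0.
have mf : measurable_fun setT (fluct s y) by rewrite fE; exact: measurable_funB.
have h6 : (\int[Q]_w (fluct s y w ^+ 6)%:E <= C6%:E)%E.
  have eX : fine ('E_Q[invA A s y])%E = a0 s by rewrite expectation_mean//= EX.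
  by have := hmom s01' y0; rewrite eX unlock fE.
have p6 w : 0 <= fluct s y w ^+ 6 by rewrite exprn_even_ge0.
have i6 : L1 Q (fun w => fluct s y w ^+ 6).
  apply/integrableP; split; first by apply/measurable_EFinP; exact: measurable_funX.
  under eq_integral do rewrite /= ger0_norm//.
  by apply: (le_lt_trans h6); rewrite ltry.
have E6 : E (fun w => fluct s y w ^+ 6) <= C6.
  rewrite -lee_fin; apply: le_trans h6; rewrite /mean /Rintegral fineK//.
  exact: integrable_fin_num.
have le46 w : fluct s y w ^+ 4 <= 1 + fluct s y w ^+ 6.
  have -> : fluct s y w ^+ 4 = (fluct s y w ^+ 2) ^+ 2 by rewrite -exprM.
  have -> : fluct s y w ^+ 6 = (fluct s y w ^+ 2) ^+ 3 by rewrite -exprM.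
  have := sqr_ge0 (fluct s y w); move: (fluct s y w ^+ 2) => t t0.
  have [t1|t1] := leP t 1; first by have := exprn_ge0 3 t0; nra.
  by rewrite -[leLHS]add0r lerD// [leRHS]exprS ler_peMl ?sqr_ge0// ltW.
have i4 : L1 Q (fun w => fluct s y w ^+ 4).
  apply: L1_dominated (L1D (L1_cst Q 1) i6) _ => [|w]; first exact: measurable_funX.
  by rewrite ger0_norm ?exprn_even_ge0.
split.
- by [].
- by rewrite fE meanB ?EX ?mean_cst ?subrr//; exact: L1_cst.
apply: (@le_trans _ _ (1 + C6)).
  apply: (le_trans (le_mean i4 (L1D (L1_cst Q 1) i6) le46)).
  by rewrite meanD ?mean_cst ?lerD2l//; exact: L1_cst.
apply: (@le_trans _ _ V); first by rewrite lerD2l ler_norm.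
by rewrite -[leLHS]expr1 ler_weXn2l.
Qed.

Lemma fluct_path (eps : R) w : 0 < eps ->
  exists B, forall s, `|fluct s (s / eps) w| <= B.
Proof.
move=> eps0; exists ((nu1 w eps)^-1 + `|c2|) => s.
rewrite /fluct; case: ifPn => [/andP[s01 y0]|_]; last first.
  rewrite normr0 addr_ge0// invr_ge0 ltW//.
  have z01 : (0 : R) \in `[0, 1] by rewrite in_itv/= lexx ler01.
  by have [h1 _ _] := hell w eps0 z01.
have s01' : s \in `[0, 1] by rewrite in_itv.
have [n1 n2 _] := hell w eps0 s01'.
have [c10 _] := hmean; have /andP[l1 l2] := a0_bounds s01.
rewrite (le_trans (ler_normB _ _))// lerD//.
  have Apos : 0 < A s (s / eps) w by exact: lt_le_trans n2.
  by rewrite /invA ger0_norm ?invr_ge0 ?(ltW Apos)// lef_pV2 ?posrE.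
rewrite ger0_norm; first by rewrite (le_trans l2)// ler_norm.
by rewrite (le_trans _ l1)// ltW.
Qed.

Lemma measurable_fluct_eps (eps : R) :
  measurable_fun setT (fun p : R * T => fluct p.1 (p.1 / eps) p.2).
Proof.
have m1 : measurable_fun setT (fun p : R * T => ((p.1, p.1 / eps), p.2)).
  apply: measurable_fun_pair => //; apply: measurable_fun_pair => //.
  by apply: measurable_funM.
exact: (measurableT_comp measurable_fluct m1).
Qed.

Lemma fluct_covariance (Gamma : R -> R) (s t y z : R) :
  cov_hypothesis A Q Gamma -> 0 <= s <= 1 -> 0 <= t <= 1 -> 0 <= y -> 0 <= y + z ->
  E (fun w => fluct s y w * fluct t (y + z) w) = Cov A Q s t z.
Proof.
move=> [hcov _ _] s01 t01 y0 yz0.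
have s01' : s \in `[0, 1] by rewrite in_itv.
have t01' : t \in `[0, 1] by rewrite in_itv.
have := hcov s t y z s01' t01' y0 yz0; rewrite /cov_at => h.
have [f1 _ _] := fluct_moments s y; have [f2 _ _] := fluct_moments t (y + z).
have i12 := L2M (L4_L2 f1) (L4_L2 f2).
have e12 : (fun w => fluct s y w * fluct t (y + z) w) =
    (fun w => (invA A s y w - a0 s) * (invA A t (y + z) w - a0 t)).
  by apply/funext => w; rewrite !fluctE.
by move: h; rewrite -e12 expectation_mean// => -[].
Qed.

End fluctuation.

(** * Gaussian approximation of the scaled averages *)

Section blocks.
Context {d : measure_display} {T : measurableType d} {R : realType}.
Variables (A : R -> R -> T -> R) (Q : probability T R).
Hypothesis hA : measurable_field A.
Variables nu1 nu2 : T -> R -> R.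
Hypothesis hell : pathwise_elliptic A nu1 nu2.
Variables (c1 c2 : R).
Hypothesis hmean : mean_hypothesis A Q c1 c2.
Variable C6 : R.
Hypothesis hmom : sixth_moment_bound A Q C6.
Local Notation mu := (@lebesgue_measure R).
Local Notation E := (mean Q).
Local Notation V := (1 + `|C6|).

Variables (g : R -> R) (C : R).
Hypothesis mg : measurable_fun setT g.
Hypothesis gC : forall s, `|g s| <= C.

Local Notation Y eps := (fun s => fluct A Q s (s / eps)).

(** The fluctuation of the integral of g / A_eps, on its natural scale. *)
Definition scaled_average (eps : R) (w : T) : R :=
  (Num.sqrt eps)^-1 * weighted_average (Y eps) g 0 1 w.

Let V0 : 0 <= V. Proof. by rewrite addr_ge0. Qed.

Let C0 : 0 <= C. Proof. exact: le_trans (gC 0). Qed.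

Let mY eps : measurable_fun setT (fun p : R * T => Y eps p.1 p.2).
Proof. exact: (measurable_fluct_eps hA hell hmean). Qed.

Let Y4 eps s : L4 Q (Y eps s).
Proof. by have [] := fluct_moments hA hmean hmom s (s / eps). Qed.

Let EY eps s : E (Y eps s) = 0.
Proof. by have [] := fluct_moments hA hmean hmom s (s / eps). Qed.

Let YV eps s : E (fun w => Y eps s w ^+ 4) <= V ^+ 4.
Proof. by have [] := fluct_moments hA hmean hmom s (s / eps). Qed.

Let Ypath eps (eps0 : 0 < eps) w : exists B, forall s, `|Y eps s w| <= B.
Proof. exact: (fluct_path hA hell hmean w eps0). Qed.

Lemma Rintegral_chain (f : R -> R) (h : R) (N : nat) :
  (forall a b, mu.-integrable `[a, b] (EFin \o f)) -> 0 <= h ->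
  \int[mu]_(s in `[0, N%:R * h]) f s =
  \sum_(0 <= j < N) \int[mu]_(s in `[j%:R * h, j.+1%:R * h]) f s.
Proof.
move=> iF h0; elim: N => [|N IH].
  by rewrite mul0r big_nil set_itv1 Rintegral_set1.
rewrite big_nat_recr//= -IH.
have le1 : (BLeft 0 <= BRight (N%:R * h) :> itv_bound R)%O by rewrite bnd_simp mulr_ge0.
have le2 : (BRight (N%:R * h) <= BRight (N.+1%:R * h) :> itv_bound R)%O.
  by rewrite bnd_simp ler_wpM2r// ler_nat.
have := Rintegral_itvB (iF 0 (N.+1%:R * h)) le1 le2.
rewrite Rintegral_itv_obnd_cbnd; last first.
  apply: (integrableS _ _ _ (iF (N%:R * h) (N.+1%:R * h))) => //.
  by apply: subset_itvr; rewrite bnd_simp.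
by move=> <-; rewrite addrC subrK.
Qed.

(** The values of the fast variable y = s / eps for j / N <= s <= k / N. *)
Definition block (eps : R) (N j k : nat) : set R :=
  `[j%:R / N%:R / eps, k%:R / N%:R / eps]%classic.

(** Replacing each block integral by a finite sum of sampled values makes it
measurable with respect to the field over that block; for the integral itself
this holds only up to a null set. *)
Lemma block_approximation (eps eta : R) (N : nat) : 0 < eps -> 0 < eta -> (0 < N)%N ->
  exists Z : nat -> T -> R,
  [/\ (forall j, L4 Q (Z j)), (forall j, E (Z j) = 0),
      (forall j, E (fun w => Z j w ^+ 4) <= (N%:R^-1 * (C * V) / Num.sqrt eps) ^+ 4),
      (forall j, field_measurable A (block eps N j j.+1) (Z j)) &
      E (fun w => (\sum_(0 <= j < N) Z j w - scaled_average eps w) ^+ 2) <= eta].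
Proof.
move=> eps0 eta0 N0.
have Np : 0 < N%:R :> R by rewrite ltr0n.
pose h : R := N%:R^-1.
have h0 : 0 < h by rewrite invr_gt0.
have seps : 0 < Num.sqrt eps by rewrite sqrtr_gt0.
pose D : R := 2 * C ^+ 2 * V ^+ 2 + 1.
(* The mean square of the error comes out as D / (K eps). *)
pose K := (Num.trunc (D / (eps * eta))).+1.
have K_large : D / (K%:R * eps) <= eta.
  rewrite ler_pdivrMr ?mulr_gt0// mulrC -mulrA -ler_pdivrMr ?mulr_gt0//.
  by apply: ltW; exact: truncnS_gt.
have step j : j%:R * h < j.+1%:R * h by rewrite ltr_pM2r// ltr_nat.
have lenE (j : nat) : j.+1%:R * h - j%:R * h = h by rewrite -natr1; ring.
have /choice[ss ssP] : forall j : nat, exists ss : seq R,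
    [/\ size ss = K, (forall s, s \in ss -> j%:R * h <= s <= j.+1%:R * h) &
     E (fun w => (\sum_(s <- ss) (h * (g s * Y eps s w)
        - weighted_average (Y eps) g (j%:R * h) (j.+1%:R * h) w)) ^+ 2)
     <= K%:R * (h ^+ 2 * D)].
  move=> j.
  have [ss [s1 s2 s3]] := sampled_average (mY eps) (Ypath eps0) (Y4 eps) V0
    (YV eps) mg gC K (step j).
  by exists ss; split=> //; move: s3; rewrite lenE.
pose c : R := h / (K%:R * Num.sqrt eps).
have c0 : 0 <= c by rewrite divr_ge0 ?(ltW h0)// mulr_ge0// ltW.
exists (fun j w => c * \sum_(s <- ss j) (g s * Y eps s w)).
have gY4 s : L4 Q (fun w => g s * Y eps s w) by exact: L4Z.
split.
- by move=> j; apply: L4Z; exact: L4_sum.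
- move=> j; rewrite meanZ; last by apply: L1_sum => s _; apply/L2_L1/L4_L2.
  rewrite mean_sum; last by move=> s _; apply/L2_L1/L4_L2.
  rewrite big1 ?mulr0// => s _; rewrite meanZ ?EY ?mulr0//.
  by apply/L2_L1/L4_L2.
- move=> j; have [szj _ _] := ssP j.
  have i4 s : L1 Q (fun w => (g s * Y eps s w) ^+ 4) by have [] := gY4 s.
  have ptw w : (c * \sum_(s <- ss j) (g s * Y eps s w)) ^+ 4 <=
      c ^+ 4 * K%:R ^+ 3 * \sum_(s <- ss j) (g s * Y eps s w) ^+ 4.
    rewrite exprMn -mulrA ler_wpM2l ?exprn_ge0//.
    by have := sum_expr4_le (ss j) predT (fun s => g s * Y eps s w); rewrite count_predT szj.
  apply: (@le_trans _ _ (E (fun w => c ^+ 4 * K%:R ^+ 3 * \sum_(s <- ss j) (g s * Y eps s w) ^+ 4))).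
    apply: le_mean => //; last by apply: L1Z; exact: L1_sum.
    by have [] : L4 Q (fun w => c * \sum_(s <- ss j) (g s * Y eps s w)) by apply: L4Z; exact: L4_sum.
  rewrite meanZ; last exact: L1_sum.
  rewrite mean_sum//.
  apply: (@le_trans _ _ (c ^+ 4 * K%:R ^+ 3 * \sum_(s <- ss j) (C * V) ^+ 4)).
    apply: ler_wpM2l; first by apply: mulr_ge0; exact: exprn_ge0.
    apply: ler_sum => s _.
    under eq_fun do rewrite exprMn.
    rewrite meanZ; last by have [] := Y4 eps s.
    rewrite exprMn ler_pM ?exprn_even_ge0//; first by apply: mean_ge0 => w; rewrite exprn_even_ge0.
    have -> : g s ^+ 4 = `|g s| ^+ 4.
      by rewrite -normrX ger0_norm// exprn_even_ge0.
    by rewrite lerXn2r ?nnegrE.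
  rewrite big_const_seq count_predT szj iter_addr addr0 -[X in _ * X]mulr_natl.
  rewrite le_eqVlt; apply/orP; left; apply/eqP; rewrite /c -/h.
  by field; rewrite !gt_eqF.
- move=> j; have [_ ssj _] := ssP j.
  apply: field_measurableM; first exact: field_measurable_cst.
  apply: field_measurable_sum => s sin _.
  apply: field_measurableM; first exact: field_measurable_cst.
  apply: field_measurable_fluct; rewrite /block/= in_itv/=.
  by rewrite !ler_pM2r ?invr_gt0//; exact: ssj.
pose I j := weighted_average (Y eps) g (j%:R * h) (j.+1%:R * h).
have I2 j : L2 Q (I j).
  by have [] := weighted_average_sqr (mY eps) (Ypath eps0) (Y4 eps) V0 (YV eps) mg gC (step j).
pose W j w := \sum_(s <- ss j) (h * (g s * Y eps s w) - I j w).
have W2 j : L2 Q (W j).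
  by apply: L2_sum => s _; apply: L2B => //; apply: L2Z; exact: L4_L2.
pose e : R := (K%:R * Num.sqrt eps)^-1.
have diffE w : \sum_(0 <= j < N) c * (\sum_(s <- ss j) g s * Y eps s w) - scaled_average eps w =
    e * \sum_(0 <= j < N) W j w.
  have -> : scaled_average eps w = (Num.sqrt eps)^-1 * \sum_(0 <= j < N) I j w.
    congr (_ * _); rewrite /I /weighted_average.
    rewrite -(Rintegral_chain N (f := fun s => g s * Y eps s w)) ?(ltW h0)//.
      by rewrite /h mulfV// gt_eqF.
    by move=> a b; apply: (integrable_path (mY eps) (Ypath eps0) mg gC).
  rewrite !mulr_sumr -sumrB; apply: eq_bigr => j _.
  have [szj _ _] := ssP j; rewrite /W sumrB big_const_seq count_predT szj iter_addr addr0.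
  by rewrite -mulr_sumr -[I j w *+ K]mulr_natl /c /e; field; rewrite !gt_eqF.
under eq_fun do rewrite diffE exprMn.
have iW j : L1 Q (fun w => W j w ^+ 2) by have [] := W2 j.
have i2 : L1 Q (fun w => (\sum_(0 <= j < N) W j w) ^+ 2).
  by have [] : L2 Q (fun w => \sum_(0 <= j < N) W j w) by exact: L2_sum.
rewrite meanZ//; apply: le_trans K_large.
apply: (@le_trans _ _ (e ^+ 2 * (N%:R * \sum_(0 <= j < N) K%:R * (h ^+ 2 * D)))); last first.
  rewrite sumr_const_nat subn0 -[X in _ * (_ * X)]mulr_natl /h /e.
  have sE : eps = Num.sqrt eps ^+ 2 by rewrite sqr_sqrtr// ltW.
  rewrite [X in _ <= _ / (_ * X)]sE le_eqVlt; apply/orP; left; apply/eqP.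
  by field; rewrite !gt_eqF.
rewrite ler_wpM2l ?sqr_ge0//.
apply: (@le_trans _ _ (N%:R * \sum_(0 <= j < N) E (fun w => W j w ^+ 2))).
  rewrite -mean_sum// -meanZ; last exact: L1_sum.
  apply: le_mean => //; first by apply: L1Z; exact: L1_sum.
  move=> w; have := sqr_sum_le (index_iota 0 N) predT (fun j => W j w).
  by rewrite count_predT size_iota subn0.
rewrite ler_wpM2l//; apply: ler_sum => j _.
by have [_ _] := ssP j.
Qed.

Variable phi : R -> R.
Hypothesis phi0 : forall t : R, 0 <= t -> 0 <= phi t.
Hypothesis phidec : forall s t : R, 0 <= s -> s <= t -> phi t <= phi s.
Hypothesis mix : forall U V : set R, measurable U -> measurable V ->
  (ereal_sup [set `|'E_Q[fun w => (etaa w * etab w)%R]| |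
     etaa in normalized A Q U & etab in normalized A Q V]
   <= (phi (set_distance U V))%:E)%E.

Lemma field_measurableS (U U' : set R) (X : T -> R) : U `<=` U' ->
  field_measurable A U X -> field_measurable A U' X.
Proof.
move=> UU' mX _ B mB; have := mX measurableT B mB.
apply: sub_sigma_algebra2 => S [p [/= p1 [p2 p3]] hp].
by exists p => //; split=> //; split=> //; exact: UU'.
Qed.

Let blocks_decorrelated (eps : R) (N : nat) (Z : nat -> T -> R) :
  0 < eps -> (0 < N)%N -> (forall j, L4 Q (Z j)) ->
  (forall j, field_measurable A (block eps N j j.+1) (Z j)) ->
  (forall j (psi : R -> R), (j < N)%N -> measurable_fun setT psi ->
    L2 Q (fun w => psi (\sum_(0 <= k < N) Z k w - \sum_(0 <= k < N | window 1 j k) Z k w)) ->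
    decorrelated Q (phi (N%:R^-1 / eps)) (Z j)
      (fun w => psi (\sum_(0 <= k < N) Z k w - \sum_(0 <= k < N | window 1 j k) Z k w))) /\
  (forall j k, (j + 3 < k)%N -> (k < N)%N ->
    decorrelated Q (phi (N%:R^-1 / eps))
      (fun w => Z j w * \sum_(0 <= i < N | window 1 j i) Z i w)
      (fun w => Z k w * \sum_(0 <= i < N | window 1 k i) Z i w)).
Proof.
move=> eps0 N0 Z4 Zf.
have Np : 0 < N%:R :> R by rewrite ltr0n.
pose t : R := N%:R^-1 / eps.
have t0 : 0 < t by rewrite divr_gt0// invr_gt0.
have gridE (j : nat) : j%:R / N%:R / eps = j%:R * t by rewrite /t mulrA.
have grid_le (i j : nat) : (i <= j)%N -> i%:R * t <= j%:R * t.
  by move=> ij; rewrite ler_wpM2r ?(ltW t0)// ler_nat.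
have blockP j k y : block eps N j k y <-> j%:R * t <= y <= k%:R * t.
  by rewrite /block/= in_itv/= !gridE.
have mblock j k : measurable (block eps N j k) by exact: measurable_itv.
have block0 j k : (j <= k)%N -> block eps N j k !=set0.
  by move=> jk; exists (j%:R * t); apply/blockP; rewrite lexx grid_le.
split.
- move=> j psi jN mpsi psi2.
  (* The fast variables at distance at least t from block j. *)
  pose F : set R := [set y | y <= (j%:R - 1) * t] `|` [set y | j.+2%:R * t <= y].
  have mF : measurable F.
    apply: measurableU.
      rewrite (_ : [set _ | _] = `]-oo, ((j%:R - 1) * t)]%classic); first exact: measurable_itv.
      by apply/seteqP; split=> y /=; rewrite in_itv.
    rewrite (_ : [set _ | _] = `[(j.+2%:R * t), +oo[%classic); first exact: measurable_itv.
    by apply/seteqP; split=> y /=; rewrite in_itv/= andbT.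
  refine (mixing_decorrelated phi0 phidec mix (mblock j j.+1) mF
    (block0 _ _ (leqnSn j)) _ _ _ _ _ _ _).
  + by exists (j.+2%:R * t); right => /=.
  + exact: ltW.
  + move=> u v /blockP/andP[u1 u2] [/= v1|/= v1]; rewrite -/t.
      rewrite (le_trans _ (ler_norm _))//.
      by move: v1; rewrite mulrBl mul1r; lra.
    rewrite distrC (le_trans _ (ler_norm _))//.
    have : j.+2%:R * t = j.+1%:R * t + t by rewrite -(natr1 j.+1) mulrDl mul1r.
    lra.
  + exact: Zf.
  + apply: field_measurable_comp => //.
    rewrite (_ : (fun w => _) = fun w => \sum_(0 <= k < N | ~~ window 1 j k) Z k w); last first.
      by apply/funext => w; rewrite (bigID (window 1 j)) /= addrC addrK.
    apply: field_measurable_sum => k _ njk.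
    apply: field_measurableS (Zf k) => y /blockP/andP[y1 y2].
    move: njk; rewrite /window negb_and -!ltnNge => /orP[kj|kj].
      left => /=; apply: (le_trans y2).
      have : (k.+2%:R : R) * t <= j%:R * t by apply: grid_le; lia.
      by rewrite -(natr1 k.+1) mulrDl mulrBl !mul1r; lra.
    right => /=; apply: le_trans y1; apply: grid_le; lia.
  + by apply: L4_L2.
  + by [].
- move=> j k jk kN.
  have fZD i : field_measurable A (block eps N i.-1 i.+2)
      (fun w => Z i w * \sum_(0 <= l < N | window 1 i l) Z l w).
    have sub l : window 1 i l -> block eps N l l.+1 `<=` block eps N i.-1 i.+2.
      rewrite /window => /andP[w1 w2] y /blockP/andP[y1 y2]; apply/blockP.
      have l1 : (i.-1 <= l)%N by clear -w1 w2; lia.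
      have l2 : (l.+1 <= i.+2)%N by clear -w1 w2; lia.
      by rewrite (le_trans _ y1) ?(le_trans y2)//; exact: grid_le.
    apply: field_measurableM.
      by apply: field_measurableS (Zf i); apply: sub; rewrite /window; lia.
    by apply: field_measurable_sum => l _ /sub; move/field_measurableS; apply.
  have ZD2 i : L2 Q (fun w => Z i w * \sum_(0 <= l < N | window 1 i l) Z l w).
    by apply: L4M => //; exact: L4_sum.
  refine (mixing_decorrelated phi0 phidec mix (mblock j.-1 j.+2) (mblock k.-1 k.+2)
    _ _ _ _ (fZD j) (fZD k) (ZD2 j) (ZD2 k)).
  + by apply: block0; lia.
  + by apply: block0; lia.
  + exact: ltW.
  + move=> u v /blockP/andP[u1 u2] /blockP/andP[v1 v2].
    rewrite -/t distrC (le_trans _ (ler_norm _))//.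
    have jk3 : (j.+3 <= k.-1)%N by clear -jk; lia.
    have := grid_le _ _ jk3.
    by rewrite -(natr1 j.+2) mulrDl mul1r; lra.
Qed.

Variable I3 : R.
Hypothesis I30 : 0 <= I3.
Hypothesis phi_decay : forall t : R, 0 < t -> phi t <= (I3 / t) ^+ 3.

(** In the next two lemmas q stands for eps^(1/10): the number n of blocks is at most
q^(-8), their size is 2 c q^3 and their correlation is i q^6. *)
Lemma variance_rate (a b i n q c : R) : 0 <= q -> q <= 1 -> 0 <= n ->
  n * q ^+ 8 <= 1 -> 1 <= a -> 0 <= b -> 0 <= i ->
  a * n * (2 * c * q ^+ 3) ^+ 4 + b * n ^+ 2 * (i * q ^+ 6) * (2 * c * q ^+ 3) ^+ 4
  <= (q * (c ^+ 2 * (16 * (a + b * i)))) ^+ 2.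
Proof.
move=> q0 q1 n0 nq a1 b0 i0; set u := n * q ^+ 8; set e := 16 * c ^+ 4 * q ^+ 2.
have e0 : 0 <= e by rewrite mulr_ge0 ?sqr_ge0// mulr_ge0// exprn_even_ge0.
have u0 : 0 <= u by rewrite mulr_ge0// exprn_ge0.
have bi0 : 0 <= b * i by exact: mulr_ge0.
set D := a + b * i; have D1 : 1 <= D by rewrite (le_trans a1)// lerDl.
rewrite [leLHS](_ : _ = e * (a * (u * q ^+ 2) + b * i * u ^+ 2)); last by rewrite /e /u; ring.
rewrite [leRHS](_ : _ = e * (16 * D ^+ 2)); last by rewrite /e; ring.
rewrite ler_wpM2l// (@le_trans _ _ D)//.
  rewrite lerD// ler_piMr// ?(le_trans ler01)//; last exact: exprn_ile1.
  by rewrite mulr_ile1 ?sqr_ge0// exprn_ile1.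
by have := sqr_ge0 D; nra.
Qed.

Lemma error_rate (i n q c l s D : R) : 0 <= q -> q <= 1 -> 0 <= n ->
  n * q ^+ 8 <= 1 -> 0 <= c -> 0 <= i -> 0 <= l -> 0 <= s ->
  n * (i * q ^+ 6) * (2 * c * q ^+ 3) + l * (q * (c ^+ 2 * D))
    + 9 * l ^+ 2 * n * (2 * c * q ^+ 3) ^+ 3
    + l * (n * (i * q ^+ 6) * (2 * c * q ^+ 3) * (s + 1 + 3 * (2 * c * q ^+ 3)))
  <= q * (2 * c * i + l * (c ^+ 2 * D) + 72 * l ^+ 2 * c ^+ 3
          + l * (2 * c * i * (s + 1 + 6 * c))).
Proof.
move=> q0 q1 n0 nq c0 i0 l0 s0; set u := n * q ^+ 8.
have u0 : 0 <= u by rewrite mulr_ge0// exprn_ge0.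
have ci0 : 0 <= 2 * c * i by rewrite !mulr_ge0.
have q3 : q ^+ 3 <= 1 by exact: exprn_ile1.
rewrite [leLHS](_ : _ = q * (u * (2 * c * i) + l * (c ^+ 2 * D)
  + u * (72 * l ^+ 2 * c ^+ 3)
  + l * (u * (2 * c * i) * (s + 1 + 6 * c * q ^+ 3)))); last by rewrite /u; ring.
rewrite ler_wpM2l//; apply: lerD; [apply: lerD; [apply: lerD|]|].
- by rewrite ler_piMl.
- by [].
- by rewrite ler_piMl// mulr_ge0 ?exprn_ge0// mulr_ge0// sqr_ge0.
- rewrite ler_wpM2l// ler_pM//; first by rewrite mulr_ge0.
  + by rewrite !addr_ge0// !mulr_ge0// exprn_ge0.
  + by rewrite ler_piMl.
  + by rewrite lerD2l ler_piMr// mulr_ge0.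
Qed.

(** Blocks of length about eps^(4/5): the number of blocks is about eps^(-4/5),
each contributes a term of size eps^(3/10), and the mixing coefficient at the
distance eps^(-1/5) of two blocks is O(eps^(3/5)); all the error terms are then
O(k) for k = eps^(1/10). *)
Lemma char_scaled_average (k s : R) : 0 < k -> k <= 1 -> 0 <= s ->
  L2 Q (scaled_average (k ^+ 10)) ->
  E (fun w => scaled_average (k ^+ 10) w ^+ 2) <= s ^+ 2 ->
  exists S : T -> R, [/\ L2 Q S,
    E (fun w => (S w - scaled_average (k ^+ 10) w) ^+ 2) <= k ^+ 2 &
    forall l, 0 <= l ->
      gaussian_char_defect Q S (E (fun w => S w ^+ 2))
        (k * (2 * (C * V) * I3 ^+ 3 + l * ((C * V) ^+ 2 * (16 * (126 + 9 * I3 ^+ 3)))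
         + 72 * l ^+ 2 * (C * V) ^+ 3
         + l * (2 * (C * V) * I3 ^+ 3 * (s + 1 + 6 * (C * V))))) l].
Proof.
move=> k0 k1 s0 X2 Xs.
set c := C * V; have cp : 0 <= c by rewrite mulr_ge0.
pose eps := k ^+ 10; have eps0 : 0 < eps by rewrite exprn_gt0.
pose N := Num.trunc (k ^- 8).
have k8 : 1 <= k ^- 8 by rewrite invf_ge1 ?exprn_gt0// exprn_ile1// ltW.
have N0 : (0 < N)%N by rewrite truncn_gt0.
have Np : 0 < N%:R :> R by rewrite ltr0n.
have kp8 : 0 < k ^+ 8 by rewrite exprn_gt0.
have Nk : N%:R * k ^+ 8 <= 1.
  have : N%:R <= k ^- 8 by rewrite truncn_le invr_ge0 ltW.
  by rewrite -(ler_pM2r kp8) mulVf// gt_eqF.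
have Nk2 : 1 <= 2 * N%:R * k ^+ 8.
  have : k ^- 8 <= 2 * N%:R.
    apply: ltW; apply: (lt_le_trans (truncnS_gt _)).
    by rewrite -natr1 -/N mulr_natl mulr2n lerD2l (ler_nat _ 1).
  by move/(ler_wpM2r (ltW kp8)); rewrite mulVf// gt_eqF.
have sqrt_eps : Num.sqrt eps = k ^+ 5.
  rewrite /eps (_ : k ^+ 10 = (k ^+ 5) ^+ 2); last by rewrite -exprM.
  by rewrite sqrtr_sqr ger0_norm// exprn_ge0// ltW.
have [Z [Z4 EZ ZV Zf Zerr]] := @block_approximation eps (k ^+ 2) N eps0
  (exprn_gt0 _ k0) N0.
pose M : R := 2 * c * k ^+ 3; pose rho : R := I3 ^+ 3 * k ^+ 6.
have M0 : 0 <= M by rewrite mulr_ge0 ?exprn_ge0 ?mulr_ge0// ltW.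
have rho0 : 0 <= rho by rewrite mulr_ge0 ?exprn_ge0// ltW.
have Minv : N%:R^-1 <= 2 * k ^+ 8.
  by rewrite -(ler_pM2l Np) mulfV ?gt_eqF// mulrA (mulrC _ 2).
have ZM j : E (fun w => Z j w ^+ 4) <= M ^+ 4.
  apply: (le_trans (ZV j)); rewrite lerXn2r ?nnegrE//.
    by rewrite !mulr_ge0 ?invr_ge0// sqrtr_ge0.
  rewrite sqrt_eps -/c ler_pdivrMr ?exprn_gt0//.
  rewrite (_ : M * k ^+ 5 = 2 * k ^+ 8 * c); last by rewrite /M; ring.
  by rewrite ler_wpM2r.
have phi_rho : phi (N%:R^-1 / eps) <= rho.
  have t0 : 0 < N%:R^-1 / eps by rewrite divr_gt0// invr_gt0.
  apply: (le_trans (phi_decay t0)).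
  rewrite (_ : rho = (I3 * k ^+ 2) ^+ 3); last by rewrite /rho; ring.
  have kn : 0 <= k by exact: ltW.
  apply: lerXn2r; rewrite ?nnegrE; [by rewrite divr_ge0// ltW|by rewrite mulr_ge0// exprn_ge0|].
  rewrite ler_wpM2l// invf_div invrK -(ler_pM2r kp8).
  rewrite /eps (_ : k ^+ 10 * _ * _ = N%:R * k ^+ 8 * (k ^+ 10)); last by ring.
  rewrite (_ : k ^+ 2 * k ^+ 8 = 1 * k ^+ 10); last by ring.
  by rewrite ler_wpM2r// exprn_ge0// ltW.
have dec_mono X X' : decorrelated Q (phi (N%:R^-1 / eps)) X X' -> decorrelated Q rho X X'.
  move=> dX a b a0 b0 Xa Xb; apply: (le_trans (dX a b a0 b0 Xa Xb)).
  by rewrite -[leLHS]mulrA -[leRHS]mulrA ler_wpM2r// mulr_ge0.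
have [dec1 dec2] := blocks_decorrelated eps0 N0 Z4 Zf.
pose S w := \sum_(0 <= j < N) Z j w.
have S2 : L2 Q S by apply: L4_L2; exact: L4_sum.
exists S; split=> //.
have Ss : E (fun w => S w ^+ 2) <= (s + 1) ^+ 2.
  have -> : (fun w => S w ^+ 2) =
      (fun w => (scaled_average eps w + (S w - scaled_average eps w)) ^+ 2).
    by apply/funext => w; rewrite addrC subrK.
  apply: mean_sqrD => //; first exact: L2B.
  by apply: (le_trans Zerr); rewrite expr1n exprn_ile1// ltW.
move=> l l0.
pose v : R := k * (c ^+ 2 * (16 * (126 + 9 * I3 ^+ 3))).
have I33 : 0 <= I3 ^+ 3 by rewrite exprn_ge0.
have v0 : 0 <= v.
  apply: mulr_ge0; first exact: ltW.
  apply: mulr_ge0; first exact: sqr_ge0.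
  by apply: mulr_ge0 => //; apply: addr_ge0; [exact: ler0n|exact: mulr_ge0].
have Vv : 126 * N%:R * M ^+ 4 + 9 * N%:R ^+ 2 * rho * M ^+ 4 <= v ^+ 2.
  apply: variance_rate => //; first exact: ltW.
  by rewrite ler1n.
have s10 : 0 <= s + 1 by rewrite addr_ge0.
have [e1 e2] := char_sum_blocks M0 rho0 Z4 (fun j _ => EZ j) (fun j _ => ZM j)
  (fun j psi jN mpsi psi2 => dec_mono _ _ (dec1 j psi jN mpsi psi2))
  (fun j k jk kN => dec_mono _ _ (dec2 j k jk kN)) s10 Ss l0 v0 Vv.
have err_le := error_rate (16 * (126 + 9 * I3 ^+ 3)) (ltW k0) k1 (ltW Np) Nk cp I33 l0 s0.
split.
  by apply: (le_trans e1); rewrite ler_wpM2l.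
by apply: (le_trans e2); rewrite ler_wpM2l.
Qed.

End blocks.

(** * Convergence of the variance *)

Section integration_tools.
Context {R : realType}.
Local Notation mu := (@lebesgue_measure R).

(** Dominated convergence. *)
Lemma cvg_Rintegral (d : measure_display) (T : measurableType d)
    (m : {measure set T -> \bar R}) (D : set T) (f_ : nat -> T -> R) (f g : T -> R) :
  measurable D -> (forall n, measurable_fun D (f_ n)) -> measurable_fun D f ->
  {ae m, forall x, D x -> f_ n x @[n --> \oo] --> f x} ->
  m.-integrable D (EFin \o g) -> (forall n x, D x -> `|f_ n x| <= g x) ->
  \int[m]_(x in D) f_ n x @[n --> \oo] --> \int[m]_(x in D) f x.
Proof.
move=> mD mf_ mf cf ig fg.
have cf' : {ae m, forall x, D x -> (f_ n x)%:E @[n --> \oo] --> (f x)%:E}.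
  move: cf; apply: filterS => x h Dx.
  by apply: cvg_EFin; [exact: nearW|exact: h].
have [if_ _ cvg] := @dominated_convergence _ _ _ m D mD (fun n x => (f_ n x)%:E)
  (EFin \o f) (EFin \o g) (fun n => (measurable_EFinP _ _).2 (mf_ n))
  ((measurable_EFinP _ _).2 mf) cf' ig (aeW _ (fun x n Dx => fg n x Dx)).
apply: fine_cvg; rewrite /Rintegral fineK//.
by have := integrable_fin_num mD if_.
Qed.

Lemma ae_interior (x : R) :
  {ae mu, forall t, `[0, 1]%classic t -> 0 < t < 1 /\ t != x}.
Proof.
exists [set 0; 1; x]; split.
- by apply: measurableU => //; exact: measurableU.
- apply: countable_lebesgue_measure0; apply: finite_set_countable.
  by rewrite !finite_setU; split => //; split.
move=> t /= nt; apply: contrapT => tN; apply: nt => tD.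
have t_x : t != x by apply/eqP => tx; apply: tN; right.
have t0 : t != 0 by apply/eqP => tx; apply: tN; left; left.
have t1 : t != 1 by apply/eqP => tx; apply: tN; left; right.
by move: tD; rewrite in_itv/= !lt_neqAle eq_sym t0 t1.
Qed.

Section affine.
Variables (s eps : R) (eps0 : 0 < eps).

Let shift (q : measurableTypeR R) : measurableTypeR R := s + eps * q.

Let mshift : measurable_fun setT shift.
Proof. by apply: measurable_funD => //; exact: measurable_funM. Qed.

Let epsnn : {nonneg R} := NngNum (ltW eps0).

Let ge0_change (f : R -> \bar R) : measurable_fun setT f -> (forall x, 0 <= f x)%E ->
  (\int[mu]_t f t = eps%:E * \int[mu]_q f (s + eps * q)%R)%E.
Proof.
move=> mf f0.
rewrite -(@ge0_integral_pushforward _ _ _ _ R shift mshift mu setT f)//.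
rewrite -[eps]/(epsnn%:num).
rewrite -(@ge0_integral_mscale _ _ R (pushforward mu shift) setT measurableT epsnn f)//.
apply: eq_measure_integral => A mA _.
apply: lebesgue_measure_unique => // _ [[a b]] _ <-.
change (mu `]a, b] = eps%:E * mu (shift @^-1` `]a, b]))%E.
rewrite [X in (_ * mu X)%E](_ : _ = `](a - s) / eps, (b - s) / eps]%classic); last first.
  apply/seteqP; split=> q /=; rewrite !in_itv/= ltr_pdivrMr// ler_pdivlMr// /shift;
    by rewrite ltrBlDl lerBrDl (mulrC q).
rewrite !lebesgue_measure_itv/= !lte_fin ltr_pM2r ?invr_gt0// ltrD2r.
case: ifP => _; last by rewrite mule0.
rewrite -!EFinB -EFinM; congr EFin; field; exact: lt0r_neq0.
Qed.

Lemma Rintegral_affine (f : R -> R) : mu.-integrable setT (EFin \o f) ->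
  \int[mu]_t f t = eps * \int[mu]_q f (s + eps * q).
Proof.
move=> iF; have mf := @measurable_int _ _ _ mu _ _ iF.
have step (h : R -> \bar R) : measurable_fun setT h -> (forall x, 0 <= h x)%E ->
    mu.-integrable setT h -> mu.-integrable setT (h \o shift) /\
    (\int[mu]_t h t = eps%:E * \int[mu]_q h (s + eps * q)%R)%E.
  move=> mh h0 ih; have H := ge0_change mh h0; split => //.
  apply/integrableP; split; first exact: (measurableT_comp mh mshift).
  under eq_integral do rewrite gee0_abs//=.
  rewrite ltNge leye_eq; apply/negP => /eqP e.
  have := @integrable_fin_num _ _ _ mu _ measurableT _ ih.
  by rewrite H [X in (_ * X)%E]e gt0_muley.
have [ip ep] := step _ (measurable_funepos mf) (fun x => funepos_ge0 _ x) (integrable_funepos measurableT iF).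
have [in_ en] := step _ (measurable_funeneg mf) (fun x => funeneg_ge0 _ x) (integrable_funeneg measurableT iF).
rewrite /Rintegral integralE ep en -muleBr//; last first.
  by apply: fin_num_adde_defr; exact: (@integrable_fin_num _ _ _ mu _ measurableT _ ip).
rewrite fineM//; last first.
  by rewrite fin_numB (@integrable_fin_num _ _ _ mu _ measurableT _ ip) (@integrable_fin_num _ _ _ mu _ measurableT _ in_).
have e := @integralE _ _ _ mu setT (EFin \o (fun x => f (s + eps * x))).
transitivity (eps * fine (\int[mu]_x (EFin \o (fun y : R => f (s + eps * y)%R)) x)%E); last by [].
by rewrite e; congr (eps * fine (_ - _)%E); apply: eq_integral => y _;
  rewrite ?funeposE ?funenegE.
Qed.

End affine.

End integration_tools.

Section measurable_mean.
Context {d : measure_display} {T : measurableType d} {R : realType}.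
Variable Q : probability T R.

Lemma measurable_mean (u : R -> T -> R) :
  measurable_fun setT (fun p : R * T => u p.1 p.2) ->
  measurable_fun setT (fun s => mean Q (u s)).
Proof.
move=> mu_; pose h (p : R * T) : \bar R := (u p.1 p.2)%:E.
have mh : measurable_fun setT h by apply/measurable_EFinP.
have mp := @measurable_fun_fubini_tonelli_F _ _ _ _ R Q _ (measurable_funepos mh)
  (fun p => funepos_ge0 h p).
have mn := @measurable_fun_fubini_tonelli_F _ _ _ _ R Q _ (measurable_funeneg mh)
  (fun p => funeneg_ge0 h p).
have -> : (fun s => mean Q (u s)) =
    fine \o (fubini_F Q (h ^\+)%E \- fubini_F Q (h ^\-)%E)%E.
  apply/funext => s; rewrite /mean /Rintegral integralE /= /fubini_F.
  by congr (fine (_ - _)%E); apply: eq_integral => w _; rewrite ?funeposE ?funenegE.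
apply: (measurableT_comp (fine_measurable measurableT)).
exact: emeasurable_funB.
Qed.

End measurable_mean.

Lemma continuous_negative_part {R : realType} (h : R -> R) (t : R) :
  {for t, continuous h} -> {for t, continuous (fun s => Num.max 0 (- h s) : R)}.
Proof.
move=> ch; apply: (continuous_max (f := fun=> 0) (g := fun s => - h s)); first exact: cvg_cst.
exact: cvgN.
Qed.

Section limit_variance.
Context {d : measure_display} {T : measurableType d} {R : realType}.
Variables (A : R -> R -> T -> R) (Q : probability T R).
Hypothesis hA : measurable_field A.
Variables nu1 nu2 : T -> R -> R.
Hypothesis hell : pathwise_elliptic A nu1 nu2.
Variables (c1 c2 : R).
Hypothesis hmean : mean_hypothesis A Q c1 c2.
Variable C6 : R.
Hypothesis hmom : sixth_moment_bound A Q C6.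
Variable Gamma : R -> R.
Hypothesis hcov : cov_hypothesis A Q Gamma.
Hypothesis hcont : cov_continuous_diag A Q.
Local Notation mu := (@lebesgue_measure R).
Local Notation E := (mean Q).
Local Notation V := (1 + `|C6|).
Local Notation flu := (fluct A Q).
Local Notation Cov := (Cov A Q).

Let V0 : 0 <= V. Proof. by rewrite addr_ge0. Qed.

Let f4 s y : L4 Q (flu s y).
Proof. by have [] := fluct_moments hA hmean hmom s y. Qed.

Let f2 s y : L2 Q (flu s y). Proof. exact: L4_L2. Qed.

Let fV s y : E (fun w => flu s y w ^+ 2) <= V ^+ 2.
Proof.
by apply: L2_norm_of_L4 => //; have [] := fluct_moments hA hmean hmom s y.
Qed.

Let covE (s t y z : R) : 0 <= s <= 1 -> 0 <= t <= 1 -> 0 <= y -> 0 <= y + z ->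
  E (fun w => flu s y w * flu t (y + z) w) = Cov s t z.
Proof. by move=> s01 t01 y0 yz0; apply: (fluct_covariance hA hmean hmom hcov). Qed.

(** The mean square of the increment is a combination of covariances at lag zero,
whatever the fast variable y is. *)
Lemma fluct_continuous (t e : R) : 0 <= t <= 1 -> 0 < e ->
  exists2 delta, 0 < delta & forall t' y : R, 0 <= t' <= 1 -> `|t' - t| < delta -> 0 <= y ->
    E (fun w => (flu t' y w - flu t y w) ^+ 2) <= e ^+ 2.
Proof.
move=> t01 e0; have t01' : t \in `[0, 1] by rewrite in_itv.
pose eta := e ^+ 2 / 4.
have eta0 : 0 < eta by rewrite divr_gt0// exprn_gt0.
have := hcont t01'; move/cvgrPdist_lt => /(_ _ eta0).
rewrite /within/= => /nbhs_ballP[delta /= delta0 H].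
exists delta => // t' y t'01 t't y0.
have pair (a b : R) : 0 <= a <= 1 -> 0 <= b <= 1 -> `|a - t| < delta -> `|b - t| < delta ->
    `|Cov t t 0 - Cov a b 0| < eta.
  move=> a01 b01 at_ bt; apply: (H (a, b)).
    by split; rewrite /ball/= distrC.
  by split; rewrite /= in_itv.
have tt : `|t - t| < delta by rewrite subrr normr0.
have c0 (a b : R) : 0 <= a <= 1 -> 0 <= b <= 1 ->
    E (fun w => flu a y w * flu b y w) = Cov a b 0.
  by move=> a01 b01; have := covE a01 b01 y0 (z := 0); rewrite addr0; exact.
rewrite (_ : (fun w => _ ^+ 2) = (fun w => flu t' y w * flu t' y w
   - (2 * (flu t' y w * flu t y w) - flu t y w * flu t y w))); last first.
  by apply/funext => w; ring.
have i1 := L2M (f2 t' y) (f2 t' y); have i2 := L2M (f2 t' y) (f2 t y).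
have i3 := L2M (f2 t y) (f2 t y).
rewrite meanB//; last by apply: L1B => //; exact: L1Z.
rewrite meanB//; last exact: L1Z.
rewrite meanZ// !c0//.
have := pair _ _ t'01 t'01 t't t't; have := pair _ _ t'01 t01 t't tt.
rewrite !ltr_norml => /andP[p1 p2] /andP[p3 p4].
have : e ^+ 2 = 4 * eta by rewrite /eta; field.
lra.
Qed.

Lemma covariance_continuous (t e : R) : 0 <= t <= 1 -> 0 < e ->
  exists2 delta, 0 < delta & forall a b q : R, 0 <= a <= 1 -> 0 <= b <= 1 ->
    `|a - t| < delta -> `|b - t| < delta -> `|Cov a b q - Cov t t q| <= e.
Proof.
move=> t01 e0.
have e'0 : 0 < e / (2 * V) by exact: divr_gt0.
have [delta delta0 H] := fluct_continuous t01 e'0.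
exists delta => // a b q a01 b01 at_ bt.
pose y := Num.max 0 (- q).
have y0 : 0 <= y by rewrite /y le_max lexx.
have yq0 : 0 <= y + q by rewrite -lerBlDr sub0r /y le_max lexx orbT.
rewrite -(covE a01 b01 y0 yq0) -(covE t01 t01 y0 yq0).
have iab := L2M (f2 a y) (f2 b (y + q)); have itt := L2M (f2 t y) (f2 t (y + q)).
rewrite -meanB//.
rewrite (_ : (fun w => _ - _) = (fun w =>
    (flu a y w - flu t y w) * flu b (y + q) w
    + flu t y w * (flu b (y + q) w - flu t (y + q) w))); last first.
  by apply/funext => w; ring.
have d1 : L2 Q (fun w => flu a y w - flu t y w) by exact: L2B.
have d2 : L2 Q (fun w => flu b (y + q) w - flu t (y + q) w) by exact: L2B.
have i1 := L2M d1 (f2 b (y + q)); have i2 := L2M (f2 t y) d2.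
rewrite meanD//.
have e0' := ltW e'0.
have b1 := le_trans (norm_mean i1) (mean_Cauchy_Schwarz_le d1 (f2 b (y + q)) e0' V0
  (H _ _ a01 at_ y0) (fV _ _)).
have b2 := le_trans (norm_mean i2) (mean_Cauchy_Schwarz_le (f2 t y) d2 V0 e0'
  (fV _ _) (H _ _ b01 bt yq0)).
apply: (le_trans (ler_normD _ _)); apply: (le_trans (lerD b1 b2)).
rewrite le_eqVlt; apply/orP; left; apply/eqP; field.
by rewrite gt_eqF// (lt_le_trans ltr01)// lerDl.
Qed.

Let cov_le (s t q : R) : 0 <= s <= 1 -> 0 <= t <= 1 -> `|Cov s t q| <= Gamma q.
Proof. by move=> s01 t01; have [_ h _] := hcov; apply: h; rewrite in_itv. Qed.

Let Gamma0 (q : R) : 0 <= Gamma q.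
Proof.
have z01 : 0 <= (0 : R) <= 1 by rewrite lexx ler01.
exact: le_trans (cov_le q z01 z01).
Qed.

Let iGamma : mu.-integrable setT (EFin \o Gamma).
Proof. by have [_ _] := hcov. Qed.

Definition clamp (s : R) : R := Num.max 0 (Num.min 1 s).

Lemma clamp01 s : 0 <= clamp s <= 1.
Proof. by rewrite /clamp le_max lexx/= ge_max ler01 ge_min lexx. Qed.

Lemma clamp_id s : 0 <= s <= 1 -> clamp s = s.
Proof. by move=> /andP[s0 s1]; rewrite /clamp (min_idPr s1) (max_idPr s0). Qed.

Lemma continuous_clamp : continuous clamp.
Proof.
move=> s; apply: continuous_max; first exact: cvg_cst.
by apply: continuous_min; [exact: cvg_cst|exact: cvg_id].
Qed.

Let measurable_Cov (t : R) : 0 <= t <= 1 -> measurable_fun setT (Cov t t).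
Proof.
move=> t01; pose y (q : R) := Num.max 0 (- q).
have y0 q : 0 <= y q by rewrite /y le_max lexx.
have yq0 q : 0 <= y q + q by rewrite -lerBlDr sub0r /y le_max lexx orbT.
have -> : Cov t t = fun q => E (fun w => flu t (y q) w * flu t (y q + q) w).
  by apply/funext => q; rewrite covE.
have my : measurable_fun setT y.
  apply: continuous_measurable_fun => q; apply: continuous_max; first exact: cvg_cst.
  by apply: cvgN; exact: cvg_id.
have mf (h : R -> R) : measurable_fun setT h ->
    measurable_fun setT (fun p : R * T => flu t (h p.1) p.2).
  move=> mh.
  have m1 : measurable_fun setT (fun p : R * T => ((t, h p.1), p.2)).
    apply: measurable_fun_pair => //; apply: measurable_fun_pair => //.
    exact: measurableT_comp.
  exact: (measurableT_comp (measurable_fluct hA hell hmean) m1).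
apply: (@measurable_mean _ _ _ Q (fun q w => flu t (y q) w * flu t (y q + q) w)).
apply: measurable_funM; first exact: mf.
by apply: (mf (fun q => y q + q)); apply: measurable_funD.
Qed.

(** The integral of the covariance over all lags, extended constantly outside
[0, 1]; it is the square of sigma once it is known to be nonnegative. *)
Definition lag_integral (t : R) : R := \int[mu]_q Cov (clamp t) (clamp t) q.

Let G : R := \int[mu]_q Gamma q.

Let G0 : 0 <= G. Proof. exact: Rintegral_ge0. Qed.

Lemma lag_integral_le t : `|lag_integral t| <= G.
Proof.
have iC : mu.-integrable setT (EFin \o Cov (clamp t) (clamp t)).
  apply: (@le_integrable _ _ _ mu _ measurableT _ _ _ _ iGamma).
    by apply/measurable_EFinP; apply: measurable_Cov; exact: clamp01.
  by move=> q _; rewrite /= lee_fin (ger0_norm (Gamma0 q)) cov_le// clamp01.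
apply: (le_trans (@le_normr_Rintegral _ _ _ mu _ _ measurableT iC)).
apply: le_Rintegral => //; first exact: integrable_norm.
by move=> q _; rewrite cov_le// clamp01.
Qed.

Let cvg_covariance (a b : nat -> R) (t q : R) : 0 <= t <= 1 ->
  a n @[n --> \oo] --> t -> b n @[n --> \oo] --> t ->
  (\forall n \near \oo, 0 <= a n <= 1) -> (\forall n \near \oo, 0 <= b n <= 1) ->
  Cov (a n) (b n) q @[n --> \oo] --> Cov t t q.
Proof.
move=> t01 at_ bt a01 b01; apply/cvgrPdist_le => e e0.
have [delta delta0 H] := covariance_continuous t01 e0.
move/cvgrPdist_lt: at_ => /(_ _ delta0) at_; move/cvgrPdist_lt: bt => /(_ _ delta0) bt.
near=> n; rewrite distrC; apply: H; [by near: n|by near: n| |]; rewrite distrC; by near: n.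
Unshelve. all: by end_near. Qed.

(** Dominated convergence, with [Gamma] as bound. *)
Lemma continuous_lag_integral : continuous lag_integral.
Proof.
move=> t; apply/(@cvg_nbhsP R R^o) => u ut.
have cu : clamp (u n) @[n --> \oo] --> clamp t.
  by apply: continuous_cvg ut; exact: continuous_clamp.
apply: (cvg_Rintegral measurableT _ _ _ iGamma).
- by move=> n; apply: measurable_Cov; exact: clamp01.
- by apply: measurable_Cov; exact: clamp01.
- apply: aeW => q _; apply: cvg_covariance => //; first exact: clamp01.
    by apply: nearW => n; exact: clamp01.
  by apply: nearW => n; exact: clamp01.
- by move=> n q _; rewrite cov_le// clamp01.
Qed.

Section weight.
Variables (g : R -> R) (C : R).
Hypothesis mg : measurable_fun setT g.
Hypothesis gC : forall s, `|g s| <= C.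

Let C0 : 0 <= C. Proof. exact: le_trans (gC 0). Qed.

Local Notation S eps := (scaled_average A Q g eps).

Let correlated (eps t s : R) : R :=
  E (fun w => flu t (t / eps) w * flu s (s / eps) w).

(** The inner integral of the variance after the substitution s = t + eps q. *)
Let H (eps t : R) : R :=
  \int[mu]_q (g (t + eps * q) * correlated eps t (t + eps * q)).

Let integrand_le (eps t q : R) : 0 < eps -> 0 <= t <= 1 ->
  `|g (t + eps * q) * correlated eps t (t + eps * q)| <= C * Gamma q.
Proof.
move=> eps0 t01; rewrite normrM ler_pM//.
have [s01|ns01] := boolP (0 <= t + eps * q <= 1); last first.
  rewrite /correlated (_ : (fun w => _) = fun=> 0); last first.
    by apply/funext => w; rewrite [X in _ * X]/fluct (negbTE ns01) mulr0.
  by rewrite mean_cst normr0.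
have /andP[t0 t1] := t01; have /andP[s0 s1] := s01.
have lagE : (t + eps * q) / eps = t / eps + q by field; exact: lt0r_neq0.
have y0 : 0 <= t / eps by rewrite divr_ge0// ltW.
have yq0 : 0 <= t / eps + q by rewrite -lagE divr_ge0// ltW.
by rewrite /correlated lagE covE// cov_le.
Qed.

Let measurable_correlated (eps t : R) : measurable_fun setT (correlated eps t).
Proof.
apply: (@measurable_mean _ _ _ Q (fun s w => flu t (t / eps) w * flu s (s / eps) w)).
apply: measurable_funM; last exact: (measurable_fluct_eps hA hell hmean).
have mf := L1_measurable (L2_L1 (f2 t (t / eps))).
exact: measurableT_comp.
Qed.

Let measurable_integrand (eps t : R) : measurable_fun setT
  (fun q => g (t + eps * q) * correlated eps t (t + eps * q)).
Proof.
have ma : measurable_fun setT (fun q : R => t + eps * q).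
  by apply: measurable_funD => //; exact: measurable_funM.
apply: measurable_funM; first exact: (measurableT_comp mg ma).
exact: (measurableT_comp (measurable_correlated eps t) ma).
Qed.

Let iCGamma : mu.-integrable setT (EFin \o (fun q => C * Gamma q)).
Proof. by have := @integrableZl _ _ _ mu _ measurableT C _ iGamma. Qed.

Let H_le (eps t : R) : 0 < eps -> 0 <= t <= 1 -> `|H eps t| <= C * G.
Proof.
move=> eps0 t01.
have iI : mu.-integrable setT (EFin \o (fun q => g (t + eps * q) * correlated eps t (t + eps * q))).
  apply: (@le_integrable _ _ _ mu _ measurableT _ _ _ _ iCGamma).
    by apply/measurable_EFinP; exact: measurable_integrand.
  move=> q _; rewrite /= lee_fin [leRHS]ger0_norm ?mulr_ge0//.
  exact: integrand_le.
apply: (le_trans (@le_normr_Rintegral _ _ _ mu _ _ measurableT iI)).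
rewrite -RintegralZl//; apply: le_Rintegral => //; first exact: integrable_norm.
by move=> q _; exact: integrand_le.
Qed.

Let variance_formula (eps : R) : 0 < eps ->
  E (fun w => S eps w ^+ 2) = \int[mu]_(t in `[0, 1]) (g t * H eps t) /\
  mu.-integrable `[0, 1] (EFin \o (fun t => g t * H eps t)).
Proof.
move=> eps0.
pose Y (s : R) := flu s (s / eps).
have mY : measurable_fun setT (fun p : R * T => Y p.1 p.2).
  exact: (measurable_fluct_eps hA hell hmean).
have Ypath w := fluct_path hA hell hmean w eps0.
have Y4 s : L4 Q (Y s) by exact: f4.
have YV s : E (fun w => Y s w ^+ 4) <= V ^+ 4.
  by have [] := fluct_moments hA hmean hmom s (s / eps).
pose I := weighted_average Y g 0 1.
have [I2 _] := weighted_average_sqr mY Ypath Y4 V0 YV mg gC (@ltr01 R).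
have mwa := mean_weighted_average mY Ypath Y4 V0 YV mg gC 0 1.
have [iII iIY IIE] := mwa I I2.
have inner t : 0 <= t <= 1 -> E (fun w => I w * Y t w) = eps * H eps t.
  move=> t01; have [_ iYY YIE] := mwa (Y t) (L4_L2 (Y4 t)).
  have -> : (fun w => I w * Y t w) = (fun w => Y t w * I w) by apply/funext => w; rewrite mulrC.
  rewrite YIE Rintegral_mkcond.
  have patchE : (fun s => g s * E (fun w => Y t w * Y s w)) \_ `[0, 1] =
      (fun s => g s * correlated eps t s).
    apply/funext => s; rewrite /patch; case: ifPn => // /negP ns.
    rewrite /correlated (_ : (fun w => _) = fun=> 0) ?mean_cst ?mulr0//.
    apply/funext => w; rewrite [X in _ * X]/fluct ifF ?mulr0//.
    by apply/negbTE/negP => /andP[s01 _]; apply: ns; rewrite inE /= in_itv.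
  rewrite patchE (Rintegral_affine t eps0)//.
  have mD : measurable (`[0, 1]%classic : set (measurableTypeR R)).
    exact: measurable_itv.
  have := (@integrable_mkcond _ _ _ mu _ _ mD).1 iYY.
  by rewrite restrict_EFin patchE.
have Ht : {in `[0, 1]%classic, (fun t => g t * E (fun w => I w * Y t w)) =1
    (fun t => eps * (g t * H eps t))}.
  by move=> t; rewrite inE /= in_itv/= => t01; rewrite inner// mulrCA.
have iH : mu.-integrable `[0, 1] (EFin \o (fun t => g t * H eps t)).
  have mD : measurable (`[0, 1]%classic : set (measurableTypeR R)).
    exact: measurable_itv.
  have := @integrableZl _ _ _ mu _ mD eps^-1 _ iIY.
  apply: eq_integrable => // t tD; rewrite /= -EFinM; congr EFin.
  by rewrite Ht// mulKf// lt0r_neq0.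
split => //.
rewrite /scaled_average -/Y -/I.
under eq_fun do rewrite exprMn.
rewrite meanZ; last by have [] := I2.
have -> : (fun w => I w ^+ 2) = (fun w => I w * I w) by apply/funext => w; rewrite expr2.
rewrite IIE (@eq_Rintegral _ _ _ mu _ _ _ Ht) RintegralZl//.
by rewrite exprVn sqr_sqrtr ?(ltW eps0)// mulKf// lt0r_neq0.
Qed.

Lemma variance_scaled_average_le (eps : R) : 0 < eps ->
  E (fun w => S eps w ^+ 2) <= C ^+ 2 * G.
Proof.
move=> eps0; have [-> iH] := variance_formula eps0.
apply: (le_trans (ler_norm _)).
rewrite [leRHS](_ : _ = C * (C * G) * fine (mu `[0, 1])); last first.
  by rewrite fine_lebesgue_itv// subr0 mulr1 mulrA -expr2.
apply: norm_Rintegral_le => //; first exact: lebesgue_itv_lty.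
  by move/integrableP : iH => [/measurable_EFinP].
move=> t; rewrite /= in_itv/= => t01; rewrite normrM ler_pM//.
exact: H_le.
Qed.

Let H_cvg (u : nat -> R) (t : R) : (forall n, 0 < u n) -> u n @[n --> \oo] --> 0 ->
  0 < t < 1 -> {for t, continuous g} -> H (u n) t @[n --> \oo] --> g t * lag_integral t.
Proof.
move=> u0 u_0 /andP[t0 t1] cg.
have t01 : 0 <= t <= 1 by rewrite !ltW.
have tu q : t + u n * q @[n --> \oo] --> t.
  rewrite -[X in _ --> X]addr0 -[in X in _ --> X](mul0r q).
  by apply: cvgD; [exact: cvg_cst|apply: cvgM => //; exact: cvg_cst].
rewrite -RintegralZl//; last first.
  rewrite (clamp_id t01); apply: (@le_integrable _ _ _ mu _ measurableT _ _ _ _ iGamma).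
    by apply/measurable_EFinP; apply: measurable_Cov.
  by move=> q _; rewrite /= lee_fin (ger0_norm (Gamma0 q)) cov_le.
rewrite (clamp_id t01).
apply: (cvg_Rintegral measurableT _ _ _ iCGamma).
- by move=> n; exact: measurable_integrand.
- by apply: measurable_funM => //; exact: measurable_Cov.
- apply: aeW => q _; apply: cvgM; first exact: continuous_cvg (tu q).
  have near01 : \forall n \near \oo, 0 <= t + u n * q <= 1.
    have open01 : open_nbhs t `]0, 1[%classic.
      by split; [exact: interval_open|rewrite /= in_itv/= t0 t1].
    have : \forall n \near \oo, (`]0, 1[%classic : set R) (t + u n * q).
      exact: (tu q _ (open_nbhs_nbhs open01)).
    apply: filterS => n /=.
    by rewrite in_itv/= => /andP[h1 h2]; rewrite !ltW.
  apply: (@cvg_trans _ (Cov t (t + u n * q) q @[n --> \oo])).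
    apply: near_eq_cvg; move: near01; apply: filterS => n s01.
    have /andP[s0 _] := s01.
    have lagE : (t + u n * q) / u n = t / u n + q by field; exact: lt0r_neq0.
    have y0 : 0 <= t / u n by rewrite divr_ge0// ltW.
    have yq0 : 0 <= t / u n + q by rewrite -lagE divr_ge0// ltW.
    by rewrite /correlated lagE covE.
  by apply: cvg_covariance => //; [exact: cvg_cst|exact: nearW].
- by move=> n q _; exact: integrand_le.
Qed.

Lemma cvg_variance_scaled_average (u : nat -> R) (x : R) :
  (forall n, 0 < u n) -> u n @[n --> \oo] --> 0 ->
  (forall t, 0 < t < 1 -> t != x -> {for t, continuous g}) ->
  E (fun w => S (u n) w ^+ 2) @[n --> \oo] -->
    \int[mu]_(t in `[0, 1]) (g t ^+ 2 * lag_integral t).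
Proof.
move=> u0 u_0 cg.
under eq_cvg do rewrite (variance_formula (u0 _)).1.
have mD : measurable (`[0, 1]%classic : set (measurableTypeR R)).
  exact: measurable_itv.
have mlag : measurable_fun setT lag_integral.
  by apply: continuous_measurable_fun; exact: continuous_lag_integral.
have iC : mu.-integrable `[0, 1] (EFin \o cst (C * (C * G))).
  apply: (@integrable_bounded _ _ _ (`|C * (C * G)|)) => //; exact: lebesgue_itv_lty.
apply: (cvg_Rintegral mD _ _ _ iC).
- by move=> n; have [_ /integrableP[/measurable_EFinP]] := variance_formula (u0 n).
- by apply: measurable_funTS; apply: measurable_funM => //; exact: measurable_funX.
- have [N [mN N0 sub]] := ae_interior x.
  exists N; split=> // t /= nt; apply: sub => /= h; apply: nt => /h[t01 tx].
  rewrite expr2 -mulrA; apply: cvgM; first exact: cvg_cst.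
  by apply: H_cvg => //; exact: cg.
- move=> n t; rewrite /= in_itv/= => t01; rewrite normrM ler_pM//.
  exact: H_le.
Qed.

End weight.

(** Integrated against the square of a weight it is a limit of variances; take as
weight its negative part. *)
Lemma lag_integral_ge0_ae : {ae mu, forall t, `[0, 1]%classic t -> 0 <= lag_integral t}.
Proof.
pose g (t : R) : R := Num.max 0 (- lag_integral t).
have g0 t : 0 <= g t by rewrite /g le_max lexx.
have cg : continuous g.
  by move=> t; apply: continuous_negative_part; exact: continuous_lag_integral.
have mg : measurable_fun setT g by exact: continuous_measurable_fun.
have gG t : `|g t| <= G.
  rewrite ger0_norm// /g ge_max G0/=.
  by apply: le_trans (lag_integral_le t); rewrite -normrN ler_norm.
have mD : measurable (`[0, 1]%classic : set (measurableTypeR R)).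
  exact: measurable_itv.
have cubeE t : g t ^+ 2 * lag_integral t = - g t ^+ 3.
  rewrite /g; have [h|h] := leP (- lag_integral t) 0; first by rewrite !expr0n/= mul0r oppr0.
  by ring.
have lim0 : 0 <= \int[mu]_(t in `[0, 1]) (g t ^+ 2 * lag_integral t).
  have := @cvg_variance_scaled_average g G mg gG (fun n => n.+1%:R^-1) 0
    (fun n => ltac:(by rewrite invr_gt0)) (@cvg_harmonic R) (fun t _ _ => cg t).
  move=> h; rewrite -(cvg_lim (@Rhausdorff R) h); apply: limr_ge; first exact: cvgP h.
  by apply: nearW => n; apply: mean_ge0 => w; exact: sqr_ge0.
have mg3 : measurable_fun (`[0, 1] : set R) (fun t => g t ^+ 3).
  by apply: measurable_funTS; exact: measurable_funX.
have ig3 : mu.-integrable `[0, 1] (EFin \o (fun t => g t ^+ 3)).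
  apply: (@integrable_bounded _ _ _ (G ^+ 3)) => //; first exact: lebesgue_itv_lty.
  by move=> t _; rewrite normrX lerXn2r ?nnegrE.
have int0 : \int[mu]_(t in `[0, 1]) (g t ^+ 3) = 0.
  apply/eqP; rewrite eq_le Rintegral_ge0 ?andbT; last by move=> t _; exact: exprn_ge0.
  move: lim0; under eq_Rintegral do rewrite cubeE -mulN1r.
  by rewrite RintegralZl// mulN1r oppr_ge0.
have eint0 : (\int[mu]_(t in `[0%R, 1%R]) `|(g t ^+ 3)%:E| = 0)%E.
  under eq_integral do rewrite gee0_abs ?lee_fin ?exprn_ge0//.
  by rewrite -[LHS]fineK ?(@integrable_fin_num _ _ _ mu _ mD _ ig3)//; congr EFin.
have := (@ae_eq_integral_abs _ _ _ mu _ mD _ ((measurable_EFinP _ _).2 mg3)).1 eint0.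
apply: filterS => t h tD; have [] := h tD; move/eqP; rewrite expf_eq0 => /= /eqP.
rewrite /g => gt0; rewrite leNgt; apply/negP => lt0.
by move: gt0; rewrite max_r ?oppr_ge0 ?ltW// => /eqP; rewrite oppr_eq0 (lt_eqF lt0).
Qed.

End limit_variance.

(** * Fluctuation of the solution *)

Section primitive.
Context {R : realType}.
Local Notation mu := (@lebesgue_measure R).
Variable f : R -> R.
Hypothesis hf : square_integrable01 f.

Let mD : measurable (`[0, 1]%classic : set (measurableTypeR R)).
Proof. exact: measurable_itv. Qed.

Lemma square_integrable01_integrable : mu.-integrable `[0, 1] (EFin \o f).
Proof.
have [mf if2] := hf.
have i1 : mu.-integrable `[0, 1] (EFin \o (fun=> 1 : R)).
  by apply: (@integrable_bounded _ _ _ 1) => // [|s _]; [exact: lebesgue_itv_lty|rewrite normr1].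
have i2 := @integrableD _ _ _ mu _ mD _ _ i1 if2.
apply: (@le_integrable _ _ _ mu _ mD _ _ _ _ i2); first exact/measurable_EFinP.
move=> s _; change (`|(f s)%:E| <= `|(1 + f s ^+ 2)%:E|)%E.
rewrite /= lee_fin [leRHS]ger0_norm ?addr_ge0 ?sqr_ge0//.
rewrite -[f s ^+ 2]real_normK ?num_real//.
by have := normr_ge0 (f s); move: `|f s| => t t0; nra.
Qed.

Definition clamped_primitive (s : R) : R := primitive f (clamp s).

Lemma continuous_clamped_primitive : continuous clamped_primitive.
Proof.
have := parameterized_integral_continuous (@ler01 R) square_integrable01_integrable.
move=> /subspace_continuousP cF t.
have ct : `[0, 1]%classic (clamp t) by rewrite /= in_itv/=; exact: clamp01.
apply: (@cvg_comp _ _ _ _ _ _ (within `[0, 1] (nbhs (clamp t))) _ _ (cF _ ct)).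
move=> P hP.
have Pt : \forall s \near t, `[0, 1]%classic (clamp s) -> P (clamp s).
  exact: (@continuous_clamp R t _ hP).
have : \forall s \near t, P (clamp s).
  by apply: filterS Pt => s; apply; rewrite /= in_itv/=; exact: clamp01.
by [].
Qed.

Lemma clamped_primitive_bounded : exists B, forall s, `|clamped_primitive s| <= B.
Proof.
have mD' : measurable_fun (`[0, 1] : set R) f by have [] := hf.
exists (\int[mu]_(s in `[0, 1]) `|f s|) => s.
have /andP[s0 s1] := clamp01 s.
have sub : `[0, clamp s]%classic `<=` `[0, 1]%classic.
  by apply: subset_itvl; rewrite bnd_simp.
have mDs : measurable (`[0, clamp s]%classic : set (measurableTypeR R)).
  exact: measurable_itv.
have if1 := square_integrable01_integrable.
have ifs := integrableS mD mDs sub if1.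
apply: (le_trans (@le_normr_Rintegral _ _ _ mu _ _ mDs ifs)).
have ia : mu.-integrable `[0, 1] (EFin \o (fun s => `|f s|)) by exact: integrable_norm.
rewrite /Rintegral fine_le//.
- by apply: (@integrable_fin_num _ _ _ mu _ mDs); exact: integrable_norm.
- exact: (@integrable_fin_num _ _ _ mu _ mD).
- apply: ge0_subset_integral => //.
  by apply/measurable_EFinP; exact: measurableT_comp.
Qed.

End primitive.

Section solution_difference.
Context {R : realType}.
Local Notation mu := (@lebesgue_measure R).
Variables (f b b0 : R -> R) (x : R).
Hypothesis x01 : 0 <= x <= 1.
Local Notation F := (primitive f).
Local Notation a := (fun s => (b s)^-1).
Local Notation a0 := (fun s => (b0 s)^-1).
Local Notation J h := (\int[mu]_(s in `[0, 1]) h s).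
Local Notation c := (avg (fun t => F t / b0 t) / avg a0).
Local Notation theta := ((avg a0)^-1 * (\int[mu]_(t in `[0, x]) (b0 t)^-1)).

Let mD y : measurable (`[0, y]%classic : set (measurableTypeR R)).
Proof. exact: measurable_itv. Qed.

Lemma Rintegral_indicator (h : R -> R) :
  \int[mu]_(s in `[0, x]) h s = J (fun s : R => (s <= x)%R%:R * h s).
Proof.
have /andP[x0 x1] := x01.
rewrite [LHS]Rintegral_mkcond [RHS]Rintegral_mkcond; apply: eq_Rintegral => s _.
rewrite /patch; case: ifPn => [|/negP]; rewrite inE /= in_itv/=.
  by move=> /andP[s0 sx]; rewrite mem_set ?sx ?mul1r//= in_itv/= s0 (le_trans sx).
case: ifPn => // /set_mem; rewrite /= in_itv/= => /andP[s0 s1] /negP.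
by rewrite s0/= => /negbTE ->; rewrite mul0r.
Qed.

Lemma kernelGE s : kernelG f b0 x s = (F s - c) * (theta - (s <= x)%R%:R).
Proof. by rewrite /kernelG; case: ifP => _; rewrite ?subr0. Qed.

Hypothesis ia : mu.-integrable `[0, 1] (EFin \o a).
Hypothesis ia0 : mu.-integrable `[0, 1] (EFin \o a0).
Hypothesis iFa : mu.-integrable `[0, 1] (EFin \o (fun s => F s / b s)).
Hypothesis iFa0 : mu.-integrable `[0, 1] (EFin \o (fun s => F s / b0 s)).

Let iZ y k (h : R -> R) : mu.-integrable `[0, y] (EFin \o h) ->
  mu.-integrable `[0, y] (EFin \o (fun s => k * h s)).
Proof. by move=> ih; have := @integrableZl _ _ _ mu _ (mD y) k _ ih. Qed.

Let iB y (h k : R -> R) : mu.-integrable `[0, y] (EFin \o h) ->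
  mu.-integrable `[0, y] (EFin \o k) -> mu.-integrable `[0, y] (EFin \o (fun s => h s - k s)).
Proof. by move=> ih ik; have := @integrableB _ _ _ mu _ (mD y) _ _ ih ik. Qed.

Let iS y (h : R -> R) : y <= 1 -> mu.-integrable `[0, 1] (EFin \o h) ->
  mu.-integrable `[0, y] (EFin \o h).
Proof.
by move=> y1 ih; apply: (integrableS _ _ _ ih) => //; apply: subset_itvl; rewrite bnd_simp.
Qed.

Let expand_difference y : y <= 1 -> \int[mu]_(s in `[0, y]) (a s - a0 s) =
  \int[mu]_(s in `[0, y]) a s - \int[mu]_(s in `[0, y]) a0 s.
Proof. by move=> y1; rewrite RintegralB//; exact: iS. Qed.

Let expand_flux y : y <= 1 -> \int[mu]_(s in `[0, y]) ((F s - c) * (a s - a0 s)) =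
  \int[mu]_(s in `[0, y]) (F s / b s) - \int[mu]_(s in `[0, y]) (F s / b0 s)
  - c * (\int[mu]_(s in `[0, y]) a s - \int[mu]_(s in `[0, y]) a0 s).
Proof.
move=> y1; rewrite -expand_difference//.
rewrite -(RintegralZl _ (mD y)); last by apply: iB; exact: iS.
rewrite -RintegralB//; [|exact: iS|exact: iS].
rewrite -RintegralB//; first by apply: eq_Rintegral => s _; ring.
  by apply: iB; exact: iS.
by apply: iZ; apply: iB; exact: iS.
Qed.

Let iflux : mu.-integrable `[0, 1] (EFin \o (fun s => (F s - c) * (a s - a0 s))).
Proof.
have := iB (iB iFa iFa0) (iZ c (iB ia ia0)).
by apply: eq_integrable => // s _; rewrite /=; congr EFin; ring.
Qed.

Let iindicator (h : R -> R) : mu.-integrable `[0, 1] (EFin \o h) ->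
  mu.-integrable `[0, 1] (EFin \o (fun s : R => (s <= x)%R%:R * h s)).
Proof.
move=> ih; have [/measurable_EFinP mh _] := integrableP _ _ _ ih.
apply: (@le_integrable _ _ _ mu _ (mD 1) _ _ _ _ ih).
  apply/measurable_EFinP; apply: measurable_funM => //.
  rewrite (_ : (fun s => _) = \1_(`]-oo, x]%classic : set R)); last first.
    by apply/funext => s; rewrite indicE; congr (_%:R); rewrite mem_setE in_itv.
  exact: measurable_indic.
move=> s _; rewrite /= lee_fin normrM ler_piMl//.
by case: (s <= x); rewrite ?normr1// normr0.
Qed.

Let flow_difference : J a0 != 0 ->
  J (fun s : R => ((s <= x)%R%:R - theta) * (a s - a0 s)) =
  \int[mu]_(s in `[0, x]) a s - theta * J a.
Proof.
move=> Ja0; have /andP[x0 x1] := x01.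
have -> : J (fun s : R => ((s <= x)%R%:R - theta) * (a s - a0 s)) =
    \int[mu]_(s in `[0, x]) (a s - a0 s) - theta * J (fun s => a s - a0 s).
  rewrite [X in _ = X - _]Rintegral_indicator; set th := (avg a0)^-1 * _.
  rewrite -(RintegralZl _ (mD 1)); last exact: iB.
  rewrite -RintegralB//.
  - by apply: eq_Rintegral => s _; ring.
  - by apply: iindicator; exact: iB.
  - by apply: iZ; exact: iB.
by rewrite !expand_difference// /avg; field.
Qed.

(** Expand the formula of the solution: the kernel collects the terms that are
linear in a - a0, and what remains is a product of two integrals of a - a0. *)
Lemma solution_difference : J a != 0 -> J a0 != 0 ->
  solution f b x - solution f b0 x =
  J (fun s => kernelG f b0 x s * (a s - a0 s)) +
  J (fun s => (F s - c) * (a s - a0 s)) *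
    (J (fun s : R => ((s <= x)%R%:R - theta) * (a s - a0 s)) / J a).
Proof.
move=> Ja Ja0; have /andP[x0 x1] := x01.
have -> : J (fun s => kernelG f b0 x s * (a s - a0 s)) =
    theta * J (fun s => (F s - c) * (a s - a0 s))
    - \int[mu]_(s in `[0, x]) ((F s - c) * (a s - a0 s)).
  rewrite [X in _ = _ - X]Rintegral_indicator; set th := (avg a0)^-1 * _.
  rewrite -(RintegralZl _ (mD 1))// -RintegralB//.
  - by apply: eq_Rintegral => s _; rewrite kernelGE -/th; ring.
  - exact: iZ.
  - exact: iindicator.
rewrite flow_difference// !expand_flux// /solution /avg.
by field; rewrite Ja.
Qed.

(** Far from degeneracy of the denominator the first term bounds the quotient;
otherwise the quotient is at most 1 and the second term is large. *)
Lemma flow_ratio_le (k : R) : 0 < k -> k <= J a0 -> 0 < J a ->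
  (forall s, s \in `[0, 1] -> 0 <= a s) -> (forall s, s \in `[0, 1] -> 0 <= a0 s) ->
  `|J (fun s : R => ((s <= x)%R%:R - theta) * (a s - a0 s)) / J a| <=
  2 / k * (`|J (fun s : R => ((s <= x)%R%:R - theta) * (a s - a0 s))| + `|J (fun s => a s - a0 s)|).
Proof.
move=> k0 kJ Ja apos a0pos; have /andP[x0 x1] := x01.
have Ja0 : 0 < J a0 by exact: lt_le_trans kJ.
have part (h : R -> R) : mu.-integrable `[0, 1] (EFin \o h) ->
    (forall s, s \in `[0, 1] -> 0 <= h s) -> 0 <= \int[mu]_(s in `[0, x]) h s <= J h.
  move=> ih h0; apply/andP; split.
    by apply: Rintegral_ge0 => s; rewrite /= in_itv/= => /andP[s0 sx];
      apply: h0; rewrite in_itv/= s0 (le_trans sx).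
  rewrite Rintegral_indicator; apply: le_Rintegral => //; first exact: iindicator.
  move=> s s01; have hs := h0 s s01.
  by rewrite ler_piMl//; case: (s <= x); rewrite ?ler01.
have /andP[r0 r1] := part _ ia apos; have /andP[t0 t1] := part _ ia0 a0pos.
have TE := flow_difference (lt0r_neq0 Ja0).
set T := J (fun s : R => _ * _) in TE *; rewrite (expand_difference (lexx 1)).
set th := (avg a0)^-1 * _ in TE.
have th01 : 0 <= th <= 1.
  by rewrite /th mulrC divr_ge0 ?ler_pdivrMr ?mul1r//= /avg ltW.
have T_le : `|T| <= J a.
  have /andP[h0 h1] := th01.
  have Ja' := ltW Ja.
  have : 0 <= th * J a <= J a by rewrite mulr_ge0//= ler_piMl.
  by move=> /andP[h2 h3]; rewrite TE ler_norml; apply/andP; split; lra.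
rewrite normrM normfV (ger0_norm (ltW Ja)).
have [kJa|Jak] := leP (k / 2) (J a).
  rewrite mulrDr -[leLHS]addr0 lerD//; last first.
    by rewrite mulr_ge0// divr_ge0// ltW.
  by rewrite mulrC ler_wpM2r// -[2 / k]invf_div lef_pV2// posrE divr_gt0.
apply: (@le_trans _ _ 1); first by rewrite ler_pdivrMr// mul1r.
have D_ge : k / 2 <= `|J a - J a0| by rewrite distrC (le_trans _ (ler_norm _))//; lra.
rewrite mulrDr (@le_trans _ _ (2 / k * `|J a - J a0|))//.
  by rewrite -ler_pdivrMl ?divr_gt0// mulr1 invf_div.
by rewrite lerDr mulr_ge0// divr_ge0// ltW.
Qed.

End solution_difference.

Section solution_fluctuation.
Context {d : measure_display} {T : measurableType d} {R : realType}.
Variables (A : R -> R -> T -> R) (Q : probability T R).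
Hypothesis hA : measurable_field A.
Variables nu1 nu2 : T -> R -> R.
Hypothesis hell : pathwise_elliptic A nu1 nu2.
Variables (c1 c2 : R).
Hypothesis hmean : mean_hypothesis A Q c1 c2.
Variable C6 : R.
Hypothesis hmom : sixth_moment_bound A Q C6.
Variable Gamma : R -> R.
Hypothesis hcov : cov_hypothesis A Q Gamma.
Variable f : R -> R.
Hypothesis hf : square_integrable01 f.
Variable x : R.
Hypothesis x01 : 0 <= x <= 1.
Local Notation mu := (@lebesgue_measure R).
Local Notation E := (mean Q).
Local Notation a0 := (meanA A Q).
Local Notation b0 := (A0 A Q).
Local Notation J h := (\int[mu]_(s in `[0, 1]) h s).
Local Notation V := (1 + `|C6|).

Let mD : measurable (`[0, 1]%classic : set (measurableTypeR R)).
Proof. exact: measurable_itv. Qed.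

(** Clamping the variable turns the kernel into a bounded function on the whole
line, which can serve as the weight of a scaled average. *)
Definition kernel (s : R) : R := kernelG f b0 x (clamp s).

Let c := avg (fun t => primitive f t / b0 t) / avg (fun t => (b0 t)^-1).
Let theta := (avg (fun t => (b0 t)^-1))^-1 * (\int[mu]_(t in `[0, x]) (b0 t)^-1).
Let indicator (s : R) : R := (clamp s <= x)%R%:R.

Let kernelE s : kernel s = (clamped_primitive f s - c) * (theta - indicator s).
Proof. exact: kernelGE. Qed.

Let measurable_indicator : measurable_fun setT indicator.
Proof.
have mc : measurable_fun setT (@clamp R).
  by apply: continuous_measurable_fun; exact: continuous_clamp.
rewrite (_ : indicator = \1_(`]-oo, x]%classic : set R) \o @clamp R).
  by apply: measurableT_comp => //; exact: measurable_indic.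
by apply/funext => s; rewrite /indicator/= indicE; congr (_%:R); rewrite mem_setE in_itv.
Qed.

Let indicator_le s : `|indicator s| <= 1.
Proof. by rewrite /indicator; case: (clamp s <= x); rewrite ?normr1// normr0. Qed.

Let measurable_primitive : measurable_fun setT (clamped_primitive f).
Proof. by apply: continuous_measurable_fun; exact: continuous_clamped_primitive. Qed.

Lemma measurable_kernel : measurable_fun setT kernel.
Proof.
rewrite (_ : kernel = fun s => (clamped_primitive f s - c) * (theta - indicator s)).
  by apply: measurable_funM; exact: measurable_funB.
by apply/funext => s; exact: kernelE.
Qed.

Lemma kernel_bounded : exists B, forall s, `|kernel s| <= B.
Proof.
have [B FB] := clamped_primitive_bounded hf.
exists ((B + `|c|) * (`|theta| + 1)) => s.
rewrite kernelE normrM ler_pM// (le_trans (ler_normB _ _))// lerD//.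
Qed.

Lemma continuous_kernel (t : R) : 0 < t < 1 -> t != x -> {for t, continuous kernel}.
Proof.
move=> /andP[t0 t1] tx.
have near01 : \forall s \near t, 0 < s < 1.
  have : open_nbhs t `]0, 1[%classic.
    by split; [exact: interval_open|rewrite /= in_itv/= t0 t1].
  by move/open_nbhs_nbhs; apply: filterS => s /=; rewrite in_itv.
have side : \forall s \near t, indicator t = indicator s.
  have : \forall s \near t, (s <= x) = (t <= x).
    have [lt_tx|lt_xt|/eqP] := ltgtP t x; last by rewrite (negbTE tx).
      have : open_nbhs t `]-oo, x[%classic.
        by split; [exact: interval_open|rewrite /= in_itv/= lt_tx].
      by move/open_nbhs_nbhs; apply: filterS => s /=; rewrite in_itv/= => /ltW ->.
    have : open_nbhs t `]x, +oo[%classic.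
      by split; [exact: interval_open|rewrite /= in_itv/= lt_xt].
    by move/open_nbhs_nbhs; apply: filterS => s /=; rewrite in_itv/= andbT leNgt => ->.
  move: near01; apply: filterS2 => s /andP[s0 s1] e.
  by rewrite /indicator !clamp_id ?e// !ltW.
change (kernel s @[s --> t] --> kernel t); rewrite [X in _ --> X]kernelE.
apply: (@cvg_trans _ ((clamped_primitive f s - c) * (theta - indicator t) @[s --> t])).
  by apply: near_eq_cvg; move: side; apply: filterS => s e; rewrite kernelE e.
have h1 : clamped_primitive f s - c @[s --> t] --> clamped_primitive f t - c.
  by apply: cvgB; [exact: continuous_clamped_primitive|exact: cvg_cst].
exact: (cvgM h1 (cvg_cst _)).
Qed.

Lemma L2_scaled_average (g : R -> R) (C eps : R) : measurable_fun setT g ->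
  (forall s, `|g s| <= C) -> 0 < eps -> L2 Q (scaled_average A Q g eps).
Proof.
move=> mg gC eps0; apply: L2Z.
have V0 : 0 <= V by rewrite addr_ge0.
pose Y (s : R) := fluct A Q s (s / eps).
have mY : measurable_fun setT (fun p : R * T => Y p.1 p.2).
  exact: (measurable_fluct_eps hA hell hmean).
have Ypath w := fluct_path hA hell hmean w eps0.
have Y4 s : L4 Q (Y s) by have [] := fluct_moments hA hmean hmom s (s / eps).
have YV s : E (fun w => Y s w ^+ 4) <= V ^+ 4.
  by have [] := fluct_moments hA hmean hmom s (s / eps).
by have [] := weighted_average_sqr mY Ypath Y4 V0 YV mg gC (@ltr01 R).
Qed.

Local Notation S g eps := (scaled_average A Q g eps).
Let flux (s : R) : R := clamped_primitive f s - c.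
Let flow (s : R) : R := indicator s - theta.
Let one (s : R) : R := 1.

Let measurable_flux : measurable_fun setT flux.
Proof. exact: measurable_funB. Qed.

Let measurable_flow : measurable_fun setT flow.
Proof. exact: measurable_funB. Qed.

Let flow_le s : `|flow s| <= 1 + `|theta|.
Proof. by rewrite (le_trans (ler_normB _ _))// lerD. Qed.

Let one_le s : `|one s| <= 1. Proof. by rewrite normr1. Qed.

Let invb0 s : (b0 s)^-1 = a0 s. Proof. by rewrite /A0 invrK. Qed.

Let a0_in (s : R) : `[0, 1]%classic s -> c1 <= a0 s <= c2.
Proof. by rewrite /= in_itv/= => s01; exact: (a0_bounds hA hmean). Qed.

Let c1_gt0 : 0 < c1. Proof. by have [] := hmean. Qed.

Let integrable_product (g h : R -> R) (B C : R) :
  measurable_fun (`[0, 1]%classic : set R) g -> measurable_fun (`[0, 1]%classic : set R) h ->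
  (forall s, `[0, 1]%classic s -> `|g s| <= B) ->
  (forall s, `[0, 1]%classic s -> `|h s| <= C) ->
  mu.-integrable `[0, 1] (EFin \o (fun s => g s * h s)).
Proof.
move=> mg mh gB hC; apply: (@integrable_bounded _ _ _ (B * C)) => //.
- exact: lebesgue_itv_lty.
- exact: measurable_funM.
- by move=> s s01; rewrite normrM ler_pM ?gB ?hC.
Qed.

Let primitive_clamped (s : R) : `[0, 1]%classic s -> clamped_primitive f s = primitive f s.
Proof. by rewrite /= in_itv/= => s01; rewrite /clamped_primitive clamp_id. Qed.

Let J_a0_ge : c1 <= J (fun s => (b0 s)^-1).
Proof.
rewrite -[c1]mulr1 -[X in c1 * X](subr0 1) -(fine_lebesgue_itv (@ler01 R)).
rewrite -(Rintegral_cst _ mD).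
apply: le_Rintegral => //.
- apply: (@integrable_bounded _ _ _ `|c1|) => //; exact: lebesgue_itv_lty.
- apply: (@integrable_bounded _ _ _ c2) => //; first exact: lebesgue_itv_lty.
    under [X in measurable_fun _ X]eq_fun do rewrite invb0.
    exact: (measurable_a0 hA hell hmean).
  move=> s /a0_in/andP[h1 h2]; rewrite invb0 ger0_norm//.
  by rewrite (le_trans _ h1)// ltW.
- by move=> s /a0_in/andP[h1 _]; rewrite invb0.
Qed.

Let path_facts (eps : R) (w : T) : 0 < eps ->
  exists B, [/\ measurable_fun (`[0, 1]%classic : set R) (fun s => (Aeps A eps s w)^-1),
    forall s, `[0, 1]%classic s -> B^-1 <= (Aeps A eps s w)^-1,
    0 < B & exists C, forall s, `[0, 1]%classic s -> `|(Aeps A eps s w)^-1| <= C].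
Proof.
move=> eps0; have z01 : (0 : R) \in `[0, 1] by rewrite in_itv/= lexx ler01.
have [n1 n2 n3] := hell w eps0 z01.
have pos s : `[0, 1]%classic s -> 0 < nu1 w eps /\ nu1 w eps <= Aeps A eps s w <= nu2 w eps.
  rewrite /= => s01; have s01' : s \in `[0, 1] by [].
  by have [h1 h2 h3] := hell w eps0 s01'; rewrite h2 h3.
exists (nu2 w eps); split.
- have mf : measurable_fun setT (fun s : R => fluct A Q s (s / eps) w).
    have m1 : measurable_fun setT (fun s : R => (s, w)) by apply: measurable_fun_pair.
    have mY : measurable_fun setT (fun p : R * T => fluct A Q p.1 (p.1 / eps) p.2).
      exact: (measurable_fluct_eps hA hell hmean).
    exact: (measurableT_comp mY m1).
  have := measurable_funD (measurable_funTS mf) (measurable_a0 hA hell hmean).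
  apply: eq_measurable_fun => s; rewrite inE /= in_itv/= => /[dup] s01 /andP[s0 _].
  by rewrite fluctE ?divr_ge0 ?(ltW eps0)// subrK.
- move=> s /pos[h1 /andP[h2 h3]].
  have hA0 : 0 < Aeps A eps s w by exact: lt_le_trans h2.
  by rewrite lef_pV2 ?posrE// (lt_le_trans hA0).
- by rewrite (lt_le_trans n1)// (le_trans n2).
exists (nu1 w eps)^-1 => s /pos[h1 /andP[h2 h3]].
have hA0 : 0 < Aeps A eps s w by exact: lt_le_trans h2.
by rewrite ger0_norm ?invr_ge0 ?(ltW hA0)// lef_pV2.
Qed.

Let solution_fluctuation_path (eps : R) (w : T) : 0 < eps ->
  let j := J (fun s => (b0 s)^-1) + Num.sqrt eps * S one eps w in
  let r := Num.sqrt eps * S flow eps w / j in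
  (solution f (fun s => Aeps A eps s w) x - solution f b0 x) / Num.sqrt eps =
    S kernel eps w + S flux eps w * r /\
  `|r| <= 2 / c1 * (Num.sqrt eps * (`|S flow eps w| + `|S one eps w|)).
Proof.
move=> eps0 j r; have seps : 0 < Num.sqrt eps by rewrite sqrtr_gt0.
have sepsN0 := lt0r_neq0 seps.
pose b s := Aeps A eps s w.
have [B0 FB] := clamped_primitive_bounded hf.
have [N [ma aN N0 [C aC]]] := path_facts w eps0.
have mF : measurable_fun (`[0, 1]%classic : set R) (primitive f).
  have : measurable_fun (`[0, 1]%classic : set R) (clamped_primitive f).
    exact: measurable_funTS.
  by apply: eq_measurable_fun => s /set_mem; exact: primitive_clamped.
have F_le s : `[0, 1]%classic s -> `|primitive f s| <= B0.
  by move=> s01; rewrite -primitive_clamped.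
have ma0 : measurable_fun (`[0, 1]%classic : set R) (fun s => (b0 s)^-1).
  under [X in measurable_fun _ X]eq_fun do rewrite invb0.
  exact: (measurable_a0 hA hell hmean).
have a0_le s : `[0, 1]%classic s -> `|(b0 s)^-1| <= c2.
  move=> /a0_in/andP[h1 h2]; rewrite invb0 ger0_norm//.
  by rewrite (le_trans _ h1)// ltW.
have ia : mu.-integrable `[0, 1] (EFin \o (fun s => (b s)^-1)).
  by apply: (@integrable_bounded _ _ _ C) => //; exact: lebesgue_itv_lty.
have ia0 : mu.-integrable `[0, 1] (EFin \o (fun s => (b0 s)^-1)).
  by apply: (@integrable_bounded _ _ _ c2) => //; exact: lebesgue_itv_lty.
have iFa : mu.-integrable `[0, 1] (EFin \o (fun s => primitive f s / b s)).
  exact: (integrable_product mF ma F_le aC).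
have iFa0 : mu.-integrable `[0, 1] (EFin \o (fun s => primitive f s / b0 s)).
  exact: (integrable_product mF ma0 F_le a0_le).
have SE (g h : R -> R) : (forall s, `[0, 1]%classic s -> g s = h s) ->
    J (fun s => g s * ((b s)^-1 - (b0 s)^-1)) = Num.sqrt eps * S h eps w.
  move=> gh; rewrite /scaled_average mulVKf//; apply: eq_Rintegral => s /set_mem s01.
  have s01' : 0 <= s <= 1 by move: s01; rewrite /= in_itv.
  have y0 : 0 <= s / eps by have /andP[s0 _] := s01'; rewrite divr_ge0// ltW.
  by rewrite gh// fluctE// invb0.
have jE : J (fun s => (b s)^-1) = j.
  rewrite /j -(SE (fun=> 1) one)//.
  under [X in _ = _ + X]eq_Rintegral do rewrite mul1r.
  by rewrite RintegralB// addrC subrK.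
have J0 : 0 < J (fun s => (b s)^-1).
  apply: (@lt_le_trans _ _ (N^-1 * fine (mu `[0, 1]))).
    by rewrite fine_lebesgue_itv// subr0 mulr1 invr_gt0.
  rewrite -(Rintegral_cst _ mD); apply: le_Rintegral => //.
  by apply: (@integrable_bounded _ _ _ `|N^-1|) => //; exact: lebesgue_itv_lty.
have J00 : 0 < J (fun s => (b0 s)^-1) by exact: lt_le_trans J_a0_ge.
have clampE s : `[0, 1]%classic s -> clamp s = s.
  by rewrite /= in_itv/=; exact: clamp_id.
have flowE : J (fun s : R => ((s <= x)%R%:R - theta) * ((b s)^-1 - (b0 s)^-1)) =
    Num.sqrt eps * S flow eps w.
  by apply: SE => s s01; rewrite /flow /indicator clampE.
have kernelJ : J (fun s => kernelG f b0 x s * ((b s)^-1 - (b0 s)^-1)) =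
    Num.sqrt eps * S kernel eps w.
  by apply: SE => s s01; rewrite /kernel clampE.
have fluxJ : J (fun s => (primitive f s - c) * ((b s)^-1 - (b0 s)^-1)) =
    Num.sqrt eps * S flux eps w.
  by apply: SE => s s01; rewrite /flux primitive_clamped.
have oneJ : J (fun s => (b s)^-1 - (b0 s)^-1) = Num.sqrt eps * S one eps w.
  by rewrite -(SE (fun=> 1) one)//; apply: eq_Rintegral => s _; rewrite mul1r.
have ratio := flow_ratio_le x01 ia ia0 c1_gt0 J_a0_ge J0.
have -> := solution_difference x01 ia ia0 iFa iFa0 (lt0r_neq0 J0) (lt0r_neq0 J00).
move: ratio; rewrite -/theta -/c flowE kernelJ fluxJ oneJ jE -/r => ratio; split.
  by rewrite -mulrA -mulrDr mulrAC mulfV// mul1r.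
have normS h : `|Num.sqrt eps * S h eps w| = Num.sqrt eps * `|S h eps w|.
  by rewrite normrM ger0_norm// ltW.
rewrite !normS -mulrDr in ratio; apply: ratio => s s01.
  by rewrite (le_trans _ (aN s s01))// invr_ge0 ltW.
have /andP[h1 _] := a0_in s01.
by rewrite invb0 (le_trans _ h1)// ltW.
Qed.

Let L2S (g : R -> R) (C eps : R) : measurable_fun setT g -> (forall s, `|g s| <= C) ->
  0 < eps -> L2 Q (S g eps).
Proof. exact: L2_scaled_average. Qed.

Let G : R := \int[mu]_q Gamma q.

Let G0 : 0 <= G.
Proof.
apply: Rintegral_ge0 => q _; have [_ h _] := hcov.
have z01 : (0 : R) \in `[0, 1] by rewrite in_itv/= lexx ler01.
exact: le_trans (h 0 0 q z01 z01).
Qed.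

Let S_norm (g : R -> R) (C eps : R) : measurable_fun setT g -> (forall s, `|g s| <= C) ->
  0 < eps -> 0 <= C * Num.sqrt G /\ E (fun w => S g eps w ^+ 2) <= (C * Num.sqrt G) ^+ 2.
Proof.
move=> mg gC eps0; split; first by rewrite mulr_ge0// (le_trans _ (gC 0)).
rewrite exprMn sqr_sqrtr//.
exact: (variance_scaled_average_le hA hell hmean hmom hcov mg gC eps0).
Qed.

(** The remainder in [solution_difference] is a product of two integrals of size
sqrt eps each, so that it is of size eps; Cauchy-Schwarz bounds its mean. *)
Lemma solution_fluctuation : exists K, forall eps, 0 < eps ->
  let X w := (solution f (fun s => Aeps A eps s w) x - solution f b0 x) / Num.sqrt eps in
  [/\ measurable_fun setT X, L1 Q (fun w => X w - S kernel eps w) &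
    E (fun w => `|X w - S kernel eps w|) <= K * Num.sqrt eps].
Proof.
have [Ck kC] := kernel_bounded.
have [B0 FB] := clamped_primitive_bounded hf.
pose CF := B0 + `|c|; pose CT := 1 + `|theta|.
have fluxC s : `|flux s| <= CF by rewrite (le_trans (ler_normB _ _))// lerD.
exists (2 / c1 * (CF * Num.sqrt G * (CT * Num.sqrt G) + CF * Num.sqrt G * (1 * Num.sqrt G))).
move=> eps eps0 X; have seps : 0 < Num.sqrt eps by rewrite sqrtr_gt0.
have mone : measurable_fun setT one by exact: measurable_cst.
have kS := L2S measurable_kernel kC eps0.
have FS := L2S measurable_flux fluxC eps0.
have TS := L2S measurable_flow flow_le eps0.
have OS := L2S mone one_le eps0.
have [nF0 nF] := S_norm measurable_flux fluxC eps0.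
have [nT0 nT] := S_norm measurable_flow flow_le eps0.
have [nO0 nO] := S_norm mone one_le eps0.
pose r w := Num.sqrt eps * S flow eps w /
  (J (fun s => (b0 s)^-1) + Num.sqrt eps * S one eps w).
have XE w : X w = S kernel eps w + S flux eps w * r w.
  by have [] := solution_fluctuation_path w eps0.
have r_le w : `|r w| <= 2 / c1 * (Num.sqrt eps * (`|S flow eps w| + `|S one eps w|)).
  by have [] := solution_fluctuation_path w eps0.
have mr : measurable_fun setT r.
  apply: measurable_funM; first by apply: measurable_funM => //; have [] := TS.
  apply: (measurableT_comp measurable_invr); apply: measurable_funD => //.
  by apply: measurable_funM => //; have [] := OS.
have mX : measurable_fun setT X.
  rewrite (_ : X = fun w => S kernel eps w + S flux eps w * r w); last exact/funext.
  apply: measurable_funD; first by have [] := kS.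
  by apply: measurable_funM => //; have [] := FS.
have dE w : X w - S kernel eps w = S flux eps w * r w by rewrite XE addrC addKr.
have FT := L1_norm (L2M FS TS); have FO := L1_norm (L2M FS OS).
pose bound w := 2 / c1 * Num.sqrt eps *
  (`|S flux eps w * S flow eps w| + `|S flux eps w * S one eps w|).
have ibound : L1 Q bound by apply: L1Z; exact: L1D.
have d_le w : `|X w - S kernel eps w| <= bound w.
  rewrite dE normrM (le_trans (ler_wpM2l _ (r_le w)))// /bound !normrM.
  by rewrite le_eqVlt; apply/orP; left; apply/eqP; ring.
have md : measurable_fun setT (fun w => X w - S kernel eps w).
  by apply: measurable_funB => //; have [] := kS.
have id : L1 Q (fun w => X w - S kernel eps w) by exact: L1_dominated md ibound d_le.
split=> //; apply: (le_trans (le_mean (L1_norm id) ibound d_le)).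
rewrite meanZ; last exact: L1D.
rewrite meanD// [leRHS]mulrAC ler_wpM2l//.
  by rewrite mulr_ge0 ?divr_ge0// ltW.
by rewrite lerD//; exact: mean_Cauchy_Schwarz_le.
Qed.

End solution_fluctuation.

(** * Characteristic function of the rescaled error *)

Section char_distance.
Context {d : measure_display} {T : measurableType d} {R : realType}.
Variable Q : probability T R.

Let mean_lipschitz (g : R -> R) (X Y : T -> R) (l : R) : 0 <= l ->
  (forall x y, `|g x - g y| <= `|x - y|) ->
  L1 Q (fun w => g (l * X w)) -> L1 Q (fun w => g (l * Y w)) ->
  L1 Q (fun w => X w - Y w) ->
  `|mean Q (fun w => g (l * X w)) - mean Q (fun w => g (l * Y w))| <=
  l * mean Q (fun w => `|X w - Y w|).
Proof.
move=> l0 lip iX iY id; rewrite -meanB//.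
apply: (le_trans (norm_mean (L1B iX iY))); rewrite -meanZ; last exact: L1_norm.
apply: le_mean; [by apply: L1_norm; exact: L1B|by apply: L1Z; exact: L1_norm|].
by move=> w; rewrite (le_trans (lip _ _))// -mulrBr normrM ger0_norm.
Qed.

Lemma char_distance (X Y : T -> R) (l : R) : 0 <= l ->
  measurable_fun setT X -> measurable_fun setT Y -> L1 Q (fun w => X w - Y w) ->
  `|mean Q (fun w => cos (l * X w)) - mean Q (fun w => cos (l * Y w))| <=
    l * mean Q (fun w => `|X w - Y w|) /\
  `|mean Q (fun w => sin (l * X w)) - mean Q (fun w => sin (l * Y w))| <=
    l * mean Q (fun w => `|X w - Y w|).
Proof.
move=> l0 mX mY id; split.
  apply: mean_lipschitz => //; try exact: L1_cos.
  apply: (@lipschitz_of_derivative R _ (fun x => - sin x)) => x.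
  by rewrite normrN norm_sin_le1.
apply: mean_lipschitz => //; try exact: L1_sin.
apply: (@lipschitz_of_derivative R _ cos) => x; exact: norm_cos_le1.
Qed.

Lemma second_moment_distance (X Y : T -> R) (s k : R) : L2 Q X -> L2 Q Y ->
  0 <= s -> 0 <= k -> mean Q (fun w => X w ^+ 2) <= s ^+ 2 ->
  mean Q (fun w => (Y w - X w) ^+ 2) <= k ^+ 2 ->
  `|mean Q (fun w => Y w ^+ 2) - mean Q (fun w => X w ^+ 2)| <= k * (2 * s + k).
Proof.
move=> X2 Y2 s0 k0 Xs Dk; have [_ iX] := X2; have [_ iY] := Y2.
have D2 : L2 Q (fun w => Y w - X w) by exact: L2B.
have [_ iD] := D2; have iDX := L2M D2 X2.
rewrite -meanB// (_ : (fun w => Y w ^+ 2 - X w ^+ 2) =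
  (fun w => 2 * ((Y w - X w) * X w) + (Y w - X w) ^+ 2)); last by apply/funext => w; ring.
rewrite meanD//; last exact: L1Z.
rewrite meanZ//; apply: (le_trans (ler_normD _ _)).
have h1 := le_trans (norm_mean iDX) (mean_Cauchy_Schwarz_le D2 X2 k0 s0 Dk Xs).
rewrite normrM ger0_norm// (@ger0_norm _ (mean Q (fun w => (Y w - X w) ^+ 2))); last first.
  by apply: mean_ge0 => w; exact: sqr_ge0.
by nra.
Qed.

End char_distance.

Lemma cvg_perturbed {R : realType} (a b k : nat -> R) (c L : R) :
  (forall n, `|a n - b n| <= c * k n) -> k n @[n --> \oo] --> 0 ->
  b n @[n --> \oo] --> L -> a n @[n --> \oo] --> L.
Proof.
move=> ab k0 bL.
have ck : c * k n @[n --> \oo] --> 0 by rewrite -(mulr0 c); apply: cvgMr.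
have ab0 : a n - b n @[n --> \oo] --> 0.
  apply/cvgrPdist_lt => e e0; move/cvgrPdist_lt: ck => /(_ _ e0).
  apply: filterS => n; rewrite !sub0r !normrN => h; apply: le_lt_trans h.
  exact: le_trans (ab n) (ler_norm _).
have -> : a = fun n => (a n - b n) + b n by apply/funext => n; rewrite subrK.
by rewrite -[L]add0r; apply: cvgD.
Qed.

Section char_solution.
Context {d : measure_display} {T : measurableType d} {R : realType}.
Variables (A : R -> R -> T -> R) (Q : probability T R).
Hypothesis hA : measurable_field A.
Variables nu1 nu2 : T -> R -> R.
Hypothesis hell : pathwise_elliptic A nu1 nu2.
Variables (c1 c2 : R).
Hypothesis hmean : mean_hypothesis A Q c1 c2.
Variable C6 : R.
Hypothesis hmom : sixth_moment_bound A Q C6.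
Variable Gamma : R -> R.
Hypothesis hcov : cov_hypothesis A Q Gamma.
Hypothesis hcont : cov_continuous_diag A Q.
Hypothesis hmix : mixing A Q.
Variable f : R -> R.
Hypothesis hf : square_integrable01 f.
Variable x : R.
Hypothesis x01 : 0 <= x <= 1.
Local Notation mu := (@lebesgue_measure R).
Local Notation E := (mean Q).
Local Notation V := (1 + `|C6|).
Local Notation g := (kernel A Q f x).
Local Notation S := (scaled_average A Q g).

Let G : R := \int[mu]_q Gamma q.

Let G0 : 0 <= G.
Proof.
apply: Rintegral_ge0 => q _; have [_ h _] := hcov.
have z01 : (0 : R) \in `[0, 1] by rewrite in_itv/= lexx ler01.
exact: le_trans (h 0 0 q z01 z01).
Qed.

Let X (eps : R) (w : T) : R :=
  (solution f (fun s => Aeps A eps s w) x - solution f (A0 A Q) x) / Num.sqrt eps.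

Let mg : measurable_fun setT g. Proof. exact: measurable_kernel. Qed.

Variable u : nat -> R.
Hypothesis u0 : forall n, 0 < u n.
Hypothesis u1 : forall n, u n <= 1.
Hypothesis u_0 : u n @[n --> \oo] --> 0.

Let scale : exists k : nat -> R,
  [/\ forall n, 0 < k n, forall n, k n <= 1, forall n, k n ^+ 10 = u n &
      k n @[n --> \oo] --> 0].
Proof.
exists (fun n => u n `^ 10^-1); have pow n : (u n `^ 10^-1) ^+ 10 = u n.
  by rewrite -powR_mulrn ?powR_ge0// -powRrM mulVf// powRr1// ltW.
split => //.
- by move=> n; rewrite powR_gt0.
- by move=> n; rewrite -(@ler_pXn2r _ 10)// ?nnegrE ?powR_ge0// pow expr1n.
apply/cvgrPdist_lt => e e0; move/cvgrPdist_lt: u_0 => /(_ (e ^+ 10) (exprn_gt0 _ e0)).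
apply: filterS => n; rewrite !sub0r !normrN !ger0_norm ?powR_ge0 ?(ltW (u0 n))// => h.
by rewrite -(@ltr_pXn2r _ 10)// ?nnegrE ?powR_ge0 ?(ltW e0)// pow.
Qed.

Definition limit_variance : R := \int[mu]_(t in `[0, 1]) (g t ^+ 2 * lag_integral A Q t).

(** Three approximations are chained: the rescaled error by a scaled average, that
average by the sum S of blocks, and the law of S by a Gaussian law. *)
Lemma cvg_char_solution (l : R) : 0 <= l ->
  E (fun w => cos (l * X (u n) w)) @[n --> \oo] --> expR (- (limit_variance * l ^+ 2 / 2)) /\
  E (fun w => sin (l * X (u n) w)) @[n --> \oo] --> 0.
Proof.
move=> l0.
have [phi [phi0 _ phidec iphi mix]] := hmix.
have [I3 I30 decay] := decay_of_integrable_root phi0 phidec iphi.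
have [C gC] := kernel_bounded A Q hf x.
have C0 : 0 <= C by exact: le_trans (gC 0).
have [K XS] := solution_fluctuation hA hell hmean hmom hcov hf x01.
have [k [k0 k1 ku k_0]] := scale.
pose s := C * Num.sqrt G; have s0 : 0 <= s by rewrite mulr_ge0.
have S2 n : L2 Q (S (u n)) by exact: (L2_scaled_average hA hell hmean hmom mg gC).
have Ss n : E (fun w => S (u n) w ^+ 2) <= s ^+ 2.
  rewrite exprMn sqr_sqrtr//.
  exact: (variance_scaled_average_le hA hell hmean hmom hcov mg gC).
pose D := 2 * (C * V) * I3 ^+ 3 + l * ((C * V) ^+ 2 * (16 * (126 + 9 * I3 ^+ 3)))
         + 72 * l ^+ 2 * (C * V) ^+ 3
         + l * (2 * (C * V) * I3 ^+ 3 * (s + 1 + 6 * (C * V))).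
have /choice[Z ZP] : forall n, exists Z : T -> R, [/\ L2 Q Z,
    E (fun w => (Z w - S (u n) w) ^+ 2) <= k n ^+ 2 &
    gaussian_char_defect Q Z (E (fun w => Z w ^+ 2)) (k n * D) l].
  move=> n; have := @char_scaled_average _ _ _ A Q hA _ _ hell _ _ hmean _ hmom g C mg gC
    phi phi0 phidec mix I3 I30 decay (k n) s (k0 n) (k1 n) s0.
  by rewrite ku => /(_ (S2 n) (Ss n))[Z [h1 h2 h3]]; exists Z; split=> //; exact: h3.
pose v n := E (fun w => Z n w ^+ 2).
have v_cvg : v n @[n --> \oo] --> limit_variance.
  apply: (@cvg_perturbed _ _ (fun n => E (fun w => S (u n) w ^+ 2)) k (2 * s + 1)) => //.
    move=> n; have [Z2 Zk _] := ZP n.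
    apply: (le_trans (second_moment_distance (S2 n) Z2 s0 (ltW (k0 n)) (Ss n) Zk)).
    by rewrite mulrC ler_wpM2r ?lerD2l// ltW.
  apply: (cvg_variance_scaled_average (x := x) hA hell hmean hmom hcov hcont mg gC u0 u_0).
  by move=> t t01 tx; exact: (continuous_kernel hf t01 tx).
have gauss_cvg : expR (- (v n * l ^+ 2 / 2)) @[n --> \oo] --> expR (- (limit_variance * l ^+ 2 / 2)).
  apply: continuous_cvg; first exact: continuous_expR.
  apply: cvgN; apply: cvgM; last exact: cvg_cst.
  by apply: cvgM => //; exact: cvg_cst.
have sqrt_le n : Num.sqrt (u n) <= k n.
  rewrite -ku (_ : k n ^+ 10 = (k n ^+ 5) ^+ 2); last by rewrite -exprM.
  rewrite sqrtr_sqr ger0_norm ?exprn_ge0 ?(ltW (k0 n))// exprS ler_piMr ?(ltW (k0 n))//.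
  by rewrite exprn_ile1// ltW.
have close n : [/\ measurable_fun setT (X (u n)), L1 Q (fun w => X (u n) w - Z n w) &
    E (fun w => `|X (u n) w - Z n w|) <= (`|K| + 1) * k n].
  have [mX id dK] := XS _ (u0 n); have [Z2 Zk _] := ZP n.
  have SZ2 : L2 Q (fun w => S (u n) w - Z n w) by exact: L2B.
  have SZk : E (fun w => `|S (u n) w - Z n w|) <= k n.
    apply: mean_norm_le_L2 => //; first exact: ltW.
    by under eq_fun do rewrite -sqrrN opprB.
  have iSZ := L2_L1 SZ2.
  have e : (fun w => X (u n) w - Z n w) =
      (fun w => (X (u n) w - S (u n) w) + (S (u n) w - Z n w)).
    by apply/funext => w; rewrite addrA subrK.
  have iXZ : L1 Q (fun w => X (u n) w - Z n w) by rewrite e; exact: L1D.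
  split => //.
  apply: (@le_trans _ _ (E (fun w => `|X (u n) w - S (u n) w| + `|S (u n) w - Z n w|))).
    apply: le_mean; [exact: L1_norm|by apply: L1D; exact: L1_norm|move=> w].
    by rewrite (_ : _ - _ = (X (u n) w - S (u n) w) + (S (u n) w - Z n w)) ?ler_normD// addrA subrK.
  rewrite meanD; [|exact: L1_norm|exact: L1_norm].
  rewrite mulrDl mul1r lerD//; apply: (le_trans dK).
  apply: (@le_trans _ _ (`|K| * Num.sqrt (u n))); first by rewrite ler_wpM2r// ler_norm.
  by rewrite ler_wpM2l.
have step n : `|E (fun w => cos (l * X (u n) w)) - expR (- (v n * l ^+ 2 / 2))| <=
      l * (`|K| + 1 + D) * k n /\
    `|E (fun w => sin (l * X (u n) w)) - 0| <= l * (`|K| + 1 + D) * k n.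
  have [mX iXZ XZ] := close n; have [Z2 _ [gc gs]] := ZP n.
  have [dc ds] := char_distance l0 mX (L1_measurable (L2_L1 Z2)) iXZ.
  have XZl := ler_wpM2l l0 XZ.
  have sumE : l * ((`|K| + 1) * k n) + l * (k n * D) = l * (`|K| + 1 + D) * k n by ring.
  split; rewrite -sumE.
    apply: (le_trans (ler_distD (E (fun w => cos (l * Z n w))) _ _)).
    by apply: lerD => //; exact: le_trans XZl.
  apply: (le_trans (ler_distD (E (fun w => sin (l * Z n w))) _ _)).
  by apply: lerD; [exact: le_trans XZl|rewrite subr0].
split; first exact: (cvg_perturbed (fun n => (step n).1) k_0 gauss_cvg).
exact: (cvg_perturbed (fun n => (step n).2) k_0 (cvg_cst 0)).
Qed.

Lemma solution_first_moment : exists K, forall n,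
  L1 Q (X (u n)) /\ E (fun w => `|X (u n) w|) <= K.
Proof.
have [C gC] := kernel_bounded A Q hf x.
have C0 : 0 <= C by exact: le_trans (gC 0).
have [K XS] := solution_fluctuation hA hell hmean hmom hcov hf x01.
exists (`|K| + C * Num.sqrt G) => n.
have [mX id dK] := XS _ (u0 n).
have S2 : L2 Q (S (u n)) by exact: (L2_scaled_average hA hell hmean hmom mg gC).
have iS := L2_L1 S2.
have S_le : E (fun w => `|S (u n) w|) <= C * Num.sqrt G.
  apply: mean_norm_le_L2 => //; first exact: mulr_ge0.
  rewrite exprMn sqr_sqrtr//.
  exact: (variance_scaled_average_le hA hell hmean hmom hcov mg gC).
have e w : X (u n) w = (X (u n) w - S (u n) w) + S (u n) w by rewrite subrK.
have iX : L1 Q (X (u n)).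
  by rewrite (_ : X (u n) = fun w => (X (u n) w - S (u n) w) + S (u n) w);
    [exact: L1D|exact/funext].
split=> //; have in1 := L1_norm id; have in2 := L1_norm iS.
apply: (le_trans (le_mean (L1_norm iX) (L1D in1 in2) _)).
  by move=> w; rewrite [in leLHS]e ler_normD.
rewrite meanD// lerD//; apply: (le_trans dK).
apply: (@le_trans _ _ (`|K| * Num.sqrt (u n))); first by rewrite ler_wpM2r// ler_norm.
by rewrite ler_piMr// -[leRHS]sqrtr1 ler_wsqrtr.
Qed.

End char_solution.

(** * The normal law *)

Section layers.
Context {R : realType}.

(** Layer cake: the sum counts the positive multiples of 1 / n up to y. *)
Lemma layer_average (n : nat) (y : R) : (0 < n)%N -> 0 <= y <= 1 ->
  `|y - n%:R^-1 * \sum_(0 <= j < n) (j.+1%:R <= n%:R * y)%R%:R| <= n%:R^-1.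
Proof.
move=> n0 /andP[y0 y1]; have np : 0 < n%:R :> R by rewrite ltr0n.
set t := Num.trunc (n%:R * y).
have ny0 : 0 <= n%:R * y by rewrite mulr_ge0.
have tn : (t <= n)%N.
  rewrite truncn_le_nat (@le_lt_trans _ _ n%:R) ?ltr_nat//.
  by rewrite -[leRHS]mulr1 ler_wpM2l.
have -> : \sum_(0 <= j < n) (j.+1%:R <= n%:R * y)%R%:R = t%:R :> R.
  have -> : t = (\sum_(0 <= j < n) (j < t))%N.
    elim: n t tn {ny0 np n0} => [|n IH] t; first by rewrite leqn0 => /eqP ->; rewrite big_nil.
    rewrite leq_eqVlt big_nat_recr//= => /predU1P[->|]; last first.
      by rewrite ltnS => tn; rewrite [LHS](IH t tn) [(n < t)%N]ltnNge tn addn0.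
    rewrite ltnSn (eq_big_nat _ _ (F2 := fun=> 1%N)); last by move=> j /andP[_ jn]; rewrite ltnS (ltnW jn).
    by rewrite sum_nat_const_nat subn0 muln1 addn1.
  by rewrite natr_sum; apply: eq_bigr => j _; rewrite truncn_gt_nat.
have t_le : t%:R <= n%:R * y by rewrite truncn_le.
have t_gt : n%:R * y < t.+1%:R by rewrite truncnS_gt.
rewrite ler_norml; apply/andP; split.
  rewrite -(ler_pM2l np) mulrBr mulrN mulrA mulfV ?gt_eqF// mul1r; lra.
rewrite -(ler_pM2l np) mulrBr mulrA mulfV ?gt_eqF// mul1r.
by move: t_gt; rewrite -natr1; lra.
Qed.

Section two_spaces.
Context {d d' : measure_display} {T : measurableType d} {T' : measurableType d'}.
Variables (m : {measure set T -> \bar R}) (m' : {measure set T' -> \bar R}).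
Variables (X D : T -> R) (X' D' : T' -> R).
Hypothesis iX : m.-integrable setT (EFin \o X).
Hypothesis iX' : m'.-integrable setT (EFin \o X').
Hypothesis mD : measurable_fun setT D.
Hypothesis mD' : measurable_fun setT D'.
Hypothesis agree : forall B : set R, measurable B ->
  \int[m]_w (X w * \1_B (D w)) = \int[m']_w (X' w * \1_B (D' w)).

Let iM d0 (S : measurableType d0) (n : {measure set S -> \bar R}) (Y H : S -> R) (M : R) :
  n.-integrable setT (EFin \o Y) -> measurable_fun setT H -> (forall w, `|H w| <= M) ->
  n.-integrable setT (EFin \o (fun w => Y w * H w)).
Proof.
move=> iY mH HM; have mY : measurable_fun setT Y.
  by apply/measurable_EFinP; exact: measurable_int iY.
have iMY := @integrableZr _ _ _ n _ measurableT M _ iY.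
apply: (@le_integrable _ _ _ n _ measurableT _ _ _ _ iMY).
  by apply/measurable_EFinP; exact: measurable_funM.
move=> w _; rewrite /= lee_fin !normrM ler_wpM2l//.
by rewrite (le_trans (HM w))// ler_norm.
Qed.

Let agree01 (psi : R -> R) : measurable_fun setT psi -> (forall y, 0 <= psi y <= 1) ->
  \int[m]_w (X w * psi (D w)) = \int[m']_w (X' w * psi (D' w)).
Proof.
move=> mpsi psi01.
pose B (n j : nat) : set R := [set y | j.+1%:R <= n%:R * psi y].
have mB n j : measurable (B n j).
  rewrite (_ : B n j = (fun y => n%:R * psi y) @^-1` `[j.+1%:R, +oo[); last first.
    by apply/seteqP; split=> y; rewrite /B/= in_itv/= andbT.
  by rewrite -[X in measurable X]setTI; apply: (measurable_funM _ mpsi) => //.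
pose phi n y := n%:R^-1 * \sum_(0 <= j < n) (\1_(B n j) y : R).
have psi_phi n y : (0 < n)%N -> `|psi y - phi n y| <= n%:R^-1.
  move=> n0; have := layer_average n0 (psi01 y).
  rewrite /phi (eq_bigr (fun j => \1_(B n j) y))// => j _.
  rewrite indicE; congr ((nat_of_bool _)%:R).
  by apply/idP/idP => h; [exact/mem_set|exact: set_mem].
have mphi n : measurable_fun setT (phi n).
  by apply: measurable_funM => //; apply: measurable_sum => j; exact: measurable_indic.
have close d0 (S : measurableType d0) (mm : {measure set S -> \bar R}) (Y H : S -> R) :
    mm.-integrable setT (EFin \o Y) -> measurable_fun setT H ->
    forall n, (0 < n)%N ->
    `|\int[mm]_w (Y w * psi (H w))
      - n%:R^-1 * \sum_(0 <= j < n) \int[mm]_w (Y w * \1_(B n j) (H w))|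
    <= n%:R^-1 * \int[mm]_w `|Y w|.
  move=> iY mH n n0.
  have iYB j : mm.-integrable setT (EFin \o (fun w => Y w * \1_(B n j) (H w))).
    apply: (iM (M := 1) iY); first by apply: measurableT_comp => //; exact: measurable_indic.
    by move=> w; rewrite indicE; case: (_ \in _); rewrite ?normr1// normr0.
  have iYpsi : mm.-integrable setT (EFin \o (fun w => Y w * psi (H w))).
    apply: (iM (M := 1) iY); first exact: measurableT_comp.
    by move=> w; have /andP[h1 h2] := psi01 (H w); rewrite ger0_norm.
  have iYphi : mm.-integrable setT (EFin \o (fun w => Y w * phi n (H w))).
    apply: (iM (M := 1 + n%:R^-1) iY); first exact: measurableT_comp.
    move=> w; have /andP[h1 h2] := psi01 (H w); have := psi_phi n (H w) n0.
    rewrite distrC => h3; have := ler_normD (phi n (H w) - psi (H w)) (psi (H w)).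
    by rewrite subrK (ger0_norm h1); move: h2 h3; lra.
  have -> : n%:R^-1 * \sum_(0 <= j < n) \int[mm]_w (Y w * \1_(B n j) (H w)) =
      \int[mm]_w (Y w * phi n (H w)).
    have sumI (r : seq nat) : mm.-integrable setT
          (EFin \o (fun w => \sum_(j <- r) Y w * \1_(B n j) (H w))) /\
        \int[mm]_w (\sum_(j <- r) Y w * \1_(B n j) (H w)) =
        \sum_(j <- r) \int[mm]_w (Y w * \1_(B n j) (H w)).
      elim: r => [|j r [ir IH]].
        split; last by rewrite big_nil; under eq_Rintegral do rewrite big_nil; rewrite Rintegral_cst// mul0r.
        under [X in mm.-integrable _ (EFin \o X)]eq_fun do rewrite big_nil.
        exact: integrable0.
      split; last first.
        by under eq_Rintegral do rewrite big_cons; rewrite RintegralD// big_cons IH.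
      under [X in mm.-integrable _ (EFin \o X)]eq_fun do rewrite big_cons.
      by have := integrableD measurableT (iYB j) ir.
    have [i1 <-] := sumI (index_iota 0 n); rewrite -RintegralZl//.
    by apply: eq_Rintegral => w _; rewrite /phi [RHS]mulrCA [in RHS]mulr_sumr.
  rewrite -RintegralB//.
  have iD : mm.-integrable setT (EFin \o (fun w => Y w * psi (H w) - Y w * phi n (H w))).
    by have := integrableB measurableT iYpsi iYphi.
  apply: (le_trans (le_normr_Rintegral measurableT iD)).
  have iYn : mm.-integrable setT (EFin \o (fun w => `|Y w|)) by exact: integrable_norm.
  rewrite -RintegralZl//; apply: le_Rintegral => //; first exact: integrable_norm.
    by have := @integrableZl _ _ _ mm _ measurableT n%:R^-1 _ iYn.
  by move=> w _; rewrite -mulrBr normrM mulrC ler_wpM2r// psi_phi.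
apply/eqP; rewrite -subr_eq0 -normr_le0; apply/ler_addgt0Pl => e e0; rewrite addr0.
pose L := \int[m]_w `|X w| + \int[m']_w `|X' w|.
pose n := (Num.trunc (L / e)).+1; have np : 0 < n%:R :> R by rewrite ltr0n.
have Ln : n%:R^-1 * L <= e.
  rewrite ler_pdivrMl// -ler_pdivrMr//; apply: ltW; exact: truncnS_gt.
apply: le_trans Ln; rewrite /L mulrDr.
have h1 := close _ _ _ _ _ iX mD n isT; have h2 := close _ _ _ _ _ iX' mD' n isT.
apply: le_trans (lerD h1 h2); rewrite (eq_bigr _ (fun j _ => agree (mB n j))).
rewrite [X in _ <= _ + X]distrC; apply: le_trans (ler_normD _ _).
by rewrite addrA subrK.
Qed.

(** After an affine change psi has values in [0, 1]; by [layer_average] it is then a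
uniform limit of averages of indicators. *)
Lemma Rintegral_agree (psi : R -> R) (M : R) : measurable_fun setT psi ->
  (forall y, `|psi y| <= M) ->
  \int[m]_w (X w * psi (D w)) = \int[m']_w (X' w * psi (D' w)).
Proof.
move=> mpsi psiM.
have M0 : 0 <= M by exact: le_trans (psiM 0).
pose c := 2 * M + 1; have c0 : 0 < c by rewrite ltr_wpDl// mulr_ge0.
have total : \int[m]_w X w = \int[m']_w X' w.
  have := agree measurableT.
  under eq_Rintegral do rewrite indicE mem_set// mulr1.
  by under [X in _ = X -> _]eq_Rintegral do rewrite indicE mem_set// mulr1.
have h01 y : 0 <= (psi y + M) / c <= 1.
  have := psiM y; rewrite ler_norml => /andP[h1 h2].
  rewrite divr_ge0 ?(ltW c0)//=; last by rewrite -lerBlDr sub0r.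
  by rewrite ler_pdivrMr// mul1r /c; lra.
have mh : measurable_fun setT (fun y => (psi y + M) / c).
  by apply: measurable_funM => //; exact: measurable_funD.
have affine d0 (S : measurableType d0) (mm : {measure set S -> \bar R}) (Y H : S -> R) :
    mm.-integrable setT (EFin \o Y) -> measurable_fun setT H ->
    \int[mm]_w (Y w * psi (H w)) =
    c * \int[mm]_w (Y w * ((psi (H w) + M) / c)) - M * \int[mm]_w Y w.
  move=> iY mH.
  have i1 : mm.-integrable setT (EFin \o (fun w => Y w * ((psi (H w) + M) / c))).
    apply: (iM (M := 1) iY); first exact: (measurableT_comp mh mH).
    by move=> w; have /andP[k1 k2] := h01 (H w); rewrite ger0_norm.
  rewrite -!RintegralZl// -RintegralB//.
  - by apply: eq_Rintegral => w _; field; exact: lt0r_neq0.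
  - by have := @integrableZl _ _ _ mm _ measurableT c _ i1.
  - by have := @integrableZl _ _ _ mm _ measurableT M _ iY.
by rewrite (affine _ _ _ _ _ iX mD) (affine _ _ _ _ _ iX' mD') total (agree01 mh h01).
Qed.

End two_spaces.
End layers.

Section fatou.
Context {d : measure_display} {T : measurableType d} {R : realType}.
Variable Q : probability T R.

(** Fatou's lemma. *)
Lemma mean_le_of_limit (X : nat -> T -> R) (Y : T -> R) (K : R) :
  (forall n, L1 Q (X n)) -> (forall n w, 0 <= X n w) -> (forall n, mean Q (X n) <= K) ->
  measurable_fun setT Y -> (forall w, X n w @[n --> \oo] --> Y w) ->
  L1 Q Y /\ mean Q Y <= K.
Proof.
move=> iX X0 XK mY XY.
have Y0 w : 0 <= Y w.
  rewrite -(cvg_lim (@Rhausdorff R) (XY w)); apply: limr_ge; first exact: cvgP (XY w).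
  exact: nearW.
have mX n : measurable_fun setT (EFin \o X n) by exact: measurable_int (iX n).
have EXn n : (\int[Q]_w (X n w)%:E = (mean Q (X n))%:E)%E.
  by rewrite /mean /Rintegral fineK//; exact: (integrable_fin_num _ (iX n)).
have := @fatou _ _ _ Q setT measurableT (fun n => EFin \o X n) mX
  (fun n w _ => X0 n w).
rewrite (eq_integral (EFin \o Y)); last first.
  move=> w _; have h : (X n w)%:E @[n --> \oo] --> (Y w)%:E.
    by apply: cvg_EFin; [exact: nearW|exact: XY].
  by rewrite is_cvg_limn_einfE; [exact/cvg_lim|exact: cvgP h].
have lim_le : (limn_einf (fun n => \int[Q]_w (EFin \o X n) w) <= K%:E)%E.
  rewrite limn_einf_lim; apply: lime_le; first exact: is_cvg_einfs.
  apply: nearW => n; apply: (@le_trans _ _ (\int[Q]_w (X n w)%:E)%E).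
    by apply: ereal_inf_lbound; exists n => //=.
  by rewrite EXn lee_fin.
move=> /le_trans /(_ lim_le) => EY.
have iY : L1 Q Y.
  apply/integrableP; split; first exact/measurable_EFinP.
  under eq_integral do rewrite /= ger0_norm//.
  by apply: (le_lt_trans EY); rewrite ltry.
split=> //; rewrite -lee_fin /mean /Rintegral fineK//; exact: integrable_fin_num.
Qed.

End fatou.

Section normal_law.
Context {d : measure_display} {T : measurableType d} {R : realType}.
Variables (P : probability T R) (D : T -> R) (h : R).
Hypothesis mD : measurable_fun setT D.
Hypothesis h0 : 0 < h.
Hypothesis lawD : forall B : set R, measurable B ->
  P [set w | B (D w)] = normal_prob 0 (Num.sqrt h) B.
Local Notation mu := (@lebesgue_measure R).
Local Notation E := (mean P).

Let p := normal_pdf 0 (Num.sqrt h) : R -> R.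

Let mp : measurable_fun setT p. Proof. exact: measurable_normal_pdf. Qed.

Let ip : mu.-integrable setT (EFin \o p).
Proof. exact: integrable_normal_pdf. Qed.

Let mean_density (psi : R -> R) (M : R) : measurable_fun setT psi ->
  (forall x, `|psi x| <= M) -> E (fun w => psi (D w)) = \int[mu]_x (p x * psi x).
Proof.
move=> mpsi psiM.
have -> : (fun w => psi (D w)) = (fun w => 1 * psi (D w)) by apply/funext => w; rewrite mul1r.
apply: (@Rintegral_agree _ _ _ T _ P mu (fun=> 1) D p id (L1_cst P 1) ip mD _ _ psi M mpsi psiM) => //.
move=> B mB; have mDB : measurable [set w | B (D w)].
  by rewrite -[X in measurable X]setTI; exact: mD.
under eq_Rintegral do rewrite mul1r.
transitivity (fine (P [set w | B (D w)])).
  by rewrite /Rintegral (integral_indic _ _ mDB)// setIT.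
rewrite lawD// /normal_prob /Rintegral [X in fine X = _]integral_mkcond; congr fine.
apply: eq_integral => x _; rewrite /patch indicE; case: ifPn => _; rewrite ?mulr1// mulr0//.
Qed.

Let window_ind (n : nat) : R -> R := \1_(`[- n.+1%:R, n.+1%:R]%classic : set R).

Let mean_truncated (q : R -> R) (c : R) (n : nat) : continuous q ->
  (forall x, `|q x| <= c * (1 + x ^+ 2)) ->
  E (fun w => q (D w) * window_ind n (D w)) =
  \int[mu]_(x in `[- n.+1%:R, n.+1%:R]) (q x * p x).
Proof.
move=> cq qc; have mq : measurable_fun setT q by exact: continuous_measurable_fun.
have mw : measurable_fun setT (window_ind n) by exact: measurable_indic.
have c0 : 0 <= c by have := qc 0; rewrite expr0n/= addr0 mulr1; exact: le_trans.
rewrite (@mean_density (fun x => q x * window_ind n x) (c * (1 + n.+1%:R ^+ 2))).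
- rewrite [RHS]Rintegral_mkcond; apply: eq_Rintegral => x _.
  rewrite /patch /window_ind indicE; case: ifPn => _; rewrite ?mulr1 ?mulr0//.
  by rewrite mulrC.
- exact: measurable_funM.
move=> x; rewrite /window_ind indicE; case: (boolP (x \in _)) => [/set_mem|_]; last first.
  by rewrite mulr0 normr0 mulr_ge0// addr_ge0// sqr_ge0.
rewrite /= in_itv/= mulr1 -ler_norml => xn; apply: (le_trans (qc x)).
rewrite ler_wpM2l// lerD2l -(real_normK (num_real x)) lerXn2r// nnegrE//.
Qed.

Let sd0 : Num.sqrt h != 0. Proof. by rewrite gt_eqF// sqrtr_gt0. Qed.

Let peak := normal_peak (Num.sqrt h).

Let pE x : p x = peak * expR (- (x ^+ 2 / (2 * h))).
Proof.
rewrite /p normal_pdfE// /normal_fun subr0 sqr_sqrtr ?(ltW h0)//; congr (_ * expR _).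
by rewrite mulNr -[h *+ 2]mulr_natl.
Qed.

Let dp (x : R) : is_derive x 1 p (- (x / h) * p x).
Proof.
rewrite (_ : p = fun x => peak * expR (- (2 * h)^-1 * x ^+ 2)); last first.
  by apply/funext => y; rewrite pE; congr (_ * expR _); rewrite mulNr mulrC.
have dq : is_derive x 1 (fun y : R => - (2 * h)^-1 * y ^+ 2) (- (x / h)).
  rewrite (_ : (fun _ => _) = cst (- (2 * h)^-1) * (id * id)); last first.
    by apply/funext => y; rewrite expr2.
  have := @is_deriveM R R^o _ _ x 1 _ _ (is_derive_cst (- (2 * h)^-1) x 1)
    (@is_deriveM R R^o id id x 1 _ _ (is_derive_id _ _) (is_derive_id _ _)).
  move=> H; apply: is_derive_eq H _; rewrite /= /GRing.scale /=.
  by field; exact: lt0r_neq0.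
have dE := @is_derive1_comp R expR _ x _ _ (is_derive_expR _) dq.
have := @is_deriveM R R^o _ _ x 1 _ _ (is_derive_cst peak x 1) dE.
by move=> H; apply: is_derive_eq H _; rewrite /= /GRing.scale /=; ring.
Qed.

Let peak0 : 0 <= peak. Proof. exact: normal_peak_ge0. Qed.

Let p_even n : p (- n) = p n. Proof. by rewrite !pE sqrrN. Qed.

Let p_ge0 n : 0 <= p n. Proof. exact: normal_pdf_ge0. Qed.

Let p_tail (x : R) : 0 < x -> p x * x <= 2 * h * peak / x.
Proof.
move=> x0; pose s := x ^+ 2 / (2 * h).
have key : expR (- s) * s <= 1.
  rewrite expRN mulrC ler_pdivrMr ?expR_gt0// mul1r.
  by apply: le_trans (expR_ge1Dx s); rewrite lerDr.
rewrite ler_pdivlMr// (_ : p x * x * x = 2 * h * peak * (expR (- s) * s)); last first.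
  by rewrite pE -/s /s; field; exact: lt0r_neq0.
by rewrite ler_piMr// !mulr_ge0// ltW.
Qed.

(** The fundamental theorem of calculus for psi times the density; the left-hand
side is the mean of its derivative divided by the density. *)
Let truncated_stein (psi psi1 : R -> R) (c : R) (n : nat) :
  (forall x : R, is_derive x 1 psi (psi1 x)) -> continuous psi1 ->
  (forall x, `|psi x| <= `|x| + 1) -> (forall x, `|psi1 x| <= c) ->
  E (fun w => (psi1 (D w) - D w * psi (D w) / h) * window_ind n (D w)) =
  (psi n.+1%:R - psi (- n.+1%:R)) * p n.+1%:R.
Proof.
move=> dpsi cpsi1 psi_le psi1_le.
have cpsi : continuous psi.
  by move=> x; apply: differentiable_continuous; apply/derivable1_diffP; have [] := dpsi x.
have cq : continuous (fun x => psi1 x - x * psi x / h).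
  move=> x; apply: cvgB; first exact: cpsi1.
  apply: cvgM; last exact: cvg_cst.
  by apply: cvgM; [exact: cvg_id|exact: cpsi].
have q_le x : `|psi1 x - x * psi x / h| <= (c + 2 / h) * (1 + x ^+ 2).
  have c0 : 0 <= c by exact: le_trans (psi1_le 0).
  have hi : 0 <= h^-1 by rewrite invr_ge0 ltW.
  apply: (le_trans (ler_normB _ _)); rewrite !normrM (ger0_norm hi).
  have l1 : `|x| * `|psi x| <= 2 * (1 + x ^+ 2).
    apply: (le_trans (ler_wpM2l (normr_ge0 x) (psi_le x))).
    by rewrite -(real_normK (num_real x)); have := normr_ge0 x; nra.
  rewrite mulrDl; apply: lerD.
    by apply: (le_trans (psi1_le x)); rewrite ler_peMr// lerDl sqr_ge0.
  by rewrite [leRHS]mulrAC ler_wpM2r.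
rewrite (mean_truncated n cq q_le).
have ltn : - n.+1%:R < n.+1%:R :> R by rewrite (@lt_trans _ _ 0)// ?oppr_lt0 ltr0n.
pose K x := psi x * p x.
have dK (x : R) : is_derive x 1 K ((psi1 x - x * psi x / h) * p x).
  have := @is_deriveM R R^o _ _ x 1 _ _ (dpsi x) (dp x).
  by move=> H; apply: is_derive_eq H _; rewrite /= /GRing.scale /=; ring.
have cp : continuous p by exact: continuous_normal_pdf.
have cK : continuous K.
  by move=> x; apply: cvgM; [exact: cpsi|exact: cp].
have := @continuous_FTC2 R (fun x => (psi1 x - x * psi x / h) * p x) K _ _ ltn.
rewrite /Rintegral => -> /=.
- by rewrite /K p_even mulrBl.
- apply: continuous_subspaceT => x; apply: cvgM; [exact: cq|exact: cp].
- split.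
  + by move=> x _; have [] := dK x.
  + by apply: cvg_at_right_filter; exact: cK.
  + by apply: cvg_at_left_filter; exact: cK.
- by move=> x _; rewrite derive1E; have [_] := dK x.
Qed.

Let boundary_le (psi : R -> R) (n : nat) : (forall x, `|psi x| <= `|x| + 1) ->
  `|(psi n.+1%:R - psi (- n.+1%:R)) * p n.+1%:R - 0| <= 8 * h * peak * n.+1%:R^-1.
Proof.
move=> psi_le; have n0 : 0 < n.+1%:R :> R by rewrite ltr0n.
have n1 : 1 <= n.+1%:R :> R by rewrite ler1n.
rewrite subr0 normrM (ger0_norm (p_ge0 _)).
have d_le : `|psi n.+1%:R - psi (- n.+1%:R)| <= 4 * n.+1%:R.
  have h1 := psi_le n.+1%:R; have h2 := psi_le (- n.+1%:R).
  have nn : `|n.+1%:R : R| = n.+1%:R by rewrite ger0_norm// ltW.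
  rewrite nn in h1; rewrite normrN nn in h2.
  by apply: (le_trans (ler_normB _ _)); lra.
apply: (le_trans (ler_wpM2r (p_ge0 _) d_le)).
rewrite (_ : 4 * n.+1%:R * p n.+1%:R = 4 * (p n.+1%:R * n.+1%:R)); last by ring.
have := p_tail n0; set y := p _ * _; set z := n.+1%:R^-1; lra.
Qed.

Let window_cvg (x : R) : \forall n \near \oo, window_ind n x = 1.
Proof.
have : \forall n \near \oo, `|x| <= (n : nat)%:R by exact: nbhs_infty_ger.
apply: filterS => n xn; rewrite /window_ind indicE mem_set//= in_itv/= -ler_norml.
by rewrite (le_trans xn)// ler_nat.
Qed.

Let measurable_window n : measurable_fun setT (fun w => window_ind n (D w)).
Proof. by apply: measurableT_comp => //; exact: measurable_indic. Qed.

Let window01 n x : 0 <= window_ind n x <= 1.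
Proof. by rewrite /window_ind indicE; case: (x \in _); rewrite ?lexx ?ler01. Qed.

Let square_integrable : L2 P D.
Proof.
split=> //.
have cst_le (x : R) : `|1 : R| <= 1 by rewrite normr1.
have id_le (x : R) : `|x| <= `|x| + 1 by rewrite lerDl.
have trunc n : E (fun w => D w ^+ 2 * window_ind n (D w)) <= h.
  have nonneg : 0 <= (n.+1%:R - - n.+1%:R) * p n.+1%:R.
    by rewrite mulr_ge0// opprK addr_ge0.
  have ts := @truncated_stein id (fun=> 1) 1 n (fun x => is_derive_id x 1)
    (fun x => cvg_cst _) id_le cst_le.
  rewrite -ts in nonneg.
  have b2 : forall w, `|D w ^+ 2 * window_ind n (D w)| <= n.+1%:R ^+ 2.
    move=> w; rewrite /window_ind indicE; case: (boolP (D w \in _)) => [/set_mem|_].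
      rewrite /= in_itv/= -ler_norml => Dn; rewrite mulr1 normrX.
      by rewrite lerXn2r ?nnegrE.
    by rewrite mulr0 normr0 sqr_ge0.
  have i2 : L1 P (fun w => D w ^+ 2 * window_ind n (D w)).
    apply: L1_bounded b2; apply: measurable_funM => //; exact: measurable_funX.
  have i1 : L1 P (fun w => window_ind n (D w)).
    apply: (@L1_bounded _ _ _ P _ 1) => // w.
    by have /andP[k1 k2] := window01 n (D w); rewrite ger0_norm.
  move: nonneg; rewrite (_ : (fun w => _ * _) = fun w => window_ind n (D w)
    - h^-1 * (D w ^+ 2 * window_ind n (D w))); last first.
    by apply/funext => w; ring.
  rewrite meanB ?meanZ//; last exact: L1Z.
  rewrite subr_ge0 mulrC ler_pdivrMr// => /le_trans; apply.
  rewrite ler_piMl ?(ltW h0)// -[leRHS](mean_cst P 1); apply: le_mean => //; first exact: L1_cst.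
  by move=> w; have /andP[] := window01 n (D w).
have [] // := @mean_le_of_limit _ _ _ P (fun n w => D w ^+ 2 * window_ind n (D w))
  (fun w => D w ^+ 2) h _ _ trunc _ _.
- move=> n; apply: (@L1_bounded _ _ _ P _ (n.+1%:R ^+ 2)).
    by apply: measurable_funM => //; exact: measurable_funX.
  move=> w; rewrite /window_ind indicE; case: (boolP (D w \in _)) => [/set_mem|_].
    rewrite /= in_itv/= -ler_norml => Dn; rewrite mulr1 normrX.
    by rewrite lerXn2r ?nnegrE.
  by rewrite mulr0 normr0 sqr_ge0.
- by move=> n w; have /andP[k1 _] := window01 n (D w); rewrite mulr_ge0// sqr_ge0.
- exact: measurable_funX.
move=> w; apply: cvg_near_cst; have := window_cvg (D w).
by apply: filterS => n ->; rewrite mulr1.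
Qed.

Let stein (psi psi1 : R -> R) (c : R) :
  (forall x : R, is_derive x 1 psi (psi1 x)) -> continuous psi1 ->
  (forall x, `|psi x| <= `|x| + 1) -> (forall x, `|psi1 x| <= c) ->
  E (fun w => D w * psi (D w)) = h * E (fun w => psi1 (D w)).
Proof.
move=> dpsi cpsi1 psi_le psi1_le; have [_ iD2] := square_integrable.
have cpsi : continuous psi.
  by move=> x; apply: differentiable_continuous; apply/derivable1_diffP; have [] := dpsi x.
have mpsi : measurable_fun setT (psi \o D).
  by apply: measurableT_comp => //; exact: continuous_measurable_fun.
have mpsi1 : measurable_fun setT (psi1 \o D).
  by apply: measurableT_comp => //; exact: continuous_measurable_fun.
have mprod : measurable_fun setT (fun w => D w * psi (D w)) by exact: measurable_funM.
have iprod : L1 P (fun w => D w * psi (D w)).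
  apply: (@L1_dominated _ _ _ P _ (fun w => 2 * (1 + D w ^+ 2))) => //.
    by apply: L1Z; apply: L1D => //; exact: L1_cst.
  move=> w; rewrite normrM; apply: (le_trans (ler_wpM2l (normr_ge0 (D w)) (psi_le _))).
  by rewrite -(real_normK (num_real (D w))); have := normr_ge0 (D w); nra.
have i1 : L1 P (fun w => psi1 (D w)).
  exact: (@L1_bounded _ _ _ P (fun w => psi1 (D w)) c mpsi1 (fun w => psi1_le _)).
pose q w := psi1 (D w) - D w * psi (D w) / h.
have iq : L1 P q.
  apply: L1B => //; rewrite (_ : (fun w => _) = fun w => h^-1 * (D w * psi (D w))); first exact: L1Z.
  by apply/funext => w; rewrite mulrC.
have qlim : E (fun w => q w * window_ind n (D w)) @[n --> \oo] --> E q.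
  apply: (@cvg_Rintegral _ _ _ P setT _ q (fun w => `|q w|) measurableT).
  - by move=> n; apply: measurable_funM => //; exact: L1_measurable iq.
  - exact: L1_measurable iq.
  - apply: aeW => w _; apply: cvg_near_cst; have := window_cvg (D w).
    by apply: filterS => n ->; rewrite mulr1.
  - exact: L1_norm.
  - move=> n w _; have /andP[k1 k2] := window01 n (D w).
    by rewrite normrM (ger0_norm k1) ler_piMr.
have q0 : E (fun w => q w * window_ind n (D w)) @[n --> \oo] --> 0.
  apply: (@cvg_perturbed _ _ (fun=> 0) (fun n => n.+1%:R^-1) (8 * h * peak)).
  - by move=> n; rewrite (truncated_stein n dpsi cpsi1 psi_le psi1_le); exact: boundary_le.
  - exact: cvg_harmonic.
  - exact: cvg_cst.
have Eq0 : E q = 0 by have := cvg_unique _ qlim q0; exact.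
have : E q = E (fun w => psi1 (D w)) - h^-1 * E (fun w => D w * psi (D w)).
  rewrite -meanZ// -meanB//; last exact: L1Z.
  by congr mean; apply/funext => w; rewrite /q [X in _ - X = _]mulrC.
rewrite Eq0 => /eqP; rewrite eq_sym subr_eq0 => /eqP ->.
by rewrite mulVKf// lt0r_neq0.
Qed.

(** All the Gaussian integrals needed are instances of Stein's identity, which is
integration by parts against the density. *)
Lemma normal_law_facts : [/\ L2 P D, E (fun w => D w ^+ 2) = h &
  forall l, E (fun w => cos (l * D w)) = expR (- (h * l ^+ 2 / 2)) /\
            E (fun w => sin (l * D w)) = 0].
Proof.
have D2 := square_integrable; split=> //.
  have cst_le (x : R) : `|1 : R| <= 1 by rewrite normr1.
  have id_le (x : R) : `|x| <= `|x| + 1 by rewrite lerDl.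
  have := @stein id (fun=> 1) 1 (fun x => is_derive_id x 1) (fun x => cvg_cst _) id_le cst_le.
  by rewrite mean_cst mulr1 => <-.
have char l : 0 <= l -> E (fun w => cos (l * D w)) = expR (- (h * l ^+ 2 / 2)) /\
            E (fun w => sin (l * D w)) = 0.
  move=> l0.
  have trig m : 0 <= m ->
      E (fun w => D w * sin (m * D w)) = h * m * E (fun w => cos (m * D w)) /\
      E (fun w => D w * cos (m * D w)) = - (h * m * E (fun w => sin (m * D w))).
    move=> m0.
    have dm (x : R) : is_derive x 1 (fun y : R => m * y) m.
      have := @is_deriveM R R^o _ _ x 1 _ _ (is_derive_cst m x 1) (is_derive_id x 1).
      by move=> H; apply: is_derive_eq H _; rewrite /= /GRing.scale /= mulr1 mulr0 addr0.
    have dsin (x : R) : is_derive x 1 (fun y : R => sin (m * y)) (m * cos (m * x)).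
      have := @is_derive1_comp R sin _ x _ _ (is_derive_sin _) (dm x).
      by move=> H; apply: is_derive_eq H _; rewrite mulrC.
    have dcos (x : R) : is_derive x 1 (fun y : R => cos (m * y)) (- m * sin (m * x)).
      have := @is_derive1_comp R cos _ x _ _ (is_derive_cos _) (dm x).
      by move=> H; apply: is_derive_eq H _; ring.
    have cmul (k : R -> R) : continuous k -> continuous (fun x => k (m * x)).
      move=> ck x; apply: (@continuous_comp _ _ _ (fun x => m * x) k); last exact: ck.
      by apply: cvgM; [exact: cvg_cst|exact: cvg_id].
    split.
      rewrite (stein (c := m) dsin).
      - by rewrite meanZ ?mulrA//; exact: L1_cos.
      - move=> x; apply: cvgM; first exact: cvg_cst.
        by apply: cmul; exact: continuous_cos.
      - by move=> x; rewrite (le_trans (norm_sin_le1 _))// lerDr.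
      - by move=> x; rewrite normrM ger0_norm// ler_piMr// norm_cos_le1.
    rewrite (stein (c := m) dcos).
    - by rewrite meanZ ?mulNr ?mulrN ?mulrA//; exact: L1_sin.
    - move=> x; apply: cvgM; first exact: cvg_cst.
      by apply: cmul; exact: continuous_sin.
    - by move=> x; rewrite (le_trans (norm_cos_le1 _))// lerDr.
    - by move=> x; rewrite normrM normrN (ger0_norm m0) ler_piMr// norm_sin_le1.
  have [] := @stein_char _ _ _ P D h l 0 (L2_L1 D2) (ltW h0) l0.
    move=> m /andP[m0 _]; have [-> ->] := trig m m0.
    by rewrite subrr addNr normr0 lexx.
  by rewrite mulr0 !normr_le0 subr_eq0 => /eqP -> /eqP.
move=> l; have [l0|l0] := leP 0 l; first exact: char.
have nl0 : 0 <= - l by rewrite oppr_ge0 ltW.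
have [h1 h2] := char _ nl0; rewrite sqrrN in h1; split.
  rewrite -h1; congr mean; apply/funext => w; by rewrite mulNr cosN.
rewrite -[RHS]oppr0 -h2 -meanN; last exact: L1_sin.
by congr mean; apply/funext => w; rewrite mulNr sinN opprK.
Qed.

End normal_law.

(** * Integrals of step functions against Brownian motion *)

Section brownian_increments.
Context {d : measure_display} {T : measurableType d} {R : realType}.
Variables (P : probability T R) (W : R -> {RV P >-> R}).
Hypothesis hW : brownian_motion W.
Local Notation mu := (@lebesgue_measure R).
Local Notation E := (mean P).

Lemma increment_facts (s t : R) : 0 <= s -> s <= t ->
  [/\ L2 P (fun w => W t w - W s w), E (fun w => (W t w - W s w) ^+ 2) = t - s &
    forall l, E (fun w => cos (l * (W t w - W s w))) = expR (- ((t - s) * l ^+ 2 / 2)) /\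
              E (fun w => sin (l * (W t w - W s w))) = 0].
Proof.
move=> s0; rewrite le_eqVlt => /predU1P[<-|st].
  have -> : (fun w => W s w - W s w) = fun=> 0 by apply/funext => w; rewrite subrr.
  split; first exact: L2_cst.
    by under eq_fun do rewrite subrr expr0n; rewrite mean_cst subrr.
  move=> l; under eq_fun do rewrite subrr mulr0 cos0.
  under [in X in _ /\ X]eq_fun do rewrite subrr mulr0 sin0.
  by rewrite !mean_cst subrr mul0r mul0r oppr0 expR0.
have [_ law _ _] := hW.
apply: (@normal_law_facts _ _ _ P (fun w => W t w - W s w) (t - s)).
- exact: measurable_funB.
- by rewrite subr_gt0.
- by move=> B mB; exact: law.
Qed.

(** Subtracting W 0, which vanishes only almost surely, makes the covariance
formula exact without exceptional sets. *)
Let Z t w := W t w - W 0 w.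

Let Z2 t : 0 <= t -> L2 P (Z t).
Proof. by move=> t0; have [] := increment_facts (lexx 0) t0. Qed.

Let covariance (s t : R) : 0 <= s -> 0 <= t -> E (fun w => Z s w * Z t w) = Num.min s t.
Proof.
wlog st : s t / s <= t.
  move=> hw s0 t0; have [st|/ltW ts] := leP s t; first by rewrite hw// (min_idPl st).
  rewrite -[RHS](min_idPl ts) -(hw t s)//.
  by congr mean; apply/funext => w; rewrite mulrC.
move=> s0 t0; rewrite (min_idPl st).
have [_ vs _] := increment_facts (lexx 0) s0; have [_ vt _] := increment_facts (lexx 0) t0.
have [D2 vst _] := increment_facts s0 st.
rewrite subr0 in vs; rewrite subr0 in vt.
have [_ is_] := Z2 s0; have [_ it] := Z2 t0; have [_ iD] := D2.
have -> : (fun w => Z s w * Z t w) =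
    (fun w => 2^-1 * (Z s w ^+ 2 + (Z t w ^+ 2 - (W t w - W s w) ^+ 2))).
  by apply/funext => w; rewrite /Z; field.
rewrite meanZ; last by apply: L1D => //; exact: L1B.
rewrite meanD//; last exact: L1B.
by rewrite meanB// vs vt vst; field.
Qed.

Let overlap (a b a' b' : R) : 0 <= a <= b -> 0 <= a' <= b' ->
  E (fun w => (W b w - W a w) * (W b' w - W a' w)) =
  Num.min b b' - Num.min b a' - (Num.min a b' - Num.min a a').
Proof.
move=> /andP[a0 ab] /andP[a0' ab'].
have b0 := le_trans a0 ab; have b0' := le_trans a0' ab'.
have iZ u v : 0 <= u -> 0 <= v -> L1 P (fun w => Z u w * Z v w).
  by move=> u0 v0; apply: L2M; exact: Z2.
have -> : (fun w => (W b w - W a w) * (W b' w - W a' w)) =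
    (fun w => (Z b w * Z b' w - Z b w * Z a' w) - (Z a w * Z b' w - Z a w * Z a' w)).
  by apply/funext => w; rewrite /Z; ring.
have i1 := iZ _ _ b0 b0'; have i2 := iZ _ _ b0 a0'; have i3 := iZ _ _ a0 b0'; have i4 := iZ _ _ a0 a0'.
by rewrite meanB ?meanB ?covariance//; exact: L1B.
Qed.

Let indicator (a b : R) : R -> R := \1_(`]a, b]%classic : set R).

Let measurable_indicator a b : measurable_fun setT (indicator a b).
Proof. exact: measurable_indic. Qed.

Let indicator01 a b t : 0 <= indicator a b t <= 1.
Proof. by rewrite /indicator indicE; case: (t \in _); rewrite ?lexx ?ler01. Qed.

Let integral_product (a b : R) : 0 <= a -> 0 <= b -> b <= 1 ->
  \int[mu]_(t in `[0, 1]) (indicator 0 a t * indicator 0 b t) = Num.min a b.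
Proof.
move=> a0 b0 b1.
have m0 : 0 <= Num.min a b by rewrite le_min a0.
have m1 : Num.min a b <= 1 by rewrite ge_min b1 orbT.
have mD : measurable (`]0, Num.min a b]%classic : set (measurableTypeR R)).
  exact: measurable_itv.
transitivity (\int[mu]_(t in `[0, 1]) (\1_(`]0, Num.min a b]%classic : set R) t : R)).
  apply: eq_Rintegral => t _; rewrite /indicator !indicE -natrM mulnb.
  by congr ((nat_of_bool _)%:R); rewrite !mem_setE !in_itv/= le_min andbACA andbb.
rewrite /Rintegral (@integral_indic _ _ _ mu _ _ _ mD); last exact: measurable_itv.
rewrite (_ : `]0, Num.min a b] `&` `[0, 1] = `]0, Num.min a b]%classic); last first.
  apply/setIidPl => t /=; rewrite !in_itv/= => /andP[t0 tm].
  by rewrite (ltW t0) (le_trans tm).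
pose I : set R := `]0, Num.min a b]%classic.
have muE : (mu I = (Num.min a b)%:E)%E.
  rewrite /I lebesgue_measure_itv/= lte_fin; case: ltP => [_|m0']; first by rewrite -EFinB subr0.
  by congr EFin; apply/esym/eqP; rewrite eq_le m0 m0'.
exact: (congr1 fine muE).
Qed.

Definition admissible (k : R * (R * R)) : bool := [&& 0 <= k.2.1, k.2.1 <= k.2.2 & k.2.2 <= 1].

Let mD01 : measurable (`[0, 1]%classic : set (measurableTypeR R)).
Proof. exact: measurable_itv. Qed.

Lemma integrable_overlap a b a' b' :
  mu.-integrable `[0, 1] (EFin \o (fun t => indicator a b t * indicator a' b' t)).
Proof.
apply: (@integrable_bounded _ _ _ 1) => //; first exact: lebesgue_itv_lty.
  by apply: measurable_funTS; exact: measurable_funM.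
move=> t _; have /andP[h1 h2] := indicator01 a b t; have /andP[h3 h4] := indicator01 a' b' t.
by rewrite ger0_norm ?mulr_ge0// mulr_ile1.
Qed.

Lemma integral_overlap (a b a' b' : R) : 0 <= a <= b -> 0 <= a' <= b' -> b <= 1 -> b' <= 1 ->
  \int[mu]_(t in `[0, 1]) (indicator a b t * indicator a' b' t) =
  Num.min b b' - Num.min b a' - (Num.min a b' - Num.min a a').
Proof.
move=> /andP[a0 ab] /andP[a0' ab'] b1 b1'.
have b0 := le_trans a0 ab; have b0' := le_trans a0' ab'.
have a1 := le_trans ab b1; have a1' := le_trans ab' b1'.
have split_ind (u v t : R) : 0 <= u -> u <= v ->
    indicator u v t = indicator 0 v t - indicator 0 u t.
  move=> u0 uv; rewrite /indicator !indicE !mem_setE !in_itv/=.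
  have [ut|tu] := ltP u t.
    by rewrite (le_lt_trans u0 ut)/= subr0.
  by rewrite (le_trans tu uv) andbT/=; case: (0 < t); rewrite subrr.
rewrite -!integral_product//.
have iB (h k : R -> R) : mu.-integrable `[0, 1] (EFin \o h) ->
    mu.-integrable `[0, 1] (EFin \o k) -> mu.-integrable `[0, 1] (EFin \o (fun s => h s - k s)).
  by move=> ih ik; have := @integrableB _ _ _ mu _ mD01 _ _ ih ik.
have io := integrable_overlap.
rewrite -RintegralB// -[X in _ = _ - X]RintegralB// -RintegralB//; [|exact: iB|exact: iB].
by apply: eq_Rintegral => t _; rewrite !(split_ind a b) ?(split_ind a' b')//; ring.
Qed.

Lemma Rintegral01_sum (I : Type) (s : seq I) (Q : pred I) (h : I -> R -> R) :
  (forall i, Q i -> mu.-integrable `[0, 1] (EFin \o h i)) ->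
  mu.-integrable `[0, 1] (EFin \o (fun t => \sum_(i <- s | Q i) h i t)) /\
  \int[mu]_(t in `[0, 1]) (\sum_(i <- s | Q i) h i t) =
  \sum_(i <- s | Q i) \int[mu]_(t in `[0, 1]) h i t.
Proof.
move=> ih; elim: s => [|i s [is_ IH]].
  split; last by rewrite big_nil; under eq_Rintegral do rewrite big_nil; rewrite Rintegral_cst// mul0r.
  under [X in mu.-integrable _ (EFin \o X)]eq_fun do rewrite big_nil.
  exact: (@integrable0 _ _ _ mu).
under [X in mu.-integrable _ (EFin \o X)]eq_fun do rewrite big_cons.
under eq_Rintegral do rewrite big_cons.
rewrite big_cons; have [Qi|//] := boolP (Q i); split; last by rewrite RintegralD ?IH//; exact: ih.
by have := @integrableD _ _ _ mu _ mD01 _ _ (ih i Qi) is_.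
Qed.

(** Both sides are quadratic forms in the coefficients with the same matrix: the
covariances of the increments are the lengths of the overlaps. *)
Lemma step_isometry (p : seq (R * (R * R))) : (forall k, k \in p -> admissible k) ->
  L2 P (step_integral W p) /\
  E (fun w => step_integral W p w ^+ 2) = \int[mu]_(t in `[0, 1]) (step_fun p t ^+ 2).
Proof.
move=> adm.
have filt (F : R * (R * R) -> R) : \sum_(k <- p) F k = \sum_(k <- p | admissible k) F k.
  rewrite big_seq [RHS]big_seq_cond; apply: eq_bigl => k.
  by have [/adm ->|] := boolP (k \in p).
have D2 k : admissible k -> L2 P (fun w => W k.2.2 w - W k.2.1 w).
  by move=> /and3P[h1 h2 _]; have [] := increment_facts h1 h2.
have -> : step_integral W p = fun w => \sum_(k <- p | admissible k) k.1 * (W k.2.2 w - W k.2.1 w).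
  by apply/funext => w; rewrite -filt.
split; first by apply: L2_sum => k /D2 k2; exact: L2Z.
under eq_fun do rewrite expr2 big_distrlr/=.
have iDD k k' : admissible k -> admissible k' -> L1 P (fun w =>
    k.1 * (W k.2.2 w - W k.2.1 w) * (k'.1 * (W k'.2.2 w - W k'.2.1 w))).
  by move=> /D2 k2 /D2 k2'; apply: L2M; exact: L2Z.
rewrite mean_sum; last by move=> k ak; apply: L1_sum => k' ak'; exact: iDD.
have iII k k' : mu.-integrable `[0, 1] (EFin \o (fun t =>
    k.1 * indicator k.2.1 k.2.2 t * (k'.1 * indicator k'.2.1 k'.2.2 t))).
  have := @integrableZl _ _ _ mu _ mD01 (k.1 * k'.1) _ (integrable_overlap k.2.1 k.2.2 k'.2.1 k'.2.2).
  by apply: eq_integrable => // t _ /=; rewrite -EFinM; congr EFin; ring.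
transitivity (\int[mu]_(t in `[0, 1]) (\sum_(k <- p | admissible k)
    \sum_(k' <- p | admissible k')
      k.1 * indicator k.2.1 k.2.2 t * (k'.1 * indicator k'.2.1 k'.2.2 t))); last first.
  by apply: eq_Rintegral => t _; rewrite /step_fun filt expr2 big_distrlr.
rewrite (Rintegral01_sum _ _).2; last by move=> k _; exact: (Rintegral01_sum _ _).1.
apply: eq_bigr => k ak; rewrite mean_sum; last by move=> k' ak'; exact: iDD.
rewrite (Rintegral01_sum _ _).2//; apply: eq_bigr => k' ak'.
have /and3P[h1 h2 h3] := ak; have /and3P[h1' h2' h3'] := ak'.
have iDD1 := L2M (D2 _ ak) (D2 _ ak').
rewrite (_ : (fun w => k.1 * (W k.2.2 w - W k.2.1 w) * (k'.1 * (W k'.2.2 w - W k'.2.1 w))) =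
  fun w => k.1 * k'.1 * ((W k.2.2 w - W k.2.1 w) * (W k'.2.2 w - W k'.2.1 w))); last first.
  by apply/funext => w; ring.
rewrite meanZ// overlap ?h1 ?h1'//.
transitivity (k.1 * k'.1 * \int[mu]_(t in `[0, 1])
    (indicator k.2.1 k.2.2 t * indicator k'.2.1 k'.2.2 t)).
  by rewrite integral_overlap ?h1 ?h1'.
rewrite -(RintegralZl _ mD01); last exact: integrable_overlap.
by apply: eq_Rintegral => t _; ring.
Qed.

Section characteristic_function.
Variables (t : nat -> R) (c : nat -> R) (n : nat) (l : R).
Hypothesis t0 : 0 <= t 0%N.
Hypothesis tS : forall i, t i <= t i.+1.

Let D i w := W (t i.+1) w - W (t i) w.

Let tpos i : 0 <= t i.
Proof. by elim: i => // i IH; exact: le_trans (tS i). Qed.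

Let mD i : measurable_fun setT (D i). Proof. exact: measurable_funB. Qed.

Let J k w := \sum_(0 <= i < k) c i * D i w.

Let mJ k : measurable_fun setT (J k).
Proof. by apply: measurable_sum => i; exact: measurable_funM. Qed.

Let damping k := expR (- (l ^+ 2 * (\sum_(0 <= i < k) c i ^+ 2 * (t i.+1 - t i)) / 2)).

Let law i (B : set R) := fine (P [set w | B (D i w)]).

Let hits (B : nat -> set R) k w : R := \prod_(k <= i < n) \1_(B i) (D i w).

Let mhits (B : nat -> set R) k : (forall i, measurable (B i)) ->
  measurable_fun setT (hits B k).
Proof.
move=> mB; apply: measurable_prod => i _.
by apply: measurableT_comp => //; exact: measurable_indic.
Qed.

Let hits01 (B : nat -> set R) k w : 0 <= hits B k w <= 1.
Proof.
apply: (big_ind (fun x : R => 0 <= x <= 1)); first by rewrite ler01 lexx.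
  by move=> x y /andP[x0 x1] /andP[y0 y1]; rewrite mulr_ge0//= mulr_ile1.
by move=> i _; rewrite indicE; case: (_ \in _); rewrite ?lexx ?ler01.
Qed.

Let bounded_factor (g : T -> R) (B : nat -> set R) k : (forall i, measurable (B i)) ->
  measurable_fun setT g -> (forall w, `|g w| <= 1) -> L1 P (fun w => g w * hits B k w).
Proof.
move=> mB mg g1; apply: (@L1_bounded _ _ _ P _ 1).
  by apply: measurable_funM => //; exact: mhits.
move=> w; have /andP[h0 h1] := hits01 B k w.
by rewrite normrM (ger0_norm h0) -[1]mulr1 ler_pM.
Qed.

Let mcos k th : measurable_fun setT (fun w => cos (l * J k w + th)).
Proof.
apply: measurableT_comp; first exact: continuous_cos_measurable.
by apply: measurable_funD => //; exact: measurable_funM.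
Qed.

(** The increments are integrated out one at a time; the later ones are kept
inside indicators, on which independence is stated. *)
Let partial_char k (B : nat -> set R) (th : R) : (k <= n)%N -> (forall i, measurable (B i)) ->
  E (fun w => cos (l * J k w + th) * hits B k w) =
  damping k * cos th * \prod_(k <= i < n) law i (B i).
Proof.
elim: k B th => [|k IH] B th kn mB.
  have [_ _ indep _] := hW.
  pose S m : set T := [set w | forall i, (i < m)%N -> B i (D i w)].
  have SS m : S m.+1 = S m `&` [set w | B m (D m w)].
    apply/seteqP; split=> w; rewrite /S/=.
      by move=> h; split; [move=> i im; apply: h; exact: ltnW|exact: h].
    by move=> [h1 h2] i; rewrite ltnS leq_eqVlt => /predU1P[->|/h1].
  have mBD i : measurable [set w | B i (D i w)].
    by rewrite -[X in measurable X]setTI; exact: mD.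
  have mS m : measurable (S m).
    elim: m => [|m IH]; last by rewrite SS; exact: measurableI.
    by rewrite (_ : S 0%N = setT)//; apply/seteqP; split.
  have allE w : hits B 0 w = \1_(S n) w.
    rewrite /hits; elim: n {kn} => [|m IHm].
      by rewrite big_geq// (_ : S 0%N = setT) ?indicT//; apply/seteqP; split.
    rewrite big_nat_recr//= IHm SS !indicE in_setI.
    rewrite (_ : (D m w \in B m) = (w \in [set w | B m (D m w)])); last first.
      by apply/idP/idP => /set_mem h; apply/mem_set.
    by rewrite -natrM mulnb.
  have -> : (fun w => cos (l * J 0 w + th) * hits B 0 w) = (fun w => cos th * \1_(S n) w).
    by apply/funext => w; rewrite allE /J big_geq// mulr0 add0r.
  have iS : L1 P (fun w => \1_(S n) w).
    apply: (@L1_bounded _ _ _ P _ 1) => [|w]; first exact: measurable_indic.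
    by rewrite indicE; case: (_ \in _); rewrite ?normr1// normr0.
  have -> : damping 0 = 1 by rewrite /damping big_geq// mulr0 mul0r oppr0 expR0.
  rewrite meanZ// mul1r; congr (_ * _).
  transitivity (fine (P (S n))).
    by rewrite /mean /Rintegral (integral_indic _ _ (mS n))// setIT.
  rewrite /S (indep n t B)//.
  rewrite big_mkord; elim: n {allE kn iS} => [|m IHm]; first by rewrite !big_ord0.
  rewrite !big_ord_recr/= fineM ?IHm//.
    by elim: m {IHm} => [|m IHm]; rewrite ?big_ord0// big_ord_recr/= fin_numM ?fin_num_measure.
  exact: fin_num_measure.
have mcm (h : R -> R) (m : R) : measurable_fun setT h -> measurable_fun setT (fun x : R => h (m * x)).
  by move=> mh; apply: measurableT_comp => //; exact: measurable_funM.
pose B' (B0 : set R) i := if i == k then B0 else B i.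
have mB' B0 : measurable B0 -> forall i, measurable (B' B0 i).
  by move=> mB0 i; rewrite /B'; case: ifP.
have hitsE B0 w : hits (B' B0) k w = \1_B0 (D k w) * hits B k.+1 w.
  rewrite /hits big_ltn// /B' eqxx; congr (_ * _).
  by apply: eq_big_nat => i /andP[ki _]; rewrite gtn_eqF.
pose kap th := damping k * cos th * \prod_(k.+1 <= i < n) law i (B i).
have split_law th' (psi : R -> R) : measurable_fun setT psi -> (forall x, `|psi x| <= 1) ->
    E (fun w => cos (l * J k w + th') * hits B k.+1 w * psi (D k w)) =
    kap th' * E (fun w => psi (D k w)).
  move=> mpsi psi1.
  have iX : L1 P (fun w => cos (l * J k w + th') * hits B k.+1 w).
    by apply: bounded_factor => // w; exact: norm_cos_le1.
  have i2 : L1 P (fun w => psi (D k w)).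
    by apply: (@L1_bounded _ _ _ P _ 1) => //; exact: measurableT_comp.
  rewrite -meanZ//.
  apply: (@Rintegral_agree _ _ _ T T P P _ (D k) _ (D k) iX (L1_cst P (kap th')) (mD k) (mD k)
    _ psi 1 mpsi psi1).
  move=> B0 mB0.
  have := IH (B' B0) th' (ltnW kn) (mB' B0 mB0).
  rewrite big_ltn// {2}/B' eqxx => h.
  rewrite -/(mean P _) -/(mean P _).
  transitivity (E (fun w => cos (l * J k w + th') * hits (B' B0) k w)).
    by congr mean; apply/funext => w; rewrite hitsE mulrCA mulrC.
  rewrite h.
  have -> : \prod_(k.+1 <= i < n) law i (B' B0 i) = \prod_(k.+1 <= i < n) law i (B i).
    by apply: eq_big_nat => i /andP[ki _]; rewrite /B' gtn_eqF.
  have iB0 : L1 P (fun w => \1_B0 (D k w)).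
    apply: (@L1_bounded _ _ _ P _ 1); first by apply: measurableT_comp => //; exact: measurable_indic.
    by move=> w; rewrite indicE; case: (_ \in _); rewrite ?normr1// normr0.
  have -> : law k B0 = E (fun w => \1_B0 (D k w)).
    rewrite /law /mean /Rintegral; congr fine.
    have mS : measurable [set w | B0 (D k w)] by rewrite -[X in measurable X]setTI; exact: mD.
    by rewrite -[X in P X]setIT -(integral_indic _ _ mS).
  by rewrite meanZ// /kap; ring.
have [_ _ /(_ (l * c k))[ec es]] := increment_facts (tpos k) (tS k).
have e1 := split_law th (fun x => cos (l * c k * x))
  (mcm _ _ continuous_cos_measurable) (fun x => norm_cos_le1 _).
have e2 := split_law (th - pi / 2) (fun x => sin (l * c k * x))
  (mcm _ _ continuous_sin_measurable) (fun x => norm_sin_le1 _).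
rewrite ec in e1; rewrite es mulr0 in e2.
have -> : (fun w => cos (l * J k.+1 w + th) * hits B k.+1 w) = (fun w =>
    cos (l * J k w + th) * hits B k.+1 w * cos (l * c k * D k w) -
    cos (l * J k w + (th - pi / 2)) * hits B k.+1 w * sin (l * c k * D k w)).
  apply/funext => w.
  rewrite (_ : l * J k.+1 w + th = (l * J k w + th) + l * c k * D k w); last first.
    by rewrite /J big_nat_recr//=; ring.
  rewrite cosD addrA (cosB (l * J k w + th)) cos_pihalf sin_pihalf; ring.
have mDk (h : R -> R) m : measurable_fun setT h -> measurable_fun setT (fun w => h (m * D k w)).
  by move=> mh; apply: (measurableT_comp (mcm h m mh)).
rewrite meanB; last 2 first.
- rewrite (_ : (fun w => _) = (fun w => cos (l * J k w + th) * cos (l * c k * D k w) * hits B k.+1 w)).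
    apply: bounded_factor => //.
      by apply: measurable_funM => //; exact: mDk continuous_cos_measurable.
    by move=> w; rewrite normrM -[1]mulr1 ler_pM// norm_cos_le1.
  by apply/funext => w; ring.
- rewrite (_ : (fun w => _) = (fun w => cos (l * J k w + (th - pi / 2)) * sin (l * c k * D k w) * hits B k.+1 w)).
    apply: bounded_factor => //.
      by apply: measurable_funM => //; exact: mDk continuous_sin_measurable.
    by move=> w; rewrite normrM -[1]mulr1 ler_pM// ?norm_cos_le1 ?norm_sin_le1.
  by apply/funext => w; ring.
rewrite e1 e2 subr0 /kap.
have -> : damping k.+1 = damping k * expR (- ((t k.+1 - t k) * (l * c k) ^+ 2 / 2)).
  by rewrite /damping big_nat_recr//= -expRD; congr expR; field.
by ring.
Qed.

Lemma char_increment_sum :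
  E (fun w => cos (l * J n w)) = damping n /\ E (fun w => sin (l * J n w)) = 0.
Proof.
have hitsn w : hits (fun=> setT) n w = 1 by rewrite /hits big_geq.
have pc th := @partial_char n (fun=> setT) th (leqnn n) (fun=> measurableT).
split.
  have := pc 0; rewrite big_geq// cos0 !mulr1 => <-.
  by congr mean; apply/funext => w; rewrite hitsn addr0 mulr1.
have := pc (- (pi / 2)); rewrite big_geq// cosN cos_pihalf mulr0 mulr1 => <-.
congr mean; apply/funext => w.
by rewrite hitsn mulr1 cosB cos_pihalf sin_pihalf mulr0 mulr1 add0r.
Qed.

End characteristic_function.
End brownian_increments.

(** * Wiener integrals *)

Section grid.
Context {R : realType}.
Local Notation mu := (@lebesgue_measure R).

Definition grid (g : R -> R) (N : nat) : seq (R * (R * R)) :=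
  [seq (g (i.+1%:R / N%:R), (i%:R / N%:R, i.+1%:R / N%:R)) | i <- iota 0 N].

Lemma grid_admissible (g : R -> R) (N : nat) k : k \in grid g N -> admissible k.
Proof.
move=> /mapP[i]; rewrite mem_iota add0n => /andP[_ iN] ->.
have N0 : 0 < N%:R :> R by rewrite ltr0n (leq_ltn_trans _ iN).
rewrite /admissible/= divr_ge0// ler_pM2r ?invr_gt0// ler_nat leqnSn/=.
by rewrite ler_pdivrMr// mul1r ler_nat.
Qed.

Lemma step_fun_grid (g : R -> R) (N : nat) (t : R) : step_fun (grid g N) t =
  \sum_(0 <= i < N) g (i.+1%:R / N%:R) *
    (\1_(`](i%:R / N%:R), (i.+1%:R / N%:R)]%classic : set R) t : R).
Proof. by rewrite /step_fun /grid big_map/= /index_iota subn0. Qed.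

Lemma measurable_step_fun (p : seq (R * (R * R))) : measurable_fun setT (step_fun p).
Proof.
apply: measurable_sum => k; apply: measurable_funM => //; exact: measurable_indic.
Qed.

Lemma grid_close (g : R -> R) (N : nat) (t y e : R) : (0 < N)%N -> 0 < t <= 1 ->
  (forall s, `|s - t| <= N%:R^-1 -> `|g s - y| <= e) ->
  `|step_fun (grid g N) t - y| <= e.
Proof.
move=> N0 /andP[t0 t1] close; have Np : 0 < N%:R :> R by rewrite ltr0n.
rewrite step_fun_grid.
pose ind i : R := \1_(`](i%:R / N%:R), (i.+1%:R / N%:R)]%classic : set R) t.
have ind0 i : 0 <= ind i by rewrite /ind indicE.
have sum1 : \sum_(0 <= i < N) ind i = 1.
  pose u (i : nat) : R := (t <= i%:R / N%:R)%R%:R.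
  transitivity (\sum_(0 <= i < N) (u i.+1 - u i)).
    apply: eq_bigr => i _; rewrite /ind /u indicE mem_setE in_itv/= ltNge.
    have [ti|_] := boolP (t <= i%:R / N%:R); last by rewrite subr0.
    rewrite (le_trans ti) ?subrr//.
    by rewrite ler_pM2r ?invr_gt0// ler_nat.
  rewrite telescope_sumr// /u mulfV ?gt_eqF// t1 mul0r leNgt t0 subr0//.
have sumE z : z = \sum_(0 <= i < N) z * ind i by rewrite -mulr_sumr sum1 mulr1.
rewrite [X in `|_ - X|]sumE -sumrB [leRHS]sumE.
apply: (le_trans (ler_norm_sum _ _ _)); apply: ler_sum => i _.
rewrite -mulrBl normrM (ger0_norm (ind0 i)).
rewrite /ind indicE; case: (boolP (t \in _)) => [/set_mem|_]; last by rewrite !mulr0.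
rewrite /= in_itv/= !mulr1 => /andP[it ti]; apply: close.
rewrite ger0_norm ?subr_ge0//.
have : i.+1%:R / N%:R = i%:R / N%:R + N%:R^-1 :> R by rewrite -natr1; ring.
by move: it; lra.
Qed.

Section continuous_weight.
Variables (g : R -> R) (C x : R).
Hypothesis mg : measurable_fun setT g.
Hypothesis gC : forall s, `|g s| <= C.
Hypothesis cg : forall t, 0 < t < 1 -> t != x -> {for t, continuous g}.

Let mD01 : measurable (`[0, 1]%classic : set (measurableTypeR R)).
Proof. exact: measurable_itv. Qed.

Lemma grid_bounded (N : nat) (t : R) : `[0, 1]%classic t ->
  `|step_fun (grid g N) t| <= C.
Proof.
rewrite /= in_itv/= => /andP[t0 t1]; have C0 : 0 <= C by exact: le_trans (gC 0).
have [->|N0] := posnP N; first by rewrite step_fun_grid big_geq// normr0.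
move: t0; rewrite le_eqVlt => /predU1P[<-|t0].
  rewrite step_fun_grid big1 ?normr0// => i _; rewrite indicE memNset ?mulr0//=.
  by rewrite in_itv/= => /andP[+ _]; rewrite ltNge divr_ge0.
rewrite -[step_fun _ _]subr0; apply: grid_close => //; first by rewrite t0.
by move=> s _; rewrite subr0.
Qed.

Lemma grid_cvg (t : R) : 0 < t < 1 -> t != x ->
  step_fun (grid g n.+1) t @[n --> \oo] --> g t.
Proof.
move=> /andP[t0 t1] tx; have ct : {for t, continuous g} by apply: cg => //; rewrite t0.
apply/cvgrPdist_le => e e0.
move/cvgrPdist_le: ct => /(_ _ e0) /nbhs_ballP[r /= r0 close].
have h : \forall n \near \oo, (n.+1%:R^-1 : R) < r.
  have := @cvg_harmonic R; move/cvgrPdist_lt => /(_ _ r0); apply: filterS => n.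
  by rewrite sub0r normrN ger0_norm// invr_ge0.
move: h; apply: filterS => n nr; rewrite distrC.
apply: grid_close => //; first by rewrite t0 ltW.
move=> s st; rewrite distrC; apply: close; rewrite /ball/= distrC.
exact: le_lt_trans nr.
Qed.

Lemma grid_L2_cvg :
  \int[mu]_(t in `[0, 1]) ((step_fun (grid g n.+1) t - g t) ^+ 2) @[n --> \oo] --> 0.
Proof.
rewrite [X in _ --> X](_ : 0 = \int[mu]_(t in `[0, 1]) (cst 0 t : R)); last first.
  by rewrite Rintegral_cst// mul0r.
have iC : mu.-integrable `[0, 1] (EFin \o cst ((C + C) ^+ 2)).
  by apply: (@integrable_bounded _ _ _ (`|(C + C) ^+ 2|)) => //; exact: lebesgue_itv_lty.
have C0 : 0 <= C by exact: le_trans (gC 0).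
apply: (cvg_Rintegral mD01 _ _ _ iC).
- move=> n; apply: measurable_funTS; apply: measurable_funX.
  by apply: measurable_funB => //; exact: measurable_step_fun.
- exact: measurable_cst.
- have [N [mN N0 sub]] := ae_interior x.
  exists N; split=> // t /= nt; apply: sub => /= h; apply: nt => /h[t01 tx].
  have d0 : step_fun (grid g n.+1) t - g t @[n --> \oo] --> 0.
    by rewrite -(subrr (g t)); apply: cvgB; [exact: grid_cvg|exact: cvg_cst].
  have : (step_fun (grid g n.+1) t - g t) ^+ 2 @[n --> \oo] --> (0 : R) ^+ 2.
    exact: (cvg_comp _ _ d0 (@exprn_continuous R 2 0)).
  by rewrite expr0n.
- move=> n t t01; rewrite normrX lerXn2r ?nnegrE ?addr_ge0//.
  by rewrite (le_trans (ler_normB _ _))// lerD// grid_bounded.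
Qed.

Lemma Riemann_sum_cvg :
  \sum_(0 <= i < n.+1) g (i.+1%:R / n.+1%:R) * (i.+1%:R / n.+1%:R - i%:R / n.+1%:R)
    @[n --> \oo] --> \int[mu]_(t in `[0, 1]) g t.
Proof.
have iC : mu.-integrable `[0, 1] (EFin \o cst C).
  by apply: (@integrable_bounded _ _ _ (`|C|)) => //; exact: lebesgue_itv_lty.
have sumE n : \sum_(0 <= i < n.+1) g (i.+1%:R / n.+1%:R) * (i.+1%:R / n.+1%:R - i%:R / n.+1%:R) =
    \int[mu]_(t in `[0, 1]) step_fun (grid g n.+1) t.
  pose ind i (t : R) : R := \1_(`](i%:R / n.+1%:R), (i.+1%:R / n.+1%:R)]%classic : set R) t.
  have iind (i : nat) : mu.-integrable `[0, 1] (EFin \o ind i).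
    apply: (@integrable_bounded _ _ _ 1) => //; first exact: lebesgue_itv_lty.
      by apply: measurable_funTS; exact: measurable_indic.
    by move=> t _; rewrite /ind indicE; case: (t \in _); rewrite ?normr1// normr0.
  have igi (i : nat) : mu.-integrable `[0, 1] (EFin \o (fun t => g (i.+1%:R / n.+1%:R) * ind i t)).
    by have := @integrableZl _ _ _ mu _ mD01 (g (i.+1%:R / n.+1%:R)) _ (iind i).
  under [RHS]eq_Rintegral do rewrite step_fun_grid.
  have h i : (i < n.+1)%N -> \int[mu]_(t in `[0, 1]) ind i t = i.+1%:R / n.+1%:R - i%:R / n.+1%:R.
    move=> ilt; have n0 : 0 < n.+1%:R :> R by rewrite ltr0n.
    have le1 : i%:R / n.+1%:R <= i.+1%:R / n.+1%:R :> R by rewrite ler_pM2r ?invr_gt0// ler_nat.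
    have le2 : i.+1%:R / n.+1%:R <= 1 :> R by rewrite ler_pdivrMr// mul1r ler_nat.
    have le0 : 0 <= i%:R / n.+1%:R :> R by rewrite divr_ge0.
    have abh : 0 <= (i%:R / n.+1%:R : R) <= i.+1%:R / n.+1%:R by rewrite le0.
    have := integral_overlap abh abh le2 le2.
    rewrite minxx (min_idPr le1) (min_idPl le1) minxx subrr subr0 => <-.
    apply: eq_Rintegral => t _; rewrite /ind indicE.
    by case: (t \in _); rewrite ?mulr1// mulr0.
  rewrite (Rintegral01_sum _ (fun i _ => igi i)).2 big_nat [RHS]big_nat.
  apply: eq_bigr => i /andP[_ ilt].
  by rewrite -(h i ilt) -(RintegralZl _ mD01).
under eq_cvg do rewrite sumE.
apply: (cvg_Rintegral mD01 _ _ _ iC).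
- by move=> n; apply: measurable_funTS; exact: measurable_step_fun.
- exact: measurable_funTS.
- have [N [mN N0 sub]] := ae_interior x.
  exists N; split=> // t /= nt; apply: sub => /= h; apply: nt => /h[t01 tx].
  exact: grid_cvg.
- by move=> n t t01; exact: grid_bounded.
Qed.

End continuous_weight.
End grid.

Section L2_limits.
Context {d : measure_display} {T : measurableType d} {R : realType}.
Variable P : probability T R.
Local Notation E := (mean P).

Lemma mean_ae_eq (X Y : T -> R) (N : set T) : measurable N -> P N = 0%E ->
  (forall w, ~ N w -> X w = Y w) -> L1 P X -> measurable_fun setT Y ->
  L1 P Y /\ E X = E Y.
Proof.
move=> mN PN XY iX mY; have mX := L1_measurable iX.
have ae_XY : ae_eq P setT (EFin \o X) (EFin \o Y).
  by exists N; split=> // w /= nXY; apply: contrapT => /XY e; apply: nXY => _; rewrite e.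
split; last first.
  by congr fine; apply: ae_eq_integral => //; exact/measurable_EFinP.
apply/integrableP; split; first exact/measurable_EFinP.
have [_ fX] := integrableP _ _ _ iX.
rewrite -(@ae_eq_integral _ _ _ P setT (fun w => `|(EFin \o Y) w|)%E (fun w => `|(EFin \o X) w|)%E)//.
- by apply: measurableT_comp => //; exact/measurable_EFinP.
- by apply: measurableT_comp => //; exact/measurable_EFinP.
- by exists N; split=> // w /= nXY; apply: contrapT => /XY e; apply: nXY => _; rewrite e.
Qed.

(** The successive distances are summable, which forces almost sure convergence;
Fatou's lemma then bounds the distance to the limit. *)
Lemma L2_complete (J : nat -> T -> R) : (forall n, L2 P (J n)) ->
  (forall n j, E (fun w => (J (n + j)%N w - J n w) ^+ 2) <= (2^-1 ^+ n) ^+ 2) ->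
  exists2 v : T -> R, L2 P v & forall n, E (fun w => (J n w - v w) ^+ 2) <= (2^-1 ^+ n) ^+ 2.
Proof.
move=> J2 JC.
have mJ n := L1_measurable (L2_L1 (J2 n)).
pose u k w := `|J k.+1 w - J k w|.
have u0 k w : 0 <= u k w by exact: normr_ge0.
have D2 n j : L2 P (fun w => J (n + j)%N w - J n w) by exact: L2B.
have iu k : L1 P (u k) by apply: L1_norm; apply: L2_L1; exact: L2B.
have uE k : E (u k) <= 2^-1 ^+ k.
  apply: mean_norm_le_L2; [exact: L2B|exact: exprn_ge0|].
  by have := JC k 1%N; rewrite addn1.
have mu_ k : measurable_fun setT (EFin \o u k) by exact: measurable_int (iu k).
pose S (w : T) : \bar R := (\sum_(k <oo) (u k w)%:E)%E.
have intS : (\int[P]_w S w <= 2%:E)%E.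
  rewrite integral_nneseries//; last by move=> n w _; rewrite lee_fin.
  apply: lime_le.
    by apply: is_cvg_nneseries => n _ _; apply: integral_ge0 => w _; rewrite lee_fin.
  apply: nearW => n.
  rewrite (eq_bigr (fun k => (E (u k))%:E)); last first.
    by move=> k _; rewrite /mean /Rintegral fineK//; exact: (integrable_fin_num _ (iu k)).
  rewrite sumEFin lee_fin.
  apply: (@le_trans _ _ (\sum_(0 <= k < n) 2^-1 ^+ k)); first by apply: ler_sum.
  suff -> : \sum_(0 <= k < n) 2^-1 ^+ k = 2 - 2 * 2^-1 ^+ n :> R.
    by rewrite gerBl mulr_ge0// exprn_ge0.
  elim: n => [|n IH]; first by rewrite big_nil expr0 mulr1 subrr.
  by rewrite big_nat_recr//= IH exprS; field.
have mS : measurable_fun setT S.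
  exact: (@ge0_emeasurable_sum _ _ _ setT (fun k w => (u k w)%:E) xpredT
    (fun k w _ _ => u0 k w) (fun k _ => mu_ k)).
have iS : P.-integrable setT S.
  apply/integrableP; split; first exact: mS.
  rewrite (eq_integral S); first by apply: (le_lt_trans intS); rewrite ltry.
  by move=> w _; rewrite gee0_abs// nneseries_ge0// => k _ _; rewrite lee_fin.
have [N [mN PN subN]] := integrable_ae measurableT iS.
have cvgJ w : ~ N w -> cvgn (fun n => J n w).
  move=> Nw; have finS : S w \is a fin_num.
    by apply: contrapT => nf; apply: Nw; apply: subN => /= h; apply: nf; exact: h.
  have cu : cvgn [normed series (fun k => J k.+1 w - J k w)].
    apply: nondecreasing_is_cvgn.
      apply/nondecreasing_seqP => n; rewrite -subr_ge0 seriesSB.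
      exact: normr_ge0.
    exists (fine (S w)) => _ [n _ <-]; rewrite /series/= -lee_fin fineK// -sumEFin.
    by apply: nneseries_lim_ge => k _ _; rewrite lee_fin.
  have := normed_cvg cu; rewrite (_ : series _ = (fun n => J n w - J 0%N w)); last first.
    by apply/funext => n; rewrite /series/= telescope_sumr.
  move=> /cvg_ex[L JL]; apply/cvg_ex; exists (L + J 0%N w).
  have -> : (fun n => J n w) = (fun n => (J n w - J 0%N w) + J 0%N w).
    by apply/funext => n; rewrite subrK.
  by apply: cvgD => //; exact: cvg_cst.
(* With this factor the sequence converges at every point, so that its limit is
measurable. *)
pose G (w : T) : R := \1_(~` N) w.
have mG : measurable_fun setT G by apply: measurable_indic; exact: measurableC.
have GN w : ~ N w -> G w = 1 by move=> Nw; rewrite /G indicE mem_set.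
have GN0 w : N w -> G w = 0 by move=> Nw; rewrite /G indicE memNset//; apply.
pose v w := lim (J n w * G w @[n --> \oo]).
have JGv w : J n w * G w @[n --> \oo] --> v w.
  have [Nw|Nw] := pselect (N w).
    rewrite /v GN0//; under eq_fun do rewrite mulr0.
    by rewrite lim_cst//; exact: cvg_cst.
  by apply: is_cvgM; [exact: cvgJ|exact: is_cvg_cst].
have mv : measurable_fun setT v.
  apply: (@measurable_fun_cvg _ _ _ _ (fun n w => J n w * G w)).
    by move=> n; exact: measurable_funM.
  by move=> w _; exact: JGv.
have Jv w : ~ N w -> J n w @[n --> \oo] --> v w.
  by move=> Nw; have := JGv w; rewrite GN//; under eq_fun do rewrite mulr1.
have close n : L1 P (fun w => (J n w - v w) ^+ 2) /\
    E (fun w => (J n w - v w) ^+ 2) <= (2^-1 ^+ n) ^+ 2.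
  pose X j w := (J (n + j)%N w - J n w) ^+ 2 * G w.
  have iX j : L1 P (X j) /\ E (X j) <= (2^-1 ^+ n) ^+ 2.
    have [_ iD] := D2 n j.
    have mX : measurable_fun setT (X j).
      apply: measurable_funM => //; apply: measurable_funX; exact: measurable_funB.
    have [|h1 <-//] := mean_ae_eq mN PN _ iD mX.
    by move=> w Nw; rewrite /X GN// mulr1.
  have X0 j w : 0 <= X j w.
    by rewrite /X mulr_ge0 ?sqr_ge0// /G indicE.
  have mY : measurable_fun setT (fun w => (v w - J n w) ^+ 2 * G w).
    by apply: measurable_funM => //; apply: measurable_funX; exact: measurable_funB.
  have [|iY EY] := mean_le_of_limit (fun j => (iX j).1) X0 (fun j => (iX j).2) mY.
    move=> w; have [Nw|Nw] := pselect (N w).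
      by rewrite /X GN0// mulr0; under eq_fun do rewrite mulr0; exact: cvg_cst.
    rewrite /X GN//; apply: cvgM; last exact: cvg_cst.
    have d0 : J (n + j)%N w - J n w @[j --> \oo] --> v w - J n w.
      apply: cvgB; last exact: cvg_cst.
      exact: (cvg_comp _ _ (@cvg_addnl n) (Jv w Nw)).
    exact: (cvg_comp _ _ d0 (@exprn_continuous R 2 _)).
  have mZ : measurable_fun setT (fun w => (J n w - v w) ^+ 2).
    by apply: measurable_funX; exact: measurable_funB.
  have [|h1 h2] := mean_ae_eq mN PN _ iY mZ; last by rewrite -h2.
  by move=> w Nw; rewrite GN// mulr1 -sqrrN opprB.
exists v; last by move=> n; have [] := close n.
have v2 : L2 P (fun w => J 0%N w - v w).
  by split; [exact: measurable_funB|have [] := close 0%N].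
rewrite (_ : v = fun w => J 0%N w - (J 0%N w - v w)); first exact: L2B.
by apply/funext => w; rewrite opprB addrC subrK.
Qed.

End L2_limits.

Section wiener.
Context {d : measure_display} {T : measurableType d} {R : realType}.
Variables (P : probability T R) (W : R -> {RV P >-> R}).
Hypothesis hW : brownian_motion W.
Local Notation mu := (@lebesgue_measure R).
Local Notation E := (mean P).
Variables (g : R -> R) (C x : R).
Hypothesis mg : measurable_fun setT g.
Hypothesis gC : forall s, `|g s| <= C.
Hypothesis cg : forall t, 0 < t < 1 -> t != x -> {for t, continuous g}.

Let mD01 : measurable (`[0, 1]%classic : set (measurableTypeR R)).
Proof. exact: measurable_itv. Qed.

Let C0 : 0 <= C. Proof. exact: le_trans (gC 0). Qed.

Let energy : R := \int[mu]_(t in `[0, 1]) (g t ^+ 2).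

Let cell (N i : nat) : R := i%:R / N%:R.

Let Riemann N : R := \sum_(0 <= i < N) g (cell N i.+1) ^+ 2 * (cell N i.+1 - cell N i).

Let half_cvg : (2^-1 : R) ^+ n @[n --> \oo] --> 0.
Proof. by apply: cvg_expr; rewrite ger0_norm// invf_lt1// ltr1n. Qed.

(** These geometric rates are what [L2_complete] asks of the integrals of the step
functions; the factor 4 pays for comparing two of them through g. *)
Let sizes : exists N : nat -> nat, forall k,
  \int[mu]_(t in `[0, 1]) ((step_fun (grid g (N k)) t - g t) ^+ 2) <= (2^-1 ^+ k) ^+ 2 / 4 /\
  `|Riemann (N k) - energy| <= 2^-1 ^+ k.
Proof.
have half0 k : 0 < (2^-1 : R) ^+ k by rewrite exprn_gt0.
suff /choice[N NP] : forall k : nat, exists n : nat,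
    \int[mu]_(t in `[0, 1]) ((step_fun (grid g n) t - g t) ^+ 2) <= (2^-1 ^+ k) ^+ 2 / 4 /\
    `|Riemann n - energy| <= 2^-1 ^+ k by exists N.
move=> k.
have e0 : 0 < (2^-1 ^+ k : R) ^+ 2 / 4 by rewrite divr_gt0// exprn_gt0.
have := grid_L2_cvg mg gC cg; move/cvgrPdist_le => /(_ _ e0) h1.
have mg2 : measurable_fun setT (fun t => g t ^+ 2) by exact: measurable_funX.
have g2C s : `|g s ^+ 2| <= C ^+ 2 by rewrite normrX lerXn2r ?nnegrE.
have cg2 t : 0 < t < 1 -> t != x -> {for t, continuous (fun t => g t ^+ 2)}.
  by move=> t01 tx; exact: (cvg_comp _ _ (cg t01 tx) (@exprn_continuous R 2 _)).
have := Riemann_sum_cvg mg2 g2C cg2; move/cvgrPdist_le => /(_ _ (half0 k)) h2.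
near \oo => n; exists n.+1; split; last by rewrite distrC; near: n.
have : `|0 - \int[mu]_(t in `[0, 1]) ((step_fun (grid g n.+1) t - g t) ^+ 2)| <=
    (2^-1 ^+ k) ^+ 2 / 4 by near: n.
by rewrite sub0r normrN; apply: le_trans; exact: ler_norm.
Unshelve. all: by end_near. Qed.

(** A difference of step functions is again encoded by a list. *)
Let opposite (p : seq (R * (R * R))) := [seq (- k.1, k.2) | k <- p].

Let step_fun_difference (p q : seq (R * (R * R))) t :
  step_fun (p ++ opposite q) t = step_fun p t - step_fun q t.
Proof.
rewrite /step_fun big_cat/= big_map -sumrN; congr (_ + _).
by apply: eq_bigr => k _; rewrite mulNr.
Qed.

Let step_integral_difference (p q : seq (R * (R * R))) w :
  step_integral W (p ++ opposite q) w = step_integral W p w - step_integral W q w.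
Proof.
rewrite /step_integral big_cat/= big_map -sumrN; congr (_ + _).
by apply: eq_bigr => k _; rewrite mulNr.
Qed.

Let isquare (h k : R -> R) : measurable_fun setT h -> measurable_fun setT k ->
  (forall t, `[0, 1]%classic t -> `|h t| <= C) -> (forall t, `[0, 1]%classic t -> `|k t| <= C) ->
  mu.-integrable `[0, 1] (EFin \o (fun t => (h t - k t) ^+ 2)).
Proof.
move=> mh mk hC kC; apply: (@integrable_bounded _ _ _ ((C + C) ^+ 2)) => //.
- exact: lebesgue_itv_lty.
- by apply: measurable_funTS; apply: measurable_funX; exact: measurable_funB.
move=> t t01; rewrite normrX lerXn2r ?nnegrE ?addr_ge0//.
by rewrite (le_trans (ler_normB _ _))// lerD ?hC ?kC.
Qed.

(** The integrand is a limit in mean square of step functions on equal cells,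
chosen fine enough for the isometry to make their integrals converge fast. The
characteristic function passes to the limit. *)
Lemma wiener_integral_exists : exists v : {RV P >-> R},
  [/\ forall g0 : R -> R, (forall t, `[0, 1]%classic t -> g0 t = g t) -> wiener_integral W g0 v,
      L2 P v, E (fun w => v w ^+ 2) <= (C + 1) ^+ 2 &
      forall l, 0 <= l ->
        E (fun w => cos (l * v w)) = expR (- (energy * l ^+ 2 / 2)) /\
        E (fun w => sin (l * v w)) = 0].
Proof.
have [N NP] := sizes.
pose p k := grid g (N k); pose f k := step_fun (p k).
pose J k := step_integral W (p k).
have adm k : forall i, i \in p k -> admissible i by move=> i; exact: grid_admissible.
have mf k : measurable_fun setT (f k) by exact: measurable_step_fun.
have fC k t : `[0, 1]%classic t -> `|f k t| <= C by exact: (grid_bounded gC).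
have J2 k : L2 P (J k) by have [] := step_isometry hW (adm k).
have gC' t : `[0, 1]%classic t -> `|g t| <= C by [].
have Cauchy n j : E (fun w => (J (n + j)%N w - J n w) ^+ 2) <= (2^-1 ^+ n) ^+ 2.
  have admd : forall i, i \in p (n + j)%N ++ opposite (p n) -> admissible i.
    move=> i; rewrite mem_cat => /orP[/adm//|/mapP[k /adm ak ->]].
    exact: ak.
  have [_] := step_isometry hW admd.
  under eq_fun do rewrite step_integral_difference.
  under eq_Rintegral do rewrite step_fun_difference.
  move=> ->; have [d1 _] := NP (n + j)%N; have [d2 _] := NP n.
  have i1 := isquare (mf (n + j)%N) mg (fC _) gC'; have i2 := isquare (mf n) mg (fC _) gC'.
  have i12 := isquare (mf (n + j)%N) (mf n) (fC _) (fC _).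
  have iD := @integrableD _ _ _ mu _ mD01 _ _ i1 i2.
  have i2D : mu.-integrable `[0, 1]
      (EFin \o (fun t => 2 * ((f (n + j)%N t - g t) ^+ 2 + (f n t - g t) ^+ 2))).
    by have := @integrableZl _ _ _ mu _ mD01 2 _ iD.
  apply: (@le_trans _ _ (\int[mu]_(t in `[0, 1])
      (2 * ((f (n + j)%N t - g t) ^+ 2 + (f n t - g t) ^+ 2)))).
    apply: le_Rintegral => // t _; rewrite -subr_ge0.
    rewrite [X in 0 <= X](_ : _ = (f (n + j)%N t + f n t - 2 * g t) ^+ 2); last by rewrite /f; ring.
    exact: sqr_ge0.
  rewrite RintegralZl// RintegralD//.
  have pow_le : (2^-1 ^+ (n + j) : R) ^+ 2 <= (2^-1 ^+ n) ^+ 2.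
    rewrite lerXn2r ?nnegrE ?exprn_ge0// exprD ler_piMr ?exprn_ge0//.
    by rewrite exprn_ile1// invf_le1// ler1n.
  move: d1 d2 pow_le; rewrite /f /p; lra.
have [v v2 Jv] := L2_complete J2 Cauchy.
have mv : measurable_fun setT v by have [] := v2.
pose V : {RV P >-> R} := HB.pack v (isMeasurableFun.Build _ _ _ _ v mv).
have D2 n : L2 P (fun w => J n w - v w) by exact: L2B.
exists V; split => //.
- move=> g0 g0E; split.
    have : measurable_fun (`[0, 1]%classic : set R) g by exact: measurable_funTS.
    by apply: eq_measurable_fun => t /set_mem /g0E.
  exists p; split.
  + by move=> n k /adm.
  + have eE n : (\int[mu]_(t in `[0%R, 1%R]) ((step_fun (p n) t - g0 t) ^+ 2)%R%:E)%E =
        (\int[mu]_(t in `[0, 1]) ((f n t - g t) ^+ 2))%:E.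
      rewrite /Rintegral fineK.
        by apply: eq_integral => t /set_mem t01; rewrite g0E.
      exact: (@integrable_fin_num _ _ _ mu _ mD01 _ (isquare (mf n) mg (fC _) gC')).
    under eq_cvg do rewrite eE.
    apply: cvg_EFin; first exact: nearW.
    apply: (@cvg_perturbed _ _ (fun=> 0) (fun n => 2^-1 ^+ n) 1) => //; last exact: cvg_cst.
    move=> n; rewrite subr0 mul1r ger0_norm; last first.
      by apply: Rintegral_ge0 => t _; exact: sqr_ge0.
    have [d1 _] := NP n; apply: (le_trans d1).
    have h0 : 0 <= (2^-1 : R) ^+ n by rewrite exprn_ge0.
    have h1 : (2^-1 : R) ^+ n <= 1 by rewrite exprn_ile1// invf_le1// ler1n.
    by move: h0 h1; move: (2^-1 ^+ n) => y y0 y1; nra.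
  + have eE n : 'E_P[fun w => ((step_integral W (p n) w - V w) ^+ 2)%R]%E =
        (E (fun w => (J n w - v w) ^+ 2))%:E.
      by rewrite expectation_mean//; have [] := D2 n.
    under eq_cvg do rewrite eE.
    apply: cvg_EFin; first exact: nearW.
    apply: (@cvg_perturbed _ _ (fun=> 0) (fun n => 2^-1 ^+ n) 1) => //; last exact: cvg_cst.
    move=> n; rewrite subr0 mul1r ger0_norm; last first.
      by apply: mean_ge0 => w; exact: sqr_ge0.
    apply: (le_trans (Jv n)).
    have h0 : 0 <= (2^-1 : R) ^+ n by rewrite exprn_ge0.
    have h1 : (2^-1 : R) ^+ n <= 1 by rewrite exprn_ile1// invf_le1// ler1n.
    by move: h0 h1; move: (2^-1 ^+ n) => y y0 y1; nra.
- have -> : (fun w => V w ^+ 2) = (fun w => (J 0%N w + (v w - J 0%N w)) ^+ 2).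
    by apply/funext => w; rewrite addrC subrK.
  apply: mean_sqrD => //; first exact: L2B.
  + have [_ ->] := step_isometry hW (adm 0%N).
    rewrite -[leRHS]mulr1 -[X in _ * X](subr0 1) -(fine_lebesgue_itv (@ler01 R)).
    apply: (le_trans (ler_norm _)); apply: norm_Rintegral_le => //.
      exact: lebesgue_itv_lty.
      by apply: measurable_funTS; exact: (measurable_funX 2 (mf 0%N)).
    by move=> t t01; rewrite normrX lerXn2r ?nnegrE//; exact: fC.
  + by have := Jv 0%N; rewrite !expr0 expr1n; under eq_fun do rewrite -sqrrN opprB.
move=> l l0.
have JE k w : J k w = \sum_(0 <= i < N k) g (cell (N k) i.+1) *
    (W (cell (N k) i.+1) w - W (cell (N k) i) w).
  by rewrite /J /step_integral /p /grid big_map/= /index_iota subn0.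
have char k := @char_increment_sum _ _ _ P W hW (cell (N k)) (fun i => g (cell (N k) i.+1)) (N k) l.
have cell0 k : 0 <= cell (N k) 0 by rewrite /cell mul0r.
have cellS k i : cell (N k) i <= cell (N k) i.+1.
  by rewrite /cell ler_wpM2r ?invr_ge0// ler_nat.
have dist k := char_distance l0 (L1_measurable (L2_L1 (J2 k))) mv (L2_L1 (D2 k)).
have Jv1 k : E (fun w => `|J k w - v w|) <= 2^-1 ^+ k.
  by apply: mean_norm_le_L2 => //; exact: exprn_ge0.
have JEf k : J k = fun w => \sum_(0 <= i < N k) g (cell (N k) i.+1) *
    (W (cell (N k) i.+1) w - W (cell (N k) i) w) by apply/funext => w; exact: JE.
have cosJ k : E (fun w => cos (l * J k w)) = expR (- (l ^+ 2 * Riemann (N k) / 2)).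
  by rewrite JEf; have [] := char k (cell0 k) (cellS k).
have sinJ k : E (fun w => sin (l * J k w)) = 0.
  by rewrite JEf; have [] := char k (cell0 k) (cellS k).
have Rcvg : Riemann (N k) @[k --> \oo] --> energy.
  apply: (@cvg_perturbed _ _ (fun=> energy) (fun n => 2^-1 ^+ n) 1) => //; last exact: cvg_cst.
  by move=> n; rewrite mul1r; have [] := NP n.
have lim1 : expR (- (l ^+ 2 * Riemann (N k) / 2)) @[k --> \oo] --> expR (- (energy * l ^+ 2 / 2)).
  apply: continuous_cvg; first exact: continuous_expR.
  apply: cvgN; apply: cvgM; last exact: cvg_cst.
  by rewrite mulrC; apply: cvgM => //; exact: cvg_cst.
have lim2 : expR (- (l ^+ 2 * Riemann (N k) / 2)) @[k --> \oo] --> E (fun w => cos (l * v w)).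
  apply: (@cvg_perturbed _ _ (fun=> E (fun w => cos (l * v w))) (fun n => 2^-1 ^+ n) l) => //;
    last exact: cvg_cst.
  move=> n; rewrite -cosJ; have [d1 _] := dist n; apply: (le_trans d1).
  by rewrite ler_wpM2l.
have lim3 : 0 @[k --> \oo] --> E (fun w => sin (l * v w)).
  apply: (@cvg_perturbed _ (fun=> 0) (fun=> E (fun w => sin (l * v w))) (fun n => 2^-1 ^+ n) l) => //;
    last exact: cvg_cst.
  move=> n; rewrite -(sinJ n); have [_ d1] := dist n; apply: (le_trans d1).
  by rewrite ler_wpM2l.
split; first exact: (cvg_unique _ lim2 lim1).
exact: (cvg_unique _ lim3 (cvg_cst 0)).
Qed.

End wiener.

(** * Convergence in distribution of the rescaled error *)

Section convergence_in_distribution.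
Context {d : measure_display} {T : measurableType d} {R : realType}.
Variables (A : R -> R -> T -> R) (Q : probability T R).
Hypothesis hA : measurable_field A.
Variables nu1 nu2 : T -> R -> R.
Hypothesis hell : pathwise_elliptic A nu1 nu2.
Variables (c1 c2 : R).
Hypothesis hmean : mean_hypothesis A Q c1 c2.
Variable C6 : R.
Hypothesis hmom : sixth_moment_bound A Q C6.
Variable Gamma : R -> R.
Hypothesis hcov : cov_hypothesis A Q Gamma.
Hypothesis hcont : cov_continuous_diag A Q.
Hypothesis hmix : mixing A Q.
Variable f : R -> R.
Hypothesis hf : square_integrable01 f.
Context {d' : measure_display} {T' : measurableType d'}.
Variables (P' : probability T' R) (W : R -> {RV P' >-> R}).
Hypothesis hW : brownian_motion W.
Variable x : R.
Hypothesis x01 : 0 <= x <= 1.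
Local Notation mu := (@lebesgue_measure R).
Local Notation g := (kernel A Q f x).
Local Notation lag := (lag_integral A Q).

Let weight (t : R) : R := g t * Num.sqrt (lag t).

Let continuous_lag : continuous lag.
Proof. exact: (continuous_lag_integral hA hell hmean hmom hcov hcont). Qed.

Let mlag : measurable_fun setT lag.
Proof. by apply: continuous_measurable_fun; exact: continuous_lag. Qed.

Let mweight : measurable_fun setT weight.
Proof.
apply: measurable_funM; first exact: measurable_kernel.
apply: measurableT_comp => //; apply: continuous_measurable_fun; exact: sqrt_continuous.
Qed.

Let weight_bounded : exists C, forall t, `|weight t| <= C.
Proof.
have [C gC] := kernel_bounded A Q hf x.
exists (C * Num.sqrt (\int[mu]_q Gamma q)) => t.
rewrite normrM ler_pM//; rewrite ger0_norm// ler_wsqrtr//.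
apply: (le_trans (ler_norm _)).
exact: (lag_integral_le hA hell hmean hmom hcov).
Qed.

Let continuous_weight t : 0 < t < 1 -> t != x -> {for t, continuous weight}.
Proof.
move=> t01 tx; have csqrt : {for t, continuous (fun s => Num.sqrt (lag s))}.
  apply: (@continuous_comp _ _ _ lag (@Num.sqrt R)); first exact: continuous_lag.
  exact: sqrt_continuous.
exact: (cvgM (continuous_kernel hf t01 tx) csqrt).
Qed.

Let mD01 : measurable (`[0, 1]%classic : set (measurableTypeR R)).
Proof. exact: measurable_itv. Qed.

(** The square root in sigma squares back to the integral of the covariance only
where that integral is nonnegative, which is almost everywhere. *)
Let weight_energy :
  \int[mu]_(t in `[0, 1]) (weight t ^+ 2) = limit_variance A Q f x.
Proof.
have [N [mN N0 sub]] := lag_integral_ge0_ae hA hell hmean hmom hcov hcont.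
have m1 : measurable_fun (`[0, 1] : set R) (EFin \o (fun t => weight t ^+ 2)).
  by apply/measurable_EFinP; apply: measurable_funTS; exact: measurable_funX.
have m2 : measurable_fun (`[0, 1] : set R) (EFin \o (fun t => g t ^+ 2 * lag t)).
  apply/measurable_EFinP; apply: measurable_funTS; apply: measurable_funM => //.
  by apply: measurable_funX; exact: measurable_kernel.
have ae : ae_eq mu (`[0, 1]%classic : set (measurableTypeR R)) (EFin \o (fun t => weight t ^+ 2))
    (EFin \o (fun t => g t ^+ 2 * lag t)).
  exists N; split=> // t /= nt; apply: sub => /= lag0; apply: nt => t01.
  by rewrite /weight exprMn sqr_sqrtr// lag0.
exact: (congr1 fine (@ae_eq_integral _ _ _ mu _ _ _ mD01 m1 m2 ae)).
Qed.

Let weightE t : `[0, 1]%classic t -> kernelG f (A0 A Q) x t * sigma A Q t = weight t.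
Proof.
by rewrite /= in_itv/= => t01; rewrite /weight /kernel /sigma /lag_integral clamp_id.
Qed.

(** By [cvg_char_solution] and [wiener_integral_exists] the limit of the
characteristic functions of the rescaled errors is the one of the integral. *)
Lemma wiener_limit_exists : exists v : {RV P' >-> R},
  wiener_integral W (fun t => kernelG f (A0 A Q) x t * sigma A Q t) v /\
  cvg_in_distribution Q (fun eps w =>
    (solution f (fun s => Aeps A eps s w) x - solution f (A0 A Q) x) / Num.sqrt eps) v.
Proof.
have [C wC] := weight_bounded.
have [v [vW v2 vC vchar]] := wiener_integral_exists hW mweight wC continuous_weight.
exists v; split; first exact: (vW _ weightE).
pose X (eps : R) (w : T) : R :=
  (solution f (fun s => Aeps A eps s w) x - solution f (A0 A Q) x) / Num.sqrt eps.
have [K XS] := solution_fluctuation hA hell hmean hmom hcov hf x01.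
have mX eps : 0 < eps -> measurable_fun setT (X eps) by move=> /XS[].
split => // h ch [M hM].
have mh : measurable_fun setT h by exact: continuous_measurable_fun.
have mean_h eps : 0 < eps -> 'E_Q[h \o X eps]%E = (mean Q (fun w => h (X eps w)))%:E.
  move=> eps0; rewrite -expectation_mean//.
  by apply: (@L1_bounded _ _ _ Q _ M) => //; apply: measurableT_comp => //; exact: mX.
have -> : 'E_P'[h \o v]%E = (mean P' (fun w => h (v w)))%:E.
  rewrite -expectation_mean//.
  by apply: (@L1_bounded _ _ _ P' _ M) => //; exact: measurableT_comp.
apply: (@cvg_trans _ ((mean Q (fun w => h (X eps w)))%:E @[eps --> (0 : R)^'+])).
  apply: near_eq_cvg; near=> eps; rewrite mean_h//; near: eps; exact: nbhs_right_gt.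
apply: cvg_EFin; first exact: nearW.
apply/cvg_at_rightP => u [u0 u_0].
(* The estimates hold for eps <= 1, hence along a tail of the sequence. *)
have [N uN] : exists N, forall n, u (n + N)%N <= 1.
  move/cvgrPdist_le: u_0 => /(_ 1 ltr01) [N _ uN]; exists N => n.
  have := uN (n + N)%N (leq_addl _ _); rewrite sub0r normrN; apply: le_trans.
  exact: ler_norm.
rewrite -(cvg_shiftn N).
pose u' n := u (n + N)%N.
have u'0 n : 0 < u' n by exact: u0.
have u'_0 : u' n @[n --> \oo] --> 0 by move: u_0; rewrite -(cvg_shiftn N).
have [K1 XK] := solution_first_moment hA hell hmean hmom hcov hf x01 u'0 uN.
have vK : mean P' (fun w => `|v w|) <= C + 1.
  by apply: mean_norm_le_L2 => //; rewrite addr_ge0// (le_trans _ (wC 0)).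
have char l (l0 : 0 <= l) := cvg_char_solution hA hell hmean hmom hcov hcont hmix hf x01
  u'0 uN u'_0 l0.
apply: (@cvg_mean_of_char _ _ _ _ _ Q P' (fun n => X (u' n)) v (Num.max K1 (C + 1))) => //.
- by move=> n; have [] := XK n.
- exact: L2_L1.
- by move=> n; have [_ h1] := XK n; rewrite le_max h1.
- by rewrite le_max vK orbT.
- by move=> l l0; have [-> _] := vchar l l0; rewrite weight_energy; have [] := char l l0.
- by move=> l l0; have [_ ->] := vchar l l0; have [] := char l l0.
- by exists M.
Unshelve. all: by end_near. Qed.

End convergence_in_distribution.

Theorem theorem3p2 (R : realType)
  (d : measure_display) (Omega : measurableType d) (P : probability Omega R)
  (m : nat) (xi : {RV P >-> m.-tuple R})
  (Pxi : m.-tuple R -> probability Omega R)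
  (hPxi : conditional_probability xi Pxi)
  (A : R -> R -> Omega -> R) (hA : measurable_field A)
  (nu1 nu2 : Omega -> R -> R) (hell : pathwise_elliptic A nu1 nu2)
  (f : R -> R) (hf : square_integrable01 f)
  (z : m.-tuple R)
  (c1 : m.-tuple R -> R) (c2 : R) (hmean : mean_hypothesis A (Pxi z) (c1 z) c2)
  (Gamma : R -> R) (hcov : cov_hypothesis A (Pxi z) Gamma)
  (hstat : stationary_in_y A (Pxi z))
  (hcont : cov_continuous_diag A (Pxi z))
  (hmix : mixing A (Pxi z))
  (Cxi : m.-tuple R -> R) (hmom : sixth_moment_bound A (Pxi z) (Cxi z))
  (d' : measure_display) (Omega' : measurableType d') (P' : probability Omega' R)
  (W : R -> {RV P' >-> R}) (hW : brownian_motion W) :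
  exists v : R -> {RV P' >-> R},
    forall x : R, x \in `[0, 1] ->
      wiener_integral W
        (fun t => kernelG f (A0 A (Pxi z)) x t * sigma A (Pxi z) t) (v x) /\
      cvg_in_distribution (Pxi z)
        (fun eps w => (solution f (fun s => Aeps A eps s w) x
                       - solution f (A0 A (Pxi z)) x) / Num.sqrt eps)
        (v x).
Proof.
have ex x : exists v : {RV P' >-> R}, x \in `[0, 1] ->
    wiener_integral W (fun t => kernelG f (A0 A (Pxi z)) x t * sigma A (Pxi z) t) v /\
    cvg_in_distribution (Pxi z) (fun eps w => (solution f (fun s => Aeps A eps s w) x
      - solution f (A0 A (Pxi z)) x) / Num.sqrt eps) v.
  have [x01|_] := boolP (x \in `[0, 1]); last by exists (W 0).
  rewrite in_itv/= in x01.
  by have [v h] := wiener_limit_exists hA hell hmean hmom hcov hcont hmix hf hW x01; exists v.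
by have [v h] := choice ex; exists v.
Qed.
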